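(* Let $\alpha(x)$ be a sub-polynomial such that $\lim_{x\to+\infty}\alpha(x)=+\infty$. Suppose also that for all $p(x)\in\mathbb{Q}[x]$, $$\lim_{x\to+\infty}|\alpha(x)-p(x)|=+\infty.$$ Then for every finite coloring of $\mathbb{N}$, there are distinct $x,y\in\mathbb{N}$ of the same color and $n\in\mathbb{N}$ such that $x+y=\lfloor\alpha(n)\rfloor$.
   Context: $\mathbb{N}=\{1,2,\dots\}$. Let $\mathcal{G}$ be the ring (under pointwise addition and multiplication) of germs at $+\infty$ of continuous real-valued functions defined on half-lines $(a,+\infty)$; two functions have the same germ if they agree for all sufficiently large $x$. A Hardy field is a subfield of $\mathcal{G}$ closed under differentiation (each element is eventually differentiable and its derivative's germ lies in the field). A sub-polynomial is a function $\alpha$ whose germ belongs to some Hardy field and which satisfies $\lim_{x\to+\infty}\alpha(x)/x^l=0$ for some $l>0$. Functions and germs are not distinguished; when values $\alpha(n)$, $n\in\mathbb{N}$, appear, $\alpha$ denotes a fixed real-valued representative defined on $[1,+\infty)$. *)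

(* Defs.v *)
From HB Require Import structures.
From mathcomp Require Import all_boot all_order all_algebra.
From mathcomp Require Import all_classical all_reals all_analysis.

Set Implicit Arguments.
Unset Strict Implicit.
Unset Printing Implicit Defensive.

Import Order.TTheory GRing.Theory Num.Theory.
Import numFieldNormedType.Exports.

Local Open Scope classical_set_scope.
Local Open Scope ring_scope.

Definition germ_eq (R : realType) (f g : R -> R) : Prop :=
  \forall x \near +oo, f x = g x.

(* A function on a half-line is represented by any total extension, and a set
   of germs by the set of all representatives of its members; this is the role
   of [hardy_germ]. *)
Record hardy_field (R : realType) (H : set (R -> R)) : Prop := HardyField {
  hardy_germ : forall f g, germ_eq f g -> H f -> H g;
  hardy_continuous : forall f, H f -> \forall x \near +oo, {for x, continuous f};
  hardy_one : H (cst 1);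
  hardy_sub : forall f g, H f -> H g -> H (f \- g);
  hardy_mul : forall f g, H f -> H g -> H (f \* g);
  hardy_inv : forall f, H f -> ~ germ_eq f (cst 0) ->
    exists2 g, H g & germ_eq (f \* g) (cst 1);
  hardy_derivable : forall f, H f -> \forall x \near +oo, derivable f x 1;
  hardy_derive : forall f, H f -> H (derive1 f)
}.

Definition sub_polynomial (R : realType) (alpha : R -> R) : Prop :=
  (exists2 H : set (R -> R), hardy_field H & H alpha) /\
  (exists2 l : R, 0 < l & alpha x / x `^ l @[x --> +oo] --> (0 : R)).

(* Main.v *)
(* Suppose that the colouring has no solution.  The derivatives of alpha up to
   some order k have power-like growth and the next one tends to 0.  If k = 0,
   alpha grows so slowly that its integer parts miss no large integer.

   If k > 0, look at a window [N, N + K] with K = eta N and at the graph on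
   an interval of T ~ alpha(N + K) - alpha(N) integers where x and y are joined
   when x + y is a value of floor(alpha) on the window.  A colour class is
   dense and has no edge, so by Parseval on Z/JT, smoothed by a Fejer kernel,
   some sum of e(j alpha(n) / T) over the window is large, 0 < j < JT.  An
   inverse theorem (van der Corput differencing, Kusmin-Landau) then forces
   (j / T) alpha to follow a polynomial with rational coefficients up to O(1)
   on a positive proportion of a progression in the window.  Since this happens
   at every scale N, alpha(n0 + p m) = lam P(m) + beta(m) with P integer valued
   and beta(m+1) - beta(m) = O(1/m).

   In that case restrict to m for which P equals Pi0 + D q(t), where
   q(t) = t + Q0 s(t), and to the integers floor(lam D i + rho) whose
   fractional part lies in [1/16, 7/16].  Over a window on which beta is almost
   constant, i + j = q(t) gives a solution.  The shape of q removes the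
   congruence obstructions to i + j = q(t), so the same graph argument now
   succeeds, provided a positive proportion of the i is admissible.  For lam
   irrational this is equidistribution; for lam rational lam D is an integer,
   and the hypothesis on rational polynomials says that beta is unbounded, so
   that rho can be moved into a good position. *)

Require Import Defs.
From HB Require Import structures.
From mathcomp Require Import all_boot all_order all_algebra.
From mathcomp Require Import all_classical all_reals all_analysis.
From mathcomp Require Import complex.
From mathcomp Require Import ring lra zify.

Import Order.TTheory GRing.Theory Num.Theory.
Import numFieldNormedType.Exports.

Local Open Scope classical_set_scope.
Local Open Scope ring_scope.

Set Implicit Arguments.
Unset Strict Implicit.
Unset Printing Implicit Defensive.

(* Two obstacles shape the proof. First, floor(alpha(n)) is not additive, so x + y = floor(alpha(n))
   is replaced by the real condition that alpha(n) - x - y lies within 1/2 of 1/2; the Fejer kernel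
   detects it up to O(1/J), which is why frequencies j/T beyond 1 occur and why alpha is never
   rounded in the exponential sums. Second, large sums cannot be excluded, as polynomials have them.
   One window only says that alpha is near some polynomial, with unknown frequency th = j/T and
   unknown coefficients. Windows at different scales become comparable because the leading
   coefficient is a bounded integer: it can be frozen, together with the residue modulo p, along
   infinitely many N, and th then converges.

   In the polynomial case fractional parts are kept in the first half of [0, 1), so that two of them
   add without carry and i + j = q(t) passes to the integer parts.

   The order of the constants matters: the number of colours fixes J and eps, then eps fixes p and
   M, and only then is the window ratio eta chosen, so small that phases of bounded frequency are
   almost linear and have small sums. *)
Tactic Notation "lraw" ne_hyp_list(l) := clear - l; lra.

Ltac pos := first [ assumption | exact: ltr01 | exact: ler01 |
  lazymatch goal with
  | |- is_true (0 < _ * _) => apply: mulr_gt0; pos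
  | |- is_true (0 <= _ * _) => apply: mulr_ge0; pos
  | |- is_true (0 < _ + _) => apply: addr_gt0; pos
  | |- is_true (0 <= _ + _) => apply: addr_ge0; pos
  | |- is_true (0 < _^-1) => rewrite invr_gt0; pos
  | |- is_true (0 <= _^-1) => rewrite invr_ge0; pos
  | |- is_true (0 < _ ^+ _) => apply: exprn_gt0; pos
  | |- is_true (0 <= _ ^+ _) => apply: exprn_ge0; pos
  | |- is_true (0 <= `|_|) => exact: normr_ge0
  | |- is_true (0 <= _%:R) => exact: ler0n
  | |- is_true (0 < _%:R) => rewrite ltr0n; done
  | |- is_true (0 < ?x) => is_var x; unfold x; pos
  | |- is_true (0 <= _) => apply: ltW; pos
  end ].

(** * Elementary estimates and the character e(x) *)

Lemma mvt_closed (R : realType) (f df : R -> R) (a b : R) : a <= b ->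
  (forall x, a <= x <= b -> is_derive x 1 f (df x)) ->
  exists2 c, a <= c <= b & f b - f a = df c * (b - a).
Proof.
move=> ab fd.
have h1 x : x \in `]a, b[ -> is_derive x 1 f (df x).
  by rewrite in_itv /= => /andP[x1 x2]; apply: fd; rewrite !ltW.
have h2 : {within `[a, b], continuous f}.
  apply: derivable_within_continuous => x; rewrite in_itv /= => xab.
  by case: (fd x xab).
by have [c cab ->] := MVT_segment ab h1 h2; exists c => //; move: cab; rewrite in_itv.
Qed.

Lemma sin_le_id (R : realType) (y : R) : 0 <= y -> sin y <= y.
Proof.
move=> y0; have [c _] := @mvt_closed R sin cos 0 y y0 (fun x _ => is_derive_sin x).
rewrite sin0 !subr0 => ->; have := cos_le1 c; nra.
Qed.

Lemma norm_sin_le (R : realType) (y : R) : `|sin y| <= `|y|.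
Proof.
wlog y0 : y / 0 <= y.
  move=> H; have [/H //|y0] := leP 0 y.
  by rewrite -normrN -sinN -(normrN y); apply: H; lra.
rewrite (ger0_norm y0) ler_norml (sin_le_id y0) andbT.
have [c _] := @mvt_closed R sin cos 0 y y0 (fun x _ => is_derive_sin x).
rewrite sin0 !subr0 => ->; have := cos_geN1 c; nra.
Qed.

Lemma cos_half_le (R : realType) (y : R) : `|y| <= 1 -> 1 / 2 <= cos y.
Proof.
move=> y1; rewrite (_ : cos y = cos ((y / 2) *+ 2)); last by congr cos; lra.
rewrite cos_mulr2n cos2sin2; move: (norm_sin_le (y / 2)); set t := sin _ => h.
have : t ^+ 2 <= (1 / 4).
  rewrite -(real_normK (num_real _)).
  have h2 : `|y / 2| <= 1 / 2 by rewrite normrM (ger0_norm (_ : 0 <= 2^-1)); lra.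
  have := normr_ge0 t; nra.
by move=> h3; rewrite -mulr_natr; lra.
Qed.

Lemma sin_ge_half (R : realType) (y : R) : 0 <= y <= 1 -> y / 2 <= sin y.
Proof.
move=> /andP[y0 y1].
have [c /andP[c0 c1]] := @mvt_closed R sin cos 0 y y0 (fun x _ => is_derive_sin x).
rewrite sin0 !subr0 => ->; have : 1 / 2 <= cos c by apply: cos_half_le; rewrite ger0_norm; lra.
nra.
Qed.

Lemma pi_bounds (R : realType) : 2 <= pi :> R /\ pi <= 4 :> R.
Proof. by have := pihalf_02 R; have := pi_ge2 R; lra. Qed.

(** The range extends to 7/8, well beyond 1/2, because [graph_hit] meets arguments up to slightly
    more than 3/4 of a period. *)
Lemma sin_pi_ge (R : realType) (s : R) : 0 <= s <= 7 / 8 -> s / 16 <= sin (pi * s).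
Proof.
move=> /andP[s0 s1]; have [p2 p4] := pi_bounds R.
have lo (t : R) : 0 <= t <= 1 / 2 -> t / 2 <= sin (pi * t).
  move=> /andP[t0 t1]; have [t4|t4] := lerP t (1 / 4).
    have := @sin_ge_half R (pi * t); nra.
  have : sin (pi * (1 / 4)) <= sin (pi * t).
    by rewrite ltW // ltr_sin ?in_itv /=; [nra | apply/andP; split; nra | apply/andP; split; nra].
  have := @sin_ge_half R (pi * (1 / 4)); nra.
have [s2|s2] := lerP s (1 / 2); first by have := lo s; lra.
have -> : sin (pi * s) = sin (pi * (1 - s)).
  by rewrite mulrBr mulr1 sinB sinpi cospi; ring.
have := lo (1 - s); lra.
Qed.

(** The modulus with values in [R]; the norm of [R[i]] takes its values in [R[i]]. *)
Definition nc (R : rcfType) (z : R[i]) : R := Num.sqrt (complex.Re z ^+ 2 + complex.Im z ^+ 2).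

Lemma ncE (R : rcfType) (z : R[i]) : nc z = ComplexField.Normc.normc z.
Proof. by case: z. Qed.

Lemma nc0 (R : rcfType) : nc (0 : R[i]) = 0.
Proof. by rewrite ncE ComplexField.Normc.normc0. Qed.
Lemma nc1 (R : rcfType) : nc (1 : R[i]) = 1.
Proof. by rewrite ncE ComplexField.Normc.normc1. Qed.
Lemma ncM (R : rcfType) (x y : R[i]) : nc (x * y) = nc x * nc y.
Proof. by rewrite !ncE ComplexField.Normc.normcM. Qed.
Lemma ncV (R : rcfType) (x : R[i]) : nc x^-1 = (nc x)^-1.
Proof. by rewrite !ncE ComplexField.Normc.normcV. Qed.
Lemma ncD (R : rcfType) (x y : R[i]) : nc (x + y) <= nc x + nc y.
Proof. by rewrite !ncE le_normcD. Qed.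
Lemma ncN (R : rcfType) (x : R[i]) : nc (- x) = nc x.
Proof. by rewrite !ncE normcN. Qed.
Lemma nc_ge0 (R : rcfType) (x : R[i]) : 0 <= nc x.
Proof. exact: sqrtr_ge0. Qed.
Lemma nc_eq0 (R : rcfType) (x : R[i]) : nc x = 0 -> x = 0.
Proof. by rewrite ncE => /ComplexField.Normc.eq0_normc. Qed.
Lemma nc_sqr (R : rcfType) (z : R[i]) : nc z ^+ 2 = complex.Re z ^+ 2 + complex.Im z ^+ 2.
Proof. by rewrite sqr_sqrtr // addr_ge0 ?sqr_ge0. Qed.
Lemma nc_real (R : rcfType) (x : R) : nc (x%:C)%C = `|x|.
Proof. by rewrite /nc /= expr0n addr0 sqrtr_sqr. Qed.
Lemma ncB (R : rcfType) (x y : R[i]) : nc x - nc y <= nc (x - y).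
Proof. by have := ncD (x - y) y; rewrite subrK; lra. Qed.
Lemma nc_distC (R : rcfType) (x y : R[i]) : nc (x - y) = nc (y - x).
Proof. by rewrite -ncN opprB. Qed.
Lemma nc_sum (R : rcfType) (I : Type) (r : seq I) (P : pred I) (F : I -> R[i]) :
  nc (\sum_(i <- r | P i) F i) <= \sum_(i <- r | P i) nc (F i).
Proof.
elim/big_rec2 : _ => [|i x y _ h]; first by rewrite nc0.
by apply: le_trans (ncD _ _) _; rewrite lerD2l.
Qed.
Lemma nc_sum_le (R : rcfType) (n : nat) (F : nat -> R[i]) (c : R) :
  (forall i, (i < n)%N -> nc (F i) <= c) -> nc (\sum_(i < n) F i) <= c * n%:R.
Proof.
move=> h; apply: le_trans (nc_sum _ _ _) _.
apply: le_trans (_ : \sum_(i < n) c <= _); first by apply: ler_sum => i _; exact: h.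
by rewrite sumr_const card_ord mulr_natr.
Qed.

Definition ee (R : realType) (x : R) : R[i] := Complex (cos (2 * pi * x)) (sin (2 * pi * x)).

Arguments ee : simpl never.

Lemma eeD (R : realType) (x y : R) : ee (x + y) = ee x * ee y.
Proof.
rewrite /ee mulrDr cosD sinD; apply/eqP; rewrite eq_complex /=.
by apply/andP; split; apply/eqP; ring.
Qed.
Lemma ee0 (R : realType) : ee (0 : R) = 1.
Proof. by rewrite /ee mulr0 cos0 sin0. Qed.
Lemma nc_ee (R : realType) (x : R) : nc (ee x) = 1.
Proof. by rewrite /nc /ee /= cos2Dsin2 sqrtr1. Qed.
Lemma ee_neq0 (R : realType) (x : R) : ee x != 0.
Proof. by apply/eqP => h; have := nc_ee x; rewrite h nc0; lra. Qed.
Lemma eeN (R : realType) (x : R) : ee (- x) = (ee x)^-1.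
Proof. by apply: (mulIf (ee_neq0 x)); rewrite -eeD addNr ee0 mulVf ?ee_neq0. Qed.
Lemma ee_conj (R : realType) (x : R) : (ee x)^*%C = ee (- x).
Proof. by rewrite /ee mulrN cosN sinN. Qed.
Lemma eeB (R : realType) (x y : R) : ee (x - y) = ee x / ee y.
Proof. by rewrite eeD eeN. Qed.
Lemma ee1 (R : realType) : ee (1 : R) = 1.
Proof.
rewrite /ee mulr1; have -> : 2 * pi = pi *+ 2 :> R by rewrite mulr2n; ring.
by rewrite cos2pi sin2pi.
Qed.
Lemma ee_nat (R : realType) (n : nat) : ee (n%:R : R) = 1.
Proof. by elim: n => [|n IH]; rewrite ?ee0 // -natr1 eeD IH ee1 mulr1. Qed.
Lemma ee_int (R : realType) (m : int) : ee (m%:~R : R) = 1.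
Proof.
case: m => n; first by rewrite -pmulrn ee_nat.
by rewrite NegzE mulrNz eeN -pmulrn ee_nat invr1.
Qed.
Lemma eeDint (R : realType) (x : R) (m : int) : ee (x + m%:~R) = ee x.
Proof. by rewrite eeD ee_int mulr1. Qed.
Lemma eeX (R : realType) (x : R) (n : nat) : ee x ^+ n = ee (n%:R * x).
Proof. by elim: n => [|n IH]; rewrite ?mul0r ?ee0 // exprS IH -eeD -natr1; congr ee; ring. Qed.

Lemma nc_ee_sub1 (R : realType) (s : R) : nc (ee s - 1) = 2 * `|sin (pi * s)|.
Proof.
have e : nc (ee s - 1) ^+ 2 = (2 * `|sin (pi * s)|) ^+ 2.
  rewrite nc_sqr /ee /= oppr0 addr0.
  have -> : 2 * pi * s = (pi * s) *+ 2 by rewrite mulr2n; ring.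
  rewrite cos_mulr2n sin_mulr2n exprMn real_normK ?num_real //.
  have : cos (pi * s) ^+ 2 = 1 - sin (pi * s) ^+ 2 by rewrite cos2sin2.
  rewrite !mulr2n; set c := cos _; set t := sin _ => h.
  have -> : (c * t + c * t) ^+ 2 = 4 * c ^+ 2 * t ^+ 2 by ring.
  by rewrite h; ring.
by apply/eqP; rewrite -(@eqrXn2 _ 2) ?e ?mulr_ge0 ?nc_ge0.
Qed.

Lemma Im_ee (R : realType) (x : R) : complex.Im (ee x) = sin (2 * pi * x).
Proof. by []. Qed.

Opaque ee.

Lemma ee_lip1 (R : realType) (s : R) : nc (ee s - 1) <= 8 * `|s|.
Proof.
rewrite nc_ee_sub1; have := norm_sin_le (pi * s); rewrite normrM.
have [p2 p4] := pi_bounds R; rewrite (ger0_norm (_ : 0 <= pi)); last lra.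
have := normr_ge0 s; nra.
Qed.

Lemma ee_lip (R : realType) (x y : R) : nc (ee x - ee y) <= 8 * `|x - y|.
Proof.
have -> : ee x - ee y = ee y * (ee (x - y) - 1).
  by rewrite mulrBr -eeD mulr1 [y + _]addrC subrK.
by rewrite ncM nc_ee mul1r ee_lip1.
Qed.

Lemma ee_sub1_ge (R : realType) (s : R) : `|s| <= 7 / 8 -> `|s| / 8 <= nc (ee s - 1).
Proof.
rewrite nc_ee_sub1; wlog s0 : s / 0 <= s.
  move=> H; have [/H //|y0] := leP 0 s.
  by have := H (- s); rewrite mulrN sinN !normrN; apply; lra.
rewrite (ger0_norm s0) => s1; have := @sin_pi_ge R s; have := ler_norm (sin (pi * s)); lra.
Qed.

Definition expsum (R : realType) (f : nat -> R) (L : nat) : R[i] := \sum_(n < L) ee (f n).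
Definition dl (V : zmodType) (f : nat -> V) (n : nat) : V := f n.+1 - f n.
Definition dh (V : zmodType) (h : nat) (f : nat -> V) (n : nat) : V := f (n + h)%N - f n.

Lemma expsum_le (R : realType) (f : nat -> R) (L : nat) : nc (expsum f L) <= L%:R.
Proof.
by have := @nc_sum_le R L (fun n => ee (f n)) 1; rewrite mul1r; apply => i _; rewrite nc_ee.
Qed.

Lemma eq_expsum (R : realType) (f g : nat -> R) (L : nat) :
  (forall n, (n < L)%N -> f n = g n) -> expsum f L = expsum g L.
Proof. by move=> h; apply: eq_bigr => i _; rewrite h. Qed.

Lemma expsumD (R : realType) (f : nat -> R) (a b : nat) :
  expsum f (a + b) = expsum f a + expsum (fun n => f (a + n)%N) b.
Proof. by rewrite /expsum big_split_ord. Qed.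

Lemma expsum_cst (R : realType) (f : nat -> R) (c : R) (L : nat) :
  nc (expsum (fun n => f n + c) L) = nc (expsum f L).
Proof.
rewrite /expsum; under eq_bigr do rewrite eeD.
by rewrite -mulr_suml ncM nc_ee mulr1.
Qed.

Lemma expsumN (R : realType) (f : nat -> R) (L : nat) :
  expsum (fun n => - f n) L = (expsum f L)^*%C.
Proof. by rewrite /expsum rmorph_sum; apply: eq_bigr => i _; rewrite -ee_conj. Qed.

Lemma nc_conj (R : rcfType) (z : R[i]) : nc z^*%C = nc z.
Proof. by case: z => a b; rewrite /nc /= sqrrN. Qed.

Lemma expsum_close (R : realType) (f g : nat -> R) (L : nat) (c : R) :
  (forall n, (n < L)%N -> `|f n - g n| <= c) ->
  nc (expsum f L - expsum g L) <= 8 * c * L%:R.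
Proof.
move=> h; rewrite /expsum -sumrB.
apply: (@nc_sum_le R L (fun n => ee (f n) - ee (g n))) => i iL.
by apply: le_trans (ee_lip _ _) _; rewrite ler_wpM2l // h.
Qed.

Lemma expsum_shift (R : realType) (f : nat -> R) (h L : nat) :
  nc (expsum (fun n => f (n + h)%N) L - expsum f L) <= 2 * h%:R.
Proof.
have e : expsum f h + expsum (fun n => f (n + h)%N) L
    = expsum f L + expsum (fun n => f (L + n)%N) h.
  rewrite -expsumD addnC expsumD; congr (_ + _).
  by apply: eq_expsum => n _; rewrite addnC.
have -> : expsum (fun n => f (n + h)%N) L - expsum f L
    = expsum (fun n => f (L + n)%N) h - expsum f h.
  by apply/eqP; rewrite subr_eq addrAC eq_sym subr_eq addrC -e addrC.
apply: le_trans (ncD _ _) _; rewrite ncN mulrDl !mul1r; apply: lerD; exact: expsum_le.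
Qed.

Lemma nc_sqrE (R : rcfType) (z : R[i]) : (nc z ^+ 2)%:C%C = z * z^*%C.
Proof. by rewrite nc_sqr; case: z => a b; rewrite /= ; simpc; congr Complex; ring. Qed.

Lemma sqr_sum_le (R : realType) (n : nat) (F : nat -> R) :
  (\sum_(i < n) F i) ^+ 2 <= n%:R * \sum_(i < n) F i ^+ 2.
Proof.
elim: n => [|n IH]; first by rewrite !big_ord0 expr0n mul0r.
rewrite !big_ord_recr /=; set s := \sum_(i < n) _ in IH *; set q := \sum_(i < n) _ in IH *.
rewrite -natr1.
case: n => [|n] in s q IH *; last first.
  have n0 : 0 < n.+1%:R :> R by rewrite ltr0n.
  set y := F _; set N := n.+1%:R in IH n0 *.
  have : 0 <= (s - N * y) ^+ 2 := sqr_ge0 _.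
  move=> h; rewrite -(ler_pM2l n0).
  have -> : N * (s + y) ^+ 2 = (N + 1) * (s ^+ 2 + N * y ^+ 2) - (s - N * y) ^+ 2 by ring.
  have : (N + 1) * (s ^+ 2 + N * y ^+ 2) <= (N + 1) * (N * q + N * y ^+ 2).
    by apply: ler_wpM2l; lra.
  lra.
by rewrite /s /q !big_ord0 !add0r mul1r.
Qed.

Lemma natr_above (R : realType) (x : R) : exists2 n : nat, (0 < n)%N & x <= n%:R.
Proof.
exists (Num.bound `|x|).+1 => //; apply: le_trans (ler_norm x) _.
by apply: ltW; apply: lt_le_trans (archi_boundP (normr_ge0 x)) _; rewrite ler_nat.
Qed.

Lemma nc_sum_sqr (R : rcfType) (H : nat) (z : nat -> R[i]) :
  (nc (\sum_(h < H) z h) ^+ 2)%:C%C = \sum_(h < H) \sum_(j < H) z h * (z j)^*%C.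
Proof.
rewrite nc_sqrE rmorph_sum mulr_suml; apply: eq_bigr => h _.
by rewrite mulr_sumr.
Qed.

(** * Differences and exponential sums *)

(** Van der Corput's inequality. The sum of [dh h f] over [l] terms reads [f] up to [l + h], so
    nothing is cut off at the boundary here; [fast_small] and [near_const] shorten [l]
    beforehand. *)
Lemma vdc (R : realType) (eps : R) : 0 < eps ->
  exists (H : nat) (e' : R) (l0 : nat), [/\ 0 < e', (0 < H)%N &
    forall (f : nat -> R) (l : nat), (l0 <= l)%N -> eps * l%:R <= nc (expsum f l) ->
    exists2 h : nat, (0 < h <= H)%N & e' * l%:R <= nc (expsum (dh h f) l)].
Proof.
move=> e0.
have [H H0 Hb] := natr_above (16 / eps ^+ 2).
have [l0 l00 l0b] := natr_above (64 * H%:R / eps ^+ 2 + 4 * H%:R / eps).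
exists H, (eps ^+ 2 / 16), l0; split=> // [|f l ll hS].
  by rewrite divr_gt0 // exprn_gt0.
have HR : 0 < H%:R :> R by rewrite ltr0n.
have e2 : 0 < eps ^+ 2 by rewrite exprn_gt0.
have lR : l0%:R <= l%:R :> R by rewrite ler_nat.
have l1 : 64 * H%:R / eps ^+ 2 <= l%:R.
  have : 0 <= 4 * H%:R / eps by rewrite divr_ge0 // ?mulr_ge0 // ltW.
  lra.
have l2 : 4 * H%:R / eps <= l%:R.
  have : 0 <= 64 * H%:R / eps ^+ 2 by rewrite divr_ge0 // ?mulr_ge0 // ltW.
  lra.
rewrite ler_pdivrMr // in l1; rewrite ler_pdivrMr // in l2; rewrite ler_pdivrMr // in Hb.
have l0R : 0 < l%:R :> R by apply: lt_le_trans lR; rewrite ltr0n.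
apply: contrapT => hno.
have small h : (0 < h <= H)%N -> nc (expsum (dh h f) l) <= eps ^+ 2 / 16 * l%:R.
  by move=> hh; rewrite leNgt; apply/negP => hlt; apply: hno; exists h => //; exact: ltW.
pose g n h := ee (f (n + h)%N).
(* Averaging over [H] shifts costs at most [2 H] per shift, negligible for [l >= l0]. *)
have lower : H%:R * eps * l%:R / 2 <= nc (\sum_(n < l) \sum_(h < H) g n h).
  have -> : \sum_(n < l) \sum_(h < H) g n h = \sum_(h < H) expsum (fun n => f (n + h)%N) l.
    by rewrite exchange_big.
  have : nc (\sum_(h < H) (expsum f l - expsum (fun n => f (n + h)%N) l)) <= 2 * H%:R * H%:R.
    apply: (@nc_sum_le R H (fun h => expsum f l - expsum (fun n => f (n + h)%N) l)) => h hH.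
    rewrite nc_distC; apply: le_trans (expsum_shift f h l) _.
    by rewrite ler_wpM2l // ler_nat ltnW.
  rewrite sumrB sumr_const card_ord => hd.
  have := ncB (expsum f l *+ H) (\sum_(h < H) expsum (fun n => f (n + h)%N) l).
  have -> : nc (expsum f l *+ H) = H%:R * nc (expsum f l).
    by rewrite !ncE normcMn mulr_natl.
  nra.
(* Cauchy-Schwarz over [n]. The diagonal terms give [H l], beaten by the choice of [H]; the others
   are correlations at lag [b - a], bounded by [small] up to a translation. *)
have upper : nc (\sum_(n < l) \sum_(h < H) g n h) ^+ 2 <=
    l%:R * (H%:R * l%:R + H%:R * H%:R * (eps ^+ 2 / 16 * l%:R + 2 * H%:R)).
  apply: (@le_trans _ _ ((\sum_(n < l) nc (\sum_(h < H) g n h)) ^+ 2)).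
    by rewrite lerXn2r ?nnegrE ?nc_ge0 ?sumr_ge0 // ?nc_sum // => i _; rewrite nc_ge0.
  apply: le_trans (@sqr_sum_le R l (fun n => nc (\sum_(h < H) g n h))) _.
  rewrite ler_pM2l // -[X in X <= _]ger0_norm; last by apply: sumr_ge0 => i _; rewrite sqr_ge0.
  rewrite -nc_real rmorph_sum /=.
  under eq_bigr do rewrite (@nc_sum_sqr _ H (fun h => g _ h)).
  rewrite exchange_big /=; under eq_bigr do rewrite exchange_big /=.
  have -> : H%:R * l%:R + H%:R * H%:R * (eps ^+ 2 / 16 * l%:R + 2 * H%:R)
     = (l%:R + H%:R * (eps ^+ 2 / 16 * l%:R + 2 * H%:R)) * H%:R by ring.
  apply: (@nc_sum_le R H (fun h => \sum_(j < H) \sum_(i < l) g i h * (g i j)^*%C)) => h hH.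
  apply: le_trans (nc_sum _ _ _) _.
  have t j : (j < H)%N -> nc (\sum_(i < l) g i h * (g i j)^*%C) <=
      (if j == h then l%:R else 0) + (eps ^+ 2 / 16 * l%:R + 2 * H%:R).
    move=> jH; have pos : 0 <= eps ^+ 2 / 16 * l%:R by rewrite mulr_ge0 // divr_ge0 // ltW.
    have eg i a b : g i a * (g i b)^*%C = ee (f (i + a)%N - f (i + b)%N).
      by rewrite /g ee_conj -eeD.
    have lem a b : (a < b < H)%N -> nc (\sum_(i < l) g i b * (g i a)^*%C) <=
        eps ^+ 2 / 16 * l%:R + 2 * H%:R.
      move=> /andP[ab bH]; under eq_bigr do rewrite eg.
      have -> : \sum_(i < l) ee (f (i + b)%N - f (i + a)%N)
          = expsum (fun n => dh (b - a) f (n + a)%N) l.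
        by apply: eq_bigr => i _; rewrite /dh -addnA subnKC // ltnW.
      rewrite -[X in nc X](subrK (expsum (dh (b - a) f) l)).
      apply: le_trans (ncD _ _) _; rewrite addrC; apply: lerD.
        by apply: small; clear -ab bH; lia.
      apply: le_trans (expsum_shift (dh (b - a) f) a l) _.
      by rewrite ler_pM2l // ler_nat; clear -ab bH; lia.
    case: eqVneq => [->|jh].
      have : nc (\sum_(i < l) g i h * (g i h)^*%C) <= l%:R.
        have := @nc_sum_le R l (fun i => g i h * (g i h)^*%C) 1; rewrite mul1r; apply => i _.
        by rewrite eg nc_ee.
      lra.
    rewrite add0r; case: (ltngtP j h) => [jh2|jh2|e]; last by rewrite e eqxx in jh.
      by apply: lem; rewrite jh2.
    rewrite -nc_conj rmorph_sum /=.
    have := @lem h j; rewrite jh2 jH => /(_ isT).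
    congr (nc _ <= _); apply: eq_bigr => i _.
    change (g i j * (g i h)^*%C = (g i h * (g i j)^*%C)^*%C).
    by rewrite !eg ee_conj opprB.
  apply: le_trans (_ : \sum_(j < H) ((if j == h :> nat then l%:R else 0) + (eps ^+ 2 / 16 * l%:R + 2 * H%:R)) <= _).
    by apply: ler_sum => j _; apply: t.
  rewrite big_split /= sumr_const card_ord -[X in _ + X]mulr_natl lerD2r.
  rewrite (bigD1 (Ordinal hH)) //= eqxx big1 ?addr0 // => i ih.
  by case: eqP => // e; move: ih; rewrite -(inj_eq val_inj) /= e eqxx.
have : (H%:R * eps * l%:R / 2) ^+ 2 <= nc (\sum_(n < l) \sum_(h < H) g n h) ^+ 2.
  by rewrite lerXn2r ?nnegrE ?nc_ge0 // divr_ge0 // !mulr_ge0 // ltW.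
have -> : (H%:R * eps * l%:R / 2) ^+ 2 = l%:R * (H%:R ^+ 2 * eps ^+ 2 * l%:R / 4) by field.
move=> h1; have := le_trans h1 upper; rewrite ler_pM2l // => h2.
have {}h2 : H%:R * (H%:R * eps ^+ 2 * l%:R / 4) <= H%:R * (l%:R + H%:R * (eps ^+ 2 / 16 * l%:R + 2 * H%:R)).
  by apply: le_trans (le_trans _ h2) _; rewrite le_eqVlt; apply/orP; left; apply/eqP; ring.
rewrite ler_pM2l // in h2.
have : 16 * l%:R <= H%:R * eps ^+ 2 * l%:R by rewrite ler_pM2r.
have : 64 * H%:R * H%:R <= l%:R * eps ^+ 2 * H%:R by rewrite ler_pM2r.
have : 0 < H%:R * (eps ^+ 2 * l%:R) by rewrite !mulr_gt0.
lra.
Qed.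

(** * Iterated differences *)

Definition dlk (V : zmodType) (k : nat) (f : nat -> V) : nat -> V := iter k (@dl V) f.

Lemma dlkS (V : zmodType) (k : nat) (f : nat -> V) : dlk k.+1 f = dl (dlk k f).
Proof. by []. Qed.
Lemma dlkSr (V : zmodType) (k : nat) (f : nat -> V) : dlk k.+1 f = dlk k (dl f).
Proof. exact: iterSr. Qed.
Lemma dlkD (V : zmodType) (i j : nat) (f : nat -> V) : dlk (i + j) f = dlk i (dlk j f).
Proof. exact: iterD. Qed.

Lemma dl_dh (V : zmodType) (f : nat -> V) (h : nat) : dl (dh h f) = dh h (dl f).
Proof.
apply/funext => n; rewrite /dl /dh addSn opprB [in RHS]opprB addrACA [in RHS]addrACA.
by rewrite [- _ - _]addrC.
Qed.

Lemma dlk_dh (V : zmodType) (f : nat -> V) (h k : nat) : dlk k (dh h f) = dh h (dlk k f).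
Proof. by elim: k => // k IH; rewrite !dlkS IH dl_dh. Qed.

Lemma telescope_dl (V : zmodType) (f : nat -> V) (n h : nat) :
  f (n + h)%N - f n = \sum_(i < h) dl f (n + i)%N.
Proof.
elim: h => [|h IH]; first by rewrite addn0 subrr big_ord0.
by rewrite big_ord_recr /= -IH /dl addnS [RHS]addrC addrA subrK.
Qed.

Definition csign (R : realType) (f : nat -> R) (L : nat) : Prop :=
  (forall n, (n < L)%N -> 0 <= f n) \/ (forall n, (n < L)%N -> f n <= 0).

Lemma sum_ge (R : numDomainType) (F : nat -> R) (h : nat) (lo : R) :
  (forall i, (i < h)%N -> lo <= F i) -> h%:R * lo <= \sum_(i < h) F i.
Proof.
move=> H; apply: le_trans (_ : \sum_(i < h) lo <= _); last by apply: ler_sum => i _; apply: H.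
by rewrite sumr_const card_ord mulr_natl.
Qed.

Definition dhs (V : zmodType) (hs : seq nat) (f : nat -> V) : nat -> V :=
  foldl (fun g h => dh h g) f hs.

Lemma dlk_dhs (V : zmodType) (k : nat) (hs : seq nat) (f : nat -> V) :
  dlk k (dhs hs f) = dhs hs (dlk k f).
Proof. by elim: hs f => //= h hs IH f; rewrite IH dlk_dh. Qed.

(** A difference of step [h] is a sum of [h] consecutive ordinary differences, so the product of the
    steps comes out as a factor. The scalar [s] is 1 or -1 in the applications and yields lower and
    upper bounds from one induction. *)
Lemma dhs_ge (R : numDomainType) (hs : seq nat) (f : nat -> R) (X : nat) (lo s : R) :
  (forall n, (n < X + sumn hs)%N -> lo <= s * dlk (size hs) f n) ->
  forall n, (n < X)%N -> (foldr muln 1 hs)%N%:R * lo <= s * dhs hs f n.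
Proof.
elim: hs f X lo => [|h hs IH] f X lo H n nX /=.
  by rewrite mul1r; apply: (H n); rewrite addn0.
have e x : (h * foldr muln 1 hs)%N%:R * x = (foldr muln 1 hs)%N%:R * (h%:R * x) :> R.
  by rewrite natrM mulrA (mulrC h%:R).
rewrite !e; apply: (IH _ X) => // m mX.
rewrite dlk_dh /dh telescope_dl mulr_sumr.
apply: (@sum_ge _ (fun i => s * dl _ (m + i)%N)) => i ih; rewrite -dlkS.
by apply: H; rewrite /= [(h + _)%N]addnC addnA -addSn leq_add // ltnW.
Qed.

Lemma dhs_bounds (R : numDomainType) (hs : seq nat) (f : nat -> R) (X : nat) (lo hi : R) :
  (forall n, (n < X + sumn hs)%N -> lo <= dlk (size hs) f n <= hi) ->
  forall n, (n < X)%N -> (foldr muln 1 hs)%N%:R * lo <= dhs hs f n <= (foldr muln 1 hs)%N%:R * hi.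
Proof.
move=> H n nX; apply/andP; split.
  rewrite -[leRHS]mul1r; apply: (@dhs_ge _ _ _ X) => // m mX; rewrite mul1r.
  by case/andP: (H m mX).
rewrite -lerN2 -mulrN -[leRHS]mulN1r; apply: (@dhs_ge _ _ _ X) => // m mX.
by rewrite mulN1r lerN2; case/andP: (H m mX).
Qed.

Lemma dhs_csign (R : realType) (hs : seq nat) (f : nat -> R) (X : nat) :
  csign (dlk (size hs) f) (X + sumn hs) -> csign (dhs hs f) X.
Proof.
case=> H; [left|right] => n nX.
  rewrite -[leRHS]mul1r -[leLHS](mulr0 (foldr muln 1 hs)%N%:R).
  by apply: (@dhs_ge _ _ _ X) => // m mX; rewrite mul1r H.
rewrite -oppr_ge0 -mulN1r -[leLHS](mulr0 (foldr muln 1 hs)%N%:R).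
by apply: (@dhs_ge _ _ _ X) => // m mX; rewrite mulN1r oppr_ge0 H.
Qed.

Lemma sumn_all_le (H : nat) (hs : seq nat) :
  all (fun h => (0 < h <= H)%N) hs -> (sumn hs <= size hs * H)%N.
Proof. by elim: hs => //= h hs IH /andP[/andP[_ h1] /IH h2]; rewrite mulSn leq_add. Qed.

Lemma prod_all_le (H : nat) (hs : seq nat) :
  all (fun h => (0 < h <= H)%N) hs -> (0 < foldr muln 1 hs <= H ^ size hs)%N.
Proof.
elim: hs => //= h hs IH /andP[/andP[h0 h1] /IH/andP[h2 h3]].
by rewrite muln_gt0 h0 h2 expnS leq_mul.
Qed.

Lemma vdc_iter (R : realType) (k : nat) (eps : R) : 0 < eps ->
  exists (H : nat) (e' : R) (l0 : nat), [/\ 0 < e', (0 < H)%N &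
    forall (f : nat -> R) (l : nat), (l0 <= l)%N -> eps * l%:R <= nc (expsum f l) ->
    exists hs : seq nat, [/\ size hs = k, all (fun h => (0 < h <= H)%N) hs &
       e' * l%:R <= nc (expsum (dhs hs f) l)]].
Proof.
elim: k eps => [|k IH] eps e0.
  by exists 1%N, eps, 0%N; split=> // f l _ h; exists [::].
have [H1 [e1 [l1 [e10 H10 P1]]]] := vdc e0.
have [H2 [e2 [l2 [e20 H20 P2]]]] := IH e1 e10.
exists (maxn H1 H2), e2, (maxn l1 l2); split=> // [|f l ll hS].
  by rewrite leq_max H10.
have [h /andP[h0 hH] h1] := P1 f l (leq_trans (leq_maxl _ _) ll) hS.
have [hs [sz al h2]] := P2 (dh h f) l (leq_trans (leq_maxr _ _) ll) h1.
exists (h :: hs); split=> //=; first by rewrite sz.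
rewrite h0 leq_max hH /=; apply: sub_all al => i /andP[-> h3].
by rewrite leq_max h3 orbT.
Qed.

(** Summation by parts: [E n = w n * (E n.+1 - E n)] with [w n] the inverse of [ee (d n) - 1], and
    [w] has bounded variation because [d] is monotone. The sign [s] is the direction of
    monotonicity, and 528 = 8 + 512 + 8. *)
Lemma kusmin_landau (R : realType) (g : nat -> R) (l : nat) (kap s : R) :
  0 < kap -> s ^+ 2 = 1 ->
  (forall n, (n < l)%N -> kap <= dl g n <= 1 / 8) ->
  (forall n, (n.+1 < l)%N -> 0 <= s * (dl g n - dl g n.+1)) ->
  nc (expsum g l) <= 528 / kap.
Proof.
move=> k0 s2 bd mono.
have kap_inv : 0 < kap^-1 by rewrite invr_gt0.
case: l => [|l] in bd mono *.
  by rewrite /expsum big_ord0 nc0 mulr_ge0 ?ler0n // ltW.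
pose d := dl g; pose E n := ee (g n); pose w n := (ee (d n) - 1)^-1.
have dpos n : (n < l.+1)%N -> 0 < d n.
  by move=> /bd /andP[h _]; exact: lt_le_trans h.
have dinv n : (n < l.+1)%N -> (d n)^-1 <= kap^-1.
  by move=> nl; rewrite lef_pV2 ?posrE ?dpos //; case/andP: (bd n nl).
have elb n : (n < l.+1)%N -> d n / 8 <= nc (ee (d n) - 1).
  move=> nl; have d0 := dpos n nl; have := @ee_sub1_ge R (d n); rewrite (gtr0_norm d0); apply.
  by case/andP: (bd n nl) => _; rewrite -/d; lra.
have enz n : (n < l.+1)%N -> ee (d n) - 1 != 0.
  move=> nl; apply/eqP => e; have := elb n nl; rewrite e nc0; have := dpos n nl; lra.
have wE n : (n < l.+1)%N -> nc (w n) <= 8 / d n.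
  move=> nl; rewrite /w ncV; have -> : 8 / d n = (d n / 8)^-1 by rewrite invfM invrK mulrC.
  by rewrite lef_pV2 ?posrE ?elb // ?divr_gt0 ?dpos //; apply: lt_le_trans (elb n nl); rewrite divr_gt0 ?dpos.
have wd n : (n.+1 < l.+1)%N -> nc (w n.+1 - w n) <= 512 * (s * ((d n.+1)^-1 - (d n)^-1)).
  move=> nl; have nl' := ltnW nl; have p1 := dpos n nl'; have p2 := dpos _ nl.
  have -> : w n.+1 - w n = (ee (d n) - ee (d n.+1)) * (w n.+1 * w n).
    rewrite /w -invfM [X in X * _](_ : _ = (ee (d n) - 1) - (ee (d n.+1) - 1)); last by ring.
    by rewrite mulrBl invfM mulrCA mulfV ?enz // mulr1 mulrA mulfV ?enz // mul1r.
  rewrite !ncM; have h1 := ee_lip (d n) (d n.+1).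
  have h2 := wE _ nl; have h3 := wE _ nl'.
  have -> : 512 * (s * ((d n.+1)^-1 - (d n)^-1)) = (8 * (s * (d n - d n.+1))) * (8 / d n.+1 * (8 / d n)).
    by field; rewrite !gt_eqF.
  apply: ler_pM => //; rewrite ?nc_ge0 //; first by rewrite mulr_ge0 ?nc_ge0.
    apply: le_trans h1 _; rewrite ler_pM2l //.
    have := mono n nl; rewrite -/d; set y := d n - d n.+1 => sy.
    have -> : `|y| = `|s * y|.
      by rewrite normrM (_ : `|s| = 1) ?mul1r //; apply/eqP; rewrite -(@eqrXn2 _ 2) // -normrX s2 normr1 expr1n.
    by rewrite ger0_norm.
  by apply: ler_pM; rewrite ?nc_ge0.
have main n : (n < l.+1)%N ->
    nc (expsum g n.+1 - w n * E n.+1) <= 8 / kap + 512 * (s * ((d n)^-1 - (d 0%N)^-1)).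
  elim: n => [|n IH] nl.
    rewrite subrr mulr0 mulr0 addr0 /expsum big_ord1 /E.
    have -> : ee (g 0%N) - w 0%N * ee (g 1%N) = - (w 0%N * ee (g 0%N)).
      have -> : g 1%N = g 0%N + d 0%N by rewrite /d /dl addrC subrK.
      rewrite eeD {1}(_ : ee (g 0%N) = w 0%N * (ee (d 0%N) - 1) * ee (g 0%N)); last by rewrite mulVf ?mul1r ?enz.
      by ring.
    rewrite ncN ncM nc_ee mulr1; apply: le_trans (wE _ nl) _.
    by rewrite ler_pM2l // dinv.
  have {}IH := IH (ltnW nl).
  have -> : expsum g n.+2 - w n.+1 * E n.+2 = (expsum g n.+1 - w n * E n.+1) - (w n.+1 - w n) * E n.+1.
    have -> : expsum g n.+2 = expsum g n.+1 + E n.+1 by rewrite /expsum big_ord_recr.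
    have -> : E n.+2 = E n.+1 * ee (d n.+1) by rewrite /E -eeD /d /dl addrC subrK.
    have : w n.+1 * (ee (d n.+1) - 1) = 1 by rewrite mulVf ?enz.
    set W := w n.+1; set D := ee _ => h.
    have -> : W * (E n.+1 * D) = (W * (D - 1)) * E n.+1 + W * E n.+1 by ring.
    rewrite h; ring.
  apply: le_trans (ncD _ _) _; rewrite ncN ncM nc_ee mulr1.
  apply: le_trans (lerD IH (wd n nl)) _.
  by rewrite -addrA -mulrDr -mulrDr [_ - _ + _]addrC addrA subrK.
have := main l (ltnSn l).
have : nc (w l * E l.+1) <= 8 / kap.
  rewrite ncM nc_ee mulr1; apply: le_trans (wE _ (ltnSn l)) _.
  by rewrite ler_pM2l // dinv.
have : s * ((d l)^-1 - (d 0%N)^-1) <= kap^-1.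
  have a1 := dinv l (ltnSn l); have a2 := dinv 0%N (ltn0Sn l).
  have b1 : 0 < (d l)^-1 by rewrite invr_gt0 dpos.
  have b2 : 0 < (d 0%N)^-1 by rewrite invr_gt0 dpos.
  have : (s == 1) || (s == -1) by rewrite -sqrf_eq1 s2.
  by move=> /orP[] /eqP ->; lra.
move=> h1 h2 h3.
have := ncD (expsum g l.+1 - w l * E l.+1) (w l * E l.+1); rewrite subrK => h4.
apply: (le_trans h4); apply: le_trans (lerD h3 h2) _.
lra.
Qed.

(** Multiplication by [ee s] almost shifts the summation index by one, which changes the sum by at
    most 2. *)
Lemma expsum_linear (R : realType) (g : nat -> R) (l : nat) (s t : R) :
  (forall n, (n < l)%N -> `|dl g n - s| <= t) ->
  nc (ee s - 1) * nc (expsum g l) <= 2 + 8 * t * l%:R.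
Proof.
move=> h; rewrite -ncM mulrBl mul1r.
have -> : ee s * expsum g l = expsum (fun n => g n + s) l.
  by rewrite /expsum mulr_sumr; apply: eq_bigr => i _; rewrite eeD mulrC.
rewrite -(subrKA (expsum (fun n => g (n + 1)%N) l)) addrC; apply: le_trans (ncD _ _) _.
apply: lerD; first by have := expsum_shift g 1 l; rewrite mulr1.
apply: expsum_close => n nl; rewrite addn1.
by have := h n nl; rewrite /dl -normrN; congr (`|_| <= _); ring.
Qed.

Lemma nearest_int (R : realType) (s : R) :
  exists2 A : int, `|s - A%:~R| <= 1 / 2 & `|s - A%:~R| <= 8 * nc (ee s - 1).
Proof.
exists (Num.floor (s + 1 / 2)).
  by have := floor_itv (s + 1 / 2); rewrite ler_norml => /andP[]; rewrite intrD; lra.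
set A := Num.floor _.
have h : `|s - A%:~R| <= 1 / 2.
  by have := floor_itv (s + 1 / 2); rewrite -/A ler_norml => /andP[]; rewrite intrD; lra.
have := @ee_sub1_ge R (s - A%:~R).
by rewrite eeB ee_int divr1 => /(_ _); lra.
Qed.

Lemma mono_cut (Q : pred nat) (L : nat) :
  (forall m n, (m <= n < L)%N -> Q n -> Q m) ->
  exists2 t, (t <= L)%N & (forall n, (n < t)%N -> Q n) /\ (forall n, (t <= n < L)%N -> ~~ Q n).
Proof.
elim: L => [|L IH] H; first by exists 0%N => //; split=> // n; rewrite ltn0 andbF.
have [|t tL [h1 h2]] := IH; first by move=> m n /andP[mn nL]; apply: H; rewrite mn ltnW.
have [QL|QL] := boolP (Q L).
  exists L.+1 => //; split=> [n|n /andP[h /(leq_trans h)]]; last by rewrite ltnn.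
  by rewrite ltnS => nL; apply: (H n L) => //; rewrite nL ltnSn.
exists t; first exact: leqW.
split=> // n /andP[tn]; rewrite ltnS leq_eqVlt => /orP[/eqP -> //|nL].
by apply: h2; rewrite tn.
Qed.

(** Blocks of length [q] are removed one by one; the term [q%:R] pays for the incomplete last
    block. *)
Lemma expsum_piece (R : realType) (e : R) (q : nat) (f : nat -> R) (l : nat) :
  0 < e -> (0 < q)%N -> e * l%:R <= nc (expsum f l) - q%:R ->
  exists2 i, (i + q <= l)%N & e * q%:R <= nc (expsum (fun n => f (i + n)%N) q).
Proof.
move=> e0 q0; elim/ltn_ind: l f => l IH f H.
have [lq|ql] := ltnP l q.
  have h1 := expsum_le f l; have h2 : l%:R < q%:R :> R by rewrite ltr_nat.
  have h3 : 0 <= e * l%:R by rewrite mulr_ge0 // ltW.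
  by exfalso; move: H h1 h2 h3; clear; move: (nc _) (_ * _) => *; lra.
have [h|h] := lerP (e * q%:R) (nc (expsum f q)); first by exists 0%N.
have ll : (l - q < l)%N by rewrite ltn_subLR // -addn1 addnC leq_add2r.
have [|i iq hi] := IH _ ll (fun n => f (q + n)%N).
  have : nc (expsum f l) <= nc (expsum f q) + nc (expsum (fun n => f (q + n)%N) (l - q)).
    by apply: le_trans (ncD _ _); rewrite -expsumD subnKC.
  rewrite natrB //; lra.
exists (q + i)%N; first by rewrite -addnA -leq_subRL.
by move: hi; congr (_ <= nc _); apply: eq_expsum => n _; rewrite addnA.
Qed.

Lemma expsum_residue (R : realType) (p : nat) (f : nat -> R) (l : nat) :
  expsum f (p * l) = \sum_(r < p) expsum (fun m => f (r + p * m)%N) l.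
Proof.
elim: l => [|l IH]; first by rewrite muln0 /expsum big_ord0 big1 // => i _; rewrite big_ord0.
rewrite mulnS addnC expsumD IH /expsum -big_split /=; apply: eq_bigr => r _.
by rewrite big_ord_recr /= addnC.
Qed.

Lemma expsum_residue_large (R : realType) (e : R) (p : nat) (f : nat -> R) (l : nat) :
  (0 < p)%N -> e * (p * l)%N%:R <= nc (expsum f (p * l)) ->
  exists2 r, (r < p)%N & e * l%:R <= nc (expsum (fun m => f (r + p * m)%N) l).
Proof.
move=> p0 H; apply: contrapT => hno.
have small r : (r < p)%N -> nc (expsum (fun m => f (r + p * m)%N) l) < e * l%:R.
  by move=> rp; rewrite ltNge; apply/negP => h; apply: hno; exists r.
have : nc (expsum f (p * l)) < e * (p * l)%N%:R.
  rewrite expsum_residue; apply: le_lt_trans (nc_sum _ _ _) _.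
  apply: lt_le_trans (_ : _ < \sum_(r < p) (e * l%:R)) _.
    apply: ltr_sum => [|i _]; last exact: small.
    by apply/hasP; exists (Ordinal p0) => //; rewrite mem_index_enum.
  by rewrite sumr_const card_ord (_ : e * (p * l)%N%:R = (e * l%:R) *+ p) ?lexx // -[RHS]mulr_natr natrM; ring.
by rewrite ltNge H.
Qed.

Lemma dlk_shift (V : zmodType) (k : nat) (f : nat -> V) (a n : nat) :
  dlk k (fun m => f (a + m)%N) n = dlk k f (a + n)%N.
Proof. by elim: k n => // k IH n; rewrite !dlkS /dl !IH addnS. Qed.

Lemma dlkN (V : zmodType) (k : nat) (f : nat -> V) (n : nat) :
  dlk k (fun m => - f m) n = - dlk k f n.
Proof. by elim: k n => // k IH n; rewrite !dlkS /dl !IH opprB opprK addrC. Qed.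

Lemma dlk_add (V : zmodType) (k : nat) (f g : nat -> V) (n : nat) :
  dlk k (fun m => f m + g m) n = dlk k f n + dlk k g n.
Proof. by elim: k n => // k IH n; rewrite !dlkS /dl !IH opprD addrACA. Qed.

Lemma dlk_sub (V : zmodType) (k : nat) (f g : nat -> V) (n : nat) :
  dlk k (fun m => f m - g m) n = dlk k f n - dlk k g n.
Proof. by rewrite (dlk_add k f (fun m => - g m)) dlkN. Qed.

Lemma dlkM (R : pzRingType) (k : nat) (c : R) (f : nat -> R) (n : nat) :
  dlk k (fun m => c * f m) n = c * dlk k f n.
Proof. by elim: k n => // k IH n; rewrite !dlkS /dl !IH mulrBr. Qed.

Lemma eq_dlk (V : zmodType) (k : nat) (f g : nat -> V) (n : nat) :
  f =1 g -> dlk k f n = dlk k g n.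
Proof. by move=> /funext ->. Qed.

Lemma dlk_sum (V : zmodType) (k : nat) (N : nat) (F : nat -> nat -> V) (n : nat) :
  dlk k (fun m => \sum_(i < N) F i m) n = \sum_(i < N) dlk k (F i) n.
Proof.
elim: k n => // k IH n; rewrite dlkS /dl !IH -sumrB; apply: eq_bigr => i _.
by rewrite dlkS.
Qed.

Lemma dlk_intr (R : pzRingType) (k : nat) (f : nat -> int) (n : nat) :
  dlk k (fun m => (f m)%:~R : R) n = (dlk k f n)%:~R.
Proof. by elim: k n => // k IH n; rewrite !dlkS /dl !IH rmorphB. Qed.

Lemma dlk_step (V : zmodType) (k p r : nat) (f : nat -> V) (m : nat) :
  dlk k (fun i => f (r + p * i)%N) m = dhs (nseq k p) f (r + p * m)%N.
Proof.
elim: k f m => // k IH f m; rewrite dlkSr /= -IH; congr dlk; apply/funext => i.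
by rewrite /dl /dh mulnS [(p + _)%N]addnC addnA.
Qed.

Lemma size_prod_nseq (k p : nat) : foldr muln 1%N (nseq k p) = (p ^ k)%N.
Proof. by elim: k => //= k ->; rewrite expnS. Qed.

Lemma sumn_nseq_mul (k p : nat) : sumn (nseq k p) = (k * p)%N.
Proof. by rewrite sumn_nseq mulnC. Qed.

Lemma dl_binom (R : pzRingType) (k : nat) :
  dl (fun n => 'C(n, k.+1)%:R : R) = fun n => 'C(n, k)%:R.
Proof. by apply/funext => n; rewrite /dl binS natrD addrAC subrr add0r. Qed.

Lemma dlk_binom (R : pzRingType) (k i : nat) (n : nat) :
  dlk i (fun n => 'C(n, k)%:R : R) n = if (i <= k)%N then 'C(n, k - i)%:R else 0.
Proof.
elim: i k => [|i IH] [|k]; rewrite ?subn0 //; last by rewrite dlkSr dl_binom IH.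
rewrite dlkSr (_ : dl _ = fun=> 0); last by apply/funext => m; rewrite /dl !bin0 subrr.
by clear IH; elim: i n => // i IH n; rewrite dlkS /dl !IH subrr.
Qed.

Lemma dlk_binom_affine (k p r i m : nat) : (k < i)%N ->
  dlk i (fun m => ('C(r + p * m, k))%:R : int) m = 0.
Proof.
move=> ki; rewrite (@dlk_step int i p r (fun n => 'C(n, k)%:R)).
have H n : dlk (size (nseq i p)) (fun n => 'C(n, k)%:R : int) n = 0.
  by rewrite size_nseq dlk_binom leqNgt ki.
have := @dhs_bounds int (nseq i p) (fun n => 'C(n, k)%:R) (r + p * m).+1 0 0 _ _ (ltnSn _).
rewrite !mulr0 => h; apply/eqP; rewrite eq_le andbC; apply: h => n _.
by rewrite H lexx.
Qed.

(** By Vandermonde the extra terms are multiples of binomials C(N, i) with N = B! k! and 1 <= i <=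
    k. Since i C(N, i) = N C(N - 1, i - 1) and i divides k!, each of them is divisible by B!, hence
    by every b <= B. *)
Lemma binom_period (b B k n : nat) : (0 < b <= B)%N ->
  exists z : nat, ('C(n + B`! * k`!, k) = 'C(n, k) + b * z)%N.
Proof.
move=> bB; rewrite addnC -binomial.Vandermonde big_ord_recl /= bin0 mul1n subn0.
suff : (b %| \sum_(i < k) 'C(B`! * k`!, bump 0 i) * 'C(n, k - bump 0 i))%N.
  by move=> /dvdnP[z ->]; exists z; rewrite mulnC.
apply: (big_ind (fun x => b %| x)%N) => [|x y|i _]; [exact: dvdn0|exact: dvdn_add|].
apply: dvdn_mulr; rewrite /bump /= add1n.
have bf : (b %| B`!)%N by apply: dvdn_fact.
apply: dvdn_trans bf _.
have : (i.+1 * 'C(B`! * k`!, i.+1) = B`! * k`! * 'C((B`! * k`!).-1, i))%N.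
  by rewrite -mul_bin_diag.
have : (i.+1 %| k`!)%N by apply: dvdn_fact; rewrite ltn_ord.
move=> /dvdnP[y ->] h; apply/dvdnP; exists (y * 'C((B`! * (y * i.+1)).-1, i))%N.
apply/eqP; rewrite -(eqn_pmul2l (ltn0Sn i)) h; apply/eqP; ring.
Qed.

Lemma expsum_take (R : realType) (f : nat -> R) (l s : nat) (e : R) : (s <= l)%N ->
  e * l%:R <= nc (expsum f l) -> 0 <= e -> 2 * s%:R <= e * l%:R ->
  e / 2 * (l - s)%N%:R <= nc (expsum f (l - s)).
Proof.
move=> sl H e0 h.
have : nc (expsum f l) <= nc (expsum f (l - s)) + s%:R.
  rewrite -{1}(subnK sl) expsumD; apply: le_trans (ncD _ _) _.
  by rewrite lerD2l expsum_le.
have : e * (l - s)%N%:R <= e * l%:R by rewrite ler_wpM2l // ler_nat leq_subr.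
lra.
Qed.

(** A sum cannot be large where the difference of order k + 1 is much bigger than 1/X: difference
    [k] times, then apply Kusmin-Landau. The bound [d] keeps the final increments, which gain a
    factor of at most [H ^ k], below 1/8. *)
Lemma fast_small (R : realType) (k : nat) (eps : R) : 0 < eps ->
  exists (d B : R) (X0 : nat), [/\ 0 < d, 0 < B &
    forall (f : nat -> R) (X : nat) (kap : R), (X0 <= X)%N -> 0 < kap ->
      (forall n, (n < X)%N -> kap <= dlk k.+1 f n <= d) ->
      csign (dlk k.+2 f) X -> eps * X%:R <= nc (expsum f X) -> kap * X%:R <= B].
Proof.
move=> e0; have [|H [e' [l0 [e'0 H0 P]]]] := @vdc_iter R k (eps / 2); first lra.
have Hk : 0 < (H ^ k)%N%:R :> R by rewrite ltr0n expn_gt0 H0.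
have [X1 X10 X1b] := natr_above (2 * (k * H)%N%:R / eps).
exists (8 * (H ^ k)%N%:R)^-1, (2 * (528 / e')), (X1 + 2 * (l0 + k * H))%N; split.
- by rewrite invr_gt0 mulr_gt0.
- by rewrite mulr_gt0 ?divr_gt0 ?ltr0n.
move=> f X kap XX k0 bd sg SX.
(* The [k] differencings look at most [k * H] places ahead, so the last [s] terms are given up. *)
pose s := (k * H)%N; have sX : (2 * s <= X)%N.
  by move: XX; rewrite -/s; clear; lia.
have lX : (l0 <= X - s)%N.
  by move: XX; rewrite -/s; clear; lia.
have X1X : X1%:R <= X%:R :> R.
  by rewrite ler_nat; apply: leq_trans XX; rewrite leq_addr.
have [|hs [sz al hS]] := P f (X - s)%N lX.
  apply: expsum_take => //; [by apply: leq_trans sX; rewrite leq_pmull|exact: ltW|].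
  by rewrite -ler_pdivrMl // mulrC; exact: le_trans X1X.
have sumhs : (X - s + sumn hs <= X)%N.
  have := sumn_all_le al; rewrite sz -/s; move: sX; clear; lia.
have /andP[b0 bH] := prod_all_le al; rewrite sz in bH.
set b := foldr muln 1%N hs in b0 bH.
have bR : 1 <= b%:R :> R by rewrite ler1n.
have bRH : b%:R <= (H ^ k)%N%:R :> R by rewrite ler_nat.
have gb n : (n < X - s)%N -> kap <= dl (dhs hs f) n <= 1 / 8.
  move=> nX; have : b%:R * kap <= dl (dhs hs f) n <= b%:R * (8 * (H ^ k)%N%:R)^-1.
    rewrite -[dl _]/(dlk 1 _) dlk_dhs; apply: (@dhs_bounds _ _ _ (X - s)) => // m mX.
    rewrite sz -dlkD addn1; apply: bd; exact: leq_trans sumhs.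
  have : b%:R * (8 * (H ^ k)%N%:R)^-1 <= 1 / 8 :> R.
    by rewrite ler_pdivrMr ?mulr_gt0 //; lra.
  have : kap <= b%:R * kap by rewrite ler_peMl // ltW.
  move=> h1 h2 /andP[h3 h4]; rewrite (le_trans h1) //=; exact: le_trans h2.
have gs : csign (dlk 2 (dhs hs f)) (X - s).
  rewrite dlk_dhs; apply: dhs_csign; rewrite sz -dlkD addn2.
  by case: sg => h; [left|right] => n nX; apply: h; apply: leq_trans sumhs.
have KL : nc (expsum (dhs hs f) (X - s)) <= 528 / kap.
  case: gs => h.
    apply: (@kusmin_landau _ _ _ kap (-1)) => // [|n nX]; first by rewrite sqrrN expr1n.
    by rewrite mulN1r opprB; apply: h; apply: ltnW.
  apply: (@kusmin_landau _ _ _ kap 1) => // [|n nX]; first by rewrite expr1n.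
  by rewrite mul1r -opprB oppr_ge0; apply: h; apply: ltnW.
have := le_trans hS KL; rewrite ler_pdivlMr //.
have -> : 2 * (528 / e') = 2 * 528 / e' by rewrite mulrA.
rewrite ler_pdivlMr // => h.
have : kap * e' * X%:R <= kap * e' * (2 * (X - s)%N%:R).
  rewrite ler_pM2l ?mulr_gt0 // -natrM ler_nat; move: sX; clear; lia.
move: h; set A := (X - s)%N%:R; set Y := X%:R; set c := 528%:R => h1 h2.
have -> : kap * Y * e' = kap * e' * Y by ring.
apply: le_trans h2 _; have -> : kap * e' * (2 * A) = 2 * (e' * A * kap) by ring.
by rewrite ler_pM2l.
Qed.

(** The difference of order k + 1 is monotone of constant sign, so the places where it exceeds C/L
    form an interval at one end, and by [fast_small] the sum over that interval is less than half of
    the given lower bound. *)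
Lemma cut_large (R : realType) (k : nat) (eps : R) : 0 < eps ->
  exists (d C : R) (L0 : nat), [/\ 0 < d, 0 < C &
    forall (f : nat -> R) (L : nat), (L0 <= L)%N ->
      (forall n, (n < L)%N -> `|dlk k.+1 f n| <= d) ->
      csign (dlk k.+1 f) L -> csign (dlk k.+2 f) L -> eps * L%:R <= nc (expsum f L) ->
    exists a l : nat, [/\ (a + l <= L)%N,
      forall n, (n < l)%N -> `|dlk k.+1 f (a + n)%N| <= C / L%:R &
      eps / 2 * L%:R <= nc (expsum (fun n => f (a + n)%N) l)]].
Proof.
move=> e0; have e20 : 0 < eps / 2 by lra.
have [d [B [X0 [d0 B0 P]]]] := fast_small k e20.
have [L1 L10 L1b] := natr_above (X0%:R / (eps / 2)).
(* A bad interval with a large sum has at least [eps / 2 * L] terms, and there [fast_small] would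
   give [2 * B <= B]. *)
pose C := 2 * B / (eps / 2); have C0 : 0 < C by rewrite divr_gt0 // mulr_gt0.
exists d, C, L1; split=> //.
have pos (f : nat -> R) (L : nat) : (L1 <= L)%N ->
      (forall n, (n < L)%N -> `|dlk k.+1 f n| <= d) ->
      (forall n, (n < L)%N -> 0 <= dlk k.+1 f n) ->
      csign (dlk k.+2 f) L -> eps * L%:R <= nc (expsum f L) ->
    exists a l : nat, [/\ (a + l <= L)%N,
      forall n, (n < l)%N -> `|dlk k.+1 f (a + n)%N| <= C / L%:R &
      eps / 2 * L%:R <= nc (expsum (fun n => f (a + n)%N) l)].
  move=> LL bd ps sg SL.
  have LR : 0 < L%:R :> R by rewrite ltr0n (leq_trans L10).
  have LX : X0%:R <= eps / 2 * L%:R.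
    rewrite mulrC -ler_pdivrMr //; apply: le_trans L1b _; by rewrite ler_nat.
  pose Q n := dlk k.+1 f n <= C / L%:R.
  have no a l : (a + l <= L)%N -> (forall n, (n < l)%N -> ~~ Q (a + n)%N) ->
      nc (expsum (fun n => f (a + n)%N) l) < eps / 2 * L%:R.
    move=> al nQ; rewrite ltNge; apply/negP => h.
    have lb : eps / 2 * L%:R <= l%:R := le_trans h (expsum_le _ _).
    have CL : 0 < C / L%:R by rewrite divr_gt0.
    have in_L n : (n < l)%N -> (a + n < L)%N.
      by move=> nl; apply: leq_trans al; rewrite -addnS leq_add2l.
    have := P (fun n => f (a + n)%N) l (C / L%:R) _ CL _ _ _.
    have -> : (X0 <= l)%N by rewrite -(ler_nat R); exact: le_trans lb.
    move=> /(_ isT) H.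
    have : C / L%:R * l%:R <= B.
      apply: H => [n nl||].
      - rewrite dlk_shift; have := nQ n nl; rewrite /Q -ltNge => /ltW -> /=.
        exact: le_trans (ler_norm _) (bd _ (in_L _ nl)).
      - by case: sg => h1; [left|right] => n nl; rewrite dlk_shift; apply: h1; apply: in_L.
      - by apply: le_trans h; rewrite ler_pM2l // ler_nat; apply: leq_trans al; rewrite leq_addl.
    have : C / L%:R * (eps / 2 * L%:R) <= C / L%:R * l%:R by rewrite ler_pM2l.
    have -> : C / L%:R * (eps / 2 * L%:R) = 2 * B by rewrite /C; field; rewrite !gt_eqF.
    lra.
  have yes a l t : (forall n, (n < l)%N -> Q (a + n)%N) -> (a + l <= L)%N ->
      nc (expsum f L) <= nc (expsum (fun n => f (a + n)%N) l) + t -> t < eps / 2 * L%:R ->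
      exists a l : nat, [/\ (a + l <= L)%N,
      forall n, (n < l)%N -> `|dlk k.+1 f (a + n)%N| <= C / L%:R &
      eps / 2 * L%:R <= nc (expsum (fun n => f (a + n)%N) l)].
    move=> q al h th; exists a, l; split=> // [n nl|]; last lra.
    rewrite ger0_norm; first exact: q.
    by apply: ps; apply: leq_trans al; rewrite -addnS leq_add2l.
  case: sg => h.
    have up m n : (m <= n < L)%N -> dlk k.+1 f m <= dlk k.+1 f n.
      move=> /andP[mn nL]; rewrite -subr_ge0 -(subnKC mn) telescope_dl sumr_ge0 // => i _.
      apply: h; have := ltn_ord i; move: nL; clear; lia.
    have [|t tL [h1 h2]] := @mono_cut Q L.
      move=> m n mn; apply: le_trans; exact: up.
    apply: (yes 0%N t (nc (expsum (fun n => f (t + n)%N) (L - t)))) => //.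
      by rewrite -{1}(subnKC tL) expsumD; apply: ncD.
    apply: no => [|n nl]; first by rewrite subnKC.
    by apply: h2; rewrite leq_addr -ltn_subRL.
  have dn m n : (m <= n < L)%N -> dlk k.+1 f n <= dlk k.+1 f m.
    move=> /andP[mn nL]; rewrite -subr_le0 -(subnKC mn) telescope_dl -oppr_ge0 -sumrN sumr_ge0 // => i _.
    rewrite oppr_ge0; apply: h; have := ltn_ord i; move: nL; clear; lia.
  have [|t tL [h1 h2]] := @mono_cut (fun n => ~~ Q n) L.
    by move=> m n mn; apply: contra => qm; apply: le_trans qm; apply: dn.
  apply: (yes t (L - t)%N (nc (expsum f t))) => //.
  - move=> n nl; apply/negPn; apply: h2; by rewrite leq_addr -ltn_subRL.
  - by rewrite subnKC.
  - by rewrite -{1}(subnKC tL) expsumD addrC; apply: ncD.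
  - by have := no 0%N t; apply.
move=> f L LL bd [ps|ng] sg SL; first exact: pos.
have [||||a [l [al h1 h2]]] := pos (fun n => - f n) L LL.
- by move=> n nL; rewrite dlkN normrN bd.
- by move=> n nL; rewrite dlkN oppr_ge0 ng.
- by case: sg => h; [right|left] => n nL; rewrite dlkN ?oppr_ge0 ?oppr_le0 h.
- by rewrite expsumN nc_conj.
exists a, l; split=> // [n nl|]; first by have := h1 n nl; rewrite dlkN normrN.
by move: h2; rewrite (expsumN (fun n => f (a + n)%N)) nc_conj.
Qed.

Lemma floor_nat (R : realType) (x : R) : 0 <= x ->
  exists2 n : nat, n%:R <= x & x < n%:R + 1.
Proof.
move=> x0; exists (Num.truncn x); have /andP[h1 h2] := truncn_itv x0; first by [].
by rewrite natr1.
Qed.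

(** On a short block the difference of order j + 1 is almost a constant [v]. Differencing [j] times
    leaves a phase of almost constant slope [b v], and a large sum forces [b v] close to an integer.
    The bound [B] on the denominators precedes [eta] because [inverse_step] chooses [eta] in terms
    of [B]. *)
Lemma near_const (R : realType) (j : nat) (eps : R) : 0 < eps ->
  exists2 B : nat, (0 < B)%N & forall eta C : R, 0 < eta -> 0 < C ->
  exists (c : R) (L0 : nat), 0 < c /\
  forall (f : nat -> R) (L l : nat), (L0 <= L)%N -> (0 < L)%N -> (l <= L)%N ->
    (forall n, (n < l)%N -> `|dlk j.+2 f n| <= C / L%:R) ->
    eps * L%:R <= nc (expsum f l) ->
  exists (a q b : nat) (A : int), [/\ (0 < b <= B)%N, (a + q <= l)%N, c * L%:R <= q%:R,
    forall n, (n < q)%N -> `|dlk j.+1 f (a + n)%N - A%:~R / b%:R| <= eta &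
    eps / 2 * q%:R <= nc (expsum (fun n => f (a + n)%N) q)].
Proof.
move=> e0; have [|H [e' [l0 [e'0 H0 P]]]] := @vdc_iter R j (eps / 2 / 2); first lra.
exists (H ^ j)%N; first by rewrite expn_gt0 H0.
move=> eta C eta0 C0.
have BR : 1 <= (H ^ j)%N%:R :> R by rewrite ler1n expn_gt0 H0.
set B : R := (H ^ j)%N%:R in BR.
have B0 : 0 < B by lra.
pose et := eta / 2 / (1 + 64 * B / e').
have den0 : 0 < 1 + 64 * B / e'.
  by pos.
have et0 : 0 < et by rewrite !divr_gt0.
have etE : et + 64 * B / e' * et = eta / 2.
  by rewrite -{1}[et]mul1r -mulrDl mulrC divfK ?gt_eqF.
(* The first bound keeps the variation over a block below [et]; the second makes the incomplete
   block of [expsum_piece] affordable. *)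
pose c1 := Num.min (et / C) (eps / 2).
have c10 : 0 < c1 by rewrite lt_min !divr_gt0.
have c1C : C * c1 <= et.
  by rewrite mulrC -ler_pdivlMr // ge_min lexx.
have c1e : c1 <= eps / 2 by rewrite ge_min lexx orbT.
pose s := (j * H)%N.
have [L1 L10 L1b] := natr_above (2 / c1 + (2 / c1) * (2 * (l0 + s)%N%:R) +
   (2 / c1) * (2 * s%:R / (eps / 2)) + (2 / c1) * (2 * (32 / e' / eta))).
have [P1 P2 P3 P4] : [/\ 0 <= 2 / c1, 0 <= (2 / c1) * (2 * (l0 + s)%N%:R),
   0 <= (2 / c1) * (2 * s%:R / (eps / 2)) & 0 <= (2 / c1) * (2 * (32 / e' / eta))].
  by split; pos.
exists (c1 / 2), L1; split; first by rewrite divr_gt0.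
move=> f L l LL L0 lL bd SL.
have LR : 0 < L%:R :> R by rewrite ltr0n.
have LLR : L1%:R <= L%:R :> R by rewrite ler_nat.
have [q q1 q2] := @floor_nat R (c1 * L%:R) (ltW (mulr_gt0 c10 LR)).
have big x : 2 / c1 * x <= L%:R -> x <= c1 / 2 * L%:R.
  by move=> h; rewrite -(ler_pM2l (_ : 0 < 2 / c1)) ?divr_gt0 // mulrA
    (_ : 2 / c1 * (c1 / 2) = 1) ?mul1r //; field; rewrite gt_eqF.
have b1 : 1 <= c1 / 2 * L%:R by apply: big; rewrite mulr1; lra.
have b2 : 2 * (l0 + s)%N%:R <= c1 / 2 * L%:R by apply: big; lra.
have b3 : 2 * s%:R / (eps / 2) <= c1 / 2 * L%:R by apply: big; lra.
have b4 : 2 * (32 / e' / eta) <= c1 / 2 * L%:R by apply: big; lra.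
have qc : c1 / 2 * L%:R <= q%:R by lra.
have q0 : (0 < q)%N by rewrite -(ltr0n R); lra.
have sq : (2 * (l0 + s) <= q)%N by rewrite -(ler_nat R) natrM; lra.
have e20 : 0 < eps / 2 by lra.
have [|a aq Sa] := @expsum_piece R (eps / 2) q f l e20 q0.
  have : l%:R <= L%:R :> R by rewrite ler_nat.
  have : q%:R <= eps / 2 * L%:R by apply: le_trans q1 _; rewrite ler_pM2r.
  move: SL e20; clear; set S := nc _ => h1 h2 h3 h4.
  have : eps / 2 * l%:R <= eps / 2 * L%:R by rewrite ler_pM2l.
  lra.
pose f' n := f (a + n)%N.
have [||hs [sz al hS]] := P f' (q - s)%N.
- by move: sq; clear; lia.
- apply: expsum_take => //; [by move: sq; clear; lia|exact: ltW|].
  by rewrite [leRHS]mulrC -ler_pdivrMr //; apply: le_trans qc.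
have sumhs : (q - s + sumn hs <= q)%N.
  have := sumn_all_le al; rewrite sz -/s; move: sq; clear; lia.
have /andP[bn0 bH] := prod_all_le al; rewrite sz in bH.
set b := foldr muln 1%N hs in bn0 bH.
have b0 : 0 < b%:R :> R by rewrite ltr0n.
have b1R : 1 <= b%:R :> R by rewrite ler1n.
have bB : b%:R <= B by rewrite ler_nat.
pose v := dlk j.+1 f a.
have near n : (n < q)%N -> `|dlk j.+1 f (a + n)%N - v| <= et.
  move=> nq; rewrite /v telescope_dl; apply: le_trans (ler_norm_sum _ _ _) _.
  apply: le_trans (_ : n%:R * (C / L%:R) <= _).
    have -> : n%:R * (C / L%:R) = \sum_(i < n) (C / L%:R) by rewrite sumr_const card_ord mulr_natl.
    apply: ler_sum => i _; rewrite -dlkS; apply: bd.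
    have := ltn_ord i; move: nq aq; clear; lia.
  have : n%:R <= c1 * L%:R by apply: le_trans q1; rewrite ler_nat ltnW.
  move=> h; rewrite mulrCA; apply: le_trans c1C; rewrite ler_pM2l // ler_pdivrMr //.
have gb n : (n < q - s)%N -> `|dl (dhs hs f') n - b%:R * v| <= b%:R * et.
  move=> nX; have : b%:R * (v - et) <= dl (dhs hs f') n <= b%:R * (v + et).
    rewrite -[dl _]/(dlk 1 _) dlk_dhs; apply: (@dhs_bounds _ _ _ (q - s)) => // m mX.
    rewrite sz -dlkD addn1 dlk_shift.
    have := near m (leq_trans mX sumhs); rewrite ler_norml; set y := dlk _ _ _; lra.
  by rewrite ler_norml; lra.
have lin := @expsum_linear R (dhs hs f') (q - s) (b%:R * v) (b%:R * et) gb.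
have [A A1 A2] := nearest_int (b%:R * v).
exists a, q, b, A; split=> //; first by rewrite bn0.
move=> n nq.
have qs0 : 0 < (q - s)%N%:R :> R by rewrite ltr0n subn_gt0; move: sq q0; clear; lia.
have qs2 : q%:R <= 2 * (q - s)%N%:R :> R by rewrite -natrM ler_nat; move: sq; clear; lia.
have w1 : nc (ee (b%:R * v) - 1) * e' <= 2 / (q - s)%N%:R + 8 * B * et.
  rewrite -(ler_pM2r qs0) mulrDl divfK ?gt_eqF //.
  apply: le_trans (le_trans _ lin) _.
    by rewrite -mulrA ler_wpM2l ?nc_ge0.
  rewrite lerD2l ler_pM2r //; rewrite -[leRHS]mulrA ler_pM2l // ler_pM2r //.
have w2 : 8 * nc (ee (b%:R * v) - 1) <= eta / 2 + 64 * B / e' * et.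
  rewrite -(ler_pM2r e'0); have -> : (eta / 2 + 64 * B / e' * et) * e' = eta / 2 * e' + 64 * B * et.
    by field; rewrite gt_eqF.
  have : 16 / (q - s)%N%:R <= eta / 2 * e'.
    rewrite ler_pdivrMr //.
    have : 32 / e' / eta <= (q - s)%N%:R by lra.
    rewrite ler_pdivrMr // ler_pdivrMr //.
    set Y := (q - s)%N%:R; clear; lra.
  move: w1; set w := nc _; set Y := _^-1; set Z := B * et; rewrite -!mulrA -/Z; clear; lra.
have : `|v - A%:~R / b%:R| <= 8 * nc (ee (b%:R * v) - 1).
  have -> : v - A%:~R / b%:R = (b%:R * v - A%:~R) / b%:R by field; rewrite gt_eqF.
  rewrite normrM normfV (ger0_norm (ltW b0)); apply: le_trans A2.
  by rewrite ler_pdivrMr // ler_peMr.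
have := near n nq => h1 h2.
rewrite (_ : _ - _ / _ = (dlk j.+1 f (a + n)%N - v) + (v - A%:~R / b%:R)); last by rewrite addrA subrK.
apply: le_trans (ler_normD _ _) _; move: etE h1 h2 w2.
set w := nc _; set y := `|_|; set z := `|_|; clear; lra.
Qed.

(** [g] is monotone, so it changes sign at most once, and one of the two parts keeps half of the
    sum. *)
Lemma sign_cut (R : realType) (f g : nat -> R) (q : nat) (e : R) :
  csign (dl g) q -> e * q%:R <= nc (expsum f q) ->
  exists a l : nat, [/\ (a + l <= q)%N, csign (fun n => g (a + n)%N) l &
    e / 2 * q%:R <= nc (expsum (fun n => f (a + n)%N) l)].
Proof.
move=> sg Sq.
have split2 t : (t <= q)%N -> e / 2 * q%:R <= nc (expsum f t) \/
    e / 2 * q%:R <= nc (expsum (fun n => f (t + n)%N) (q - t)).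
  move=> tq; have := ncD (expsum f t) (expsum (fun n => f (t + n)%N) (q - t)).
  rewrite -expsumD subnKC //; move: Sq.
  set x := nc _; set y := nc _; set z := nc _ => h1 h2.
  by have [h|h] := lerP (e / 2 * q%:R) y; [left|right; lra].
have mono (s : R) : (forall n, (n < q)%N -> 0 <= s * dl g n) ->
    exists2 t, (t <= q)%N & (forall n, (n < t)%N -> s * g n <= 0) /\
      (forall n, (n < q - t)%N -> 0 <= s * g (t + n)%N).
  move=> h; have [|t tq [h1 h2]] := @mono_cut (fun n => s * g n <= 0) q.
    move=> m n /andP[mn nq]; apply: le_trans; rewrite -subr_ge0 -mulrBr -(subnKC mn) telescope_dl mulr_sumr sumr_ge0 // => i _.
    apply: h; have := ltn_ord i; move: nq; clear; lia.
  exists t => //; split=> // n nq; apply: ltW; rewrite ltNge; apply: h2.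
  by rewrite leq_addr -ltn_subRL.
case: sg => h.
  have [|t tq [h1 h2]] := mono 1; first by move=> n nq; rewrite mul1r h.
  case: (split2 t tq) => hS; [exists 0%N, t|exists t, (q - t)%N]; split=> //.
  - by right => n nt; have := h1 n nt; rewrite mul1r.
  - by rewrite subnKC.
  - by left => n nt; have := h2 n nt; rewrite mul1r.
have [|t tq [h1 h2]] := mono (-1); first by move=> n nq; rewrite mulN1r oppr_ge0 h.
case: (split2 t tq) => hS; [exists 0%N, t|exists t, (q - t)%N]; split=> //.
- by left => n nt; have := h1 n nt; rewrite mulN1r oppr_le0.
- by rewrite subnKC.
- by right => n nt; have := h2 n nt; rewrite mulN1r oppr_ge0.
Qed.

(** * The inverse theorem for exponential sums *)

(* [f] has small (k+1)-st differences; a large exponential sum forces it to be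
   close to [P / M], [P] an integer valued polynomial of degree at most [k],
   along a progression of step [p].  The difference is only controlled through
   its increments, which are O(1/L), hence the additive constant is free. *)
Definition inverse_at (R : realType) (k : nat) (eps : R) (p M L0 : nat) (C c d : R) : Prop :=
  [/\ (0 < p)%N, (0 < M)%N, 0 < C, 0 < c & 0 < d] /\
  forall (f : nat -> R) (L : nat), (L0 <= L)%N ->
    (forall n, (n < L)%N -> `|dlk k.+1 f n| <= d) ->
    csign (dlk k.+1 f) L -> csign (dlk k.+2 f) L -> eps * L%:R <= nc (expsum f L) ->
  exists (r l : nat) (P : nat -> int), [/\ c * L%:R <= l%:R, (r + p * l <= L)%N,
    forall m, dlk k.+1 P m = 0 &
    forall m, (m < l)%N ->
      `|M%:R * (f (r + p * m.+1)%N - f (r + p * m)%N) - (dl P m)%:~R| <= C / L%:R].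

Definition inverse_prop (R : realType) (k : nat) : Prop := forall eps : R, 0 < eps ->
  exists (p M L0 : nat) (C c d : R), inverse_at k eps p M L0 C c d.

Lemma inverse0 (R : realType) : inverse_prop R 0.
Proof.
move=> eps e0; have [d [C [L0 [d0 C0 P]]]] := cut_large 0 e0.
exists 1%N, 1%N, L0, C, (eps / 2), d; split; first by split=> //; pos.
move=> f L LL bd s1 s2 SL; have [a [l [al h1 h2]]] := P f L LL bd s1 s2 SL.
exists a, l, (fun _ => 0); split=> [||m|m ml].
- exact: le_trans h2 (expsum_le _ _).
- by rewrite mul1n.
- by rewrite /dlk /= /dl subrr.
- have := h1 m ml; rewrite !mul1n mul1r /dlk /= /dl subrr subr0 addnS; congr (`|_| <= _).
Qed.

Lemma csign_sub (R : realType) (f : nat -> R) (a l L : nat) : (a + l <= L)%N ->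
  csign f L -> csign (fun n => f (a + n)%N) l.
Proof.
by move=> al [] h; [left|right] => n nL; apply: h; apply: leq_trans al; rewrite -addnS leq_add2l.
Qed.

Lemma eq_csign (R : realType) (f g : nat -> R) (L : nat) :
  (forall n, (n < L)%N -> f n = g n) -> csign f L -> csign g L.
Proof. by move=> e [] h; [left|right] => n nL; rewrite -e ?h. Qed.

Lemma binom_period_mul (b B k n m : nat) : (0 < b <= B)%N ->
  exists z : nat, ('C(n + B`! * k`! * m, k) = 'C(n, k) + b * z)%N.
Proof.
move=> bB; elim: m => [|m [z IH]]; first by exists 0%N; rewrite !muln0 !addn0.
have [z' e] := binom_period k (n + B`! * k`! * m) bB.
by exists (z + z')%N; rewrite mulnS [(_ * _ + _ * m)%N]addnC addnA e IH mulnDr addnA.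
Qed.

(** Once the difference of order j + 1 is close to A/b, subtract A/b times the binomial polynomial
    of degree j + 1 and restrict to a progression on which that polynomial is constant modulo 1.
    What remains has small differences of order j + 1 and a large sum, so the case [j] applies to
    it. *)
Lemma inverse_step (R : realType) (j : nat) : inverse_prop R j -> inverse_prop R j.+1.
Proof.
move=> IH eps e0.
have [d1 [C1 [L1 [d10 C10 P1]]]] := cut_large j.+1 e0.
have e20 : 0 < eps / 2 by pos.
have [B B0 P2] := near_const j e20.
(* [cut_large], [near_const], [sign_cut] and the removal of a tail each halve the sum. *)
have e160 : 0 < eps / 16 by pos.
have [p' [M' [L' [C' [c' [d' [[p'0 M'0 C'0 c'0 d'0] P3]]]]]]] := IH _ e160.
pose pp := (B`! * (j.+1)`!)%N.
have pp0 : (0 < pp)%N by rewrite muln_gt0 !fact_gt0.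
have ppR : 0 < pp%:R :> R by rewrite ltr0n.
have fB0 : 0 < (B`!)%:R :> R by rewrite ltr0n fact_gt0.
have ppk0 : 0 < (pp ^ j.+1)%N%:R :> R by rewrite ltr0n expn_gt0 pp0.
(* Passing to step [pp] multiplies the bound on differences of order j + 1 by [pp ^ j.+1]. *)
pose eta := d' / (pp ^ j.+1)%N%:R.
have eta0 : 0 < eta by pos.
have [c2 [L2 [c20 {}P2]]] := P2 eta C1 eta0 C10.
pose c3 := eps / 16 * c2 / pp%:R; have c30 : 0 < c3 by pos.
have [L3 L30 L3b] := natr_above (L'%:R / c3 + (pp * (j + 4))%N%:R / (eps / 16 * c2)).
exists (pp * p')%N, (M' * B`!)%N, (L1 + L2 + L3)%N, ((B`!)%:R * C' / c3), (c' * c3), d1.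
split; first by split; rewrite ?muln_gt0 ?pp0 ?p'0 ?M'0 ?fact_gt0 //; pos.
move=> f L LL bd sg1 sg2 SL.
have [LL1 LL2 LL3] : [/\ (L1 <= L)%N, (L2 <= L)%N & (L3 <= L)%N].
  by move: LL; clear; split; lia.
have L0 : (0 < L)%N by apply: leq_trans LL3.
have LR : 0 < L%:R :> R by rewrite ltr0n.
have L3R : L3%:R <= L%:R :> R by rewrite ler_nat.
have [a0 [l0 [al0 h01 h02]]] := P1 f L LL1 bd sg1 sg2 SL.
have l0L : (l0 <= L)%N by apply: leq_trans al0; rewrite leq_addl.
have bd0 n : (n < l0)%N -> `|dlk j.+2 (fun n => f (a0 + n)%N) n| <= C1 / L%:R.
  by move=> nl; rewrite dlk_shift h01.
have [a1 [q [b [A [bB al1 cq near Sq]]]]] := P2 _ L l0 LL2 L0 l0L bd0 h02.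
have /andP[b0 _] := bB; have bR : 0 < b%:R :> R by rewrite ltr0n.
pose s := (a0 + a1)%N.
pose F n := f (s + n)%N - A%:~R / b%:R * ('C(n, j.+1))%:R.
have DF n : dlk j.+1 F n = dlk j.+1 f (s + n)%N - A%:~R / b%:R.
  rewrite (dlk_sub _ (fun n => f (s + n)%N)) dlk_shift dlkM dlk_binom leqnn subnn bin0 mulr1 //.
have DDF n : dlk j.+2 F n = dlk j.+2 f (s + n)%N.
  rewrite (dlk_sub _ (fun n => f (s + n)%N)) dlk_shift dlkM dlk_binom ltnn mulr0 subr0 //.
have nearF n : (n < q)%N -> - eta <= dlk j.+1 F n <= eta.
  by move=> nq; have := near n nq; rewrite dlk_shift addnA -DF ler_norml.
have sq : (s + q <= L)%N by move: al0 al1; rewrite /s; clear; lia.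
have sgF : csign (dl (dlk j.+1 F)) q.
  apply: (@eq_csign _ (fun n => dlk j.+2 f (s + n)%N)).
    by move=> n nq; rewrite -dlkS DDF.
  exact: csign_sub sg1.
have Sq' : eps / 4 * q%:R <= nc (expsum (fun n => f (s + n)%N) q).
  have <- : expsum (fun n => f (a0 + (a1 + n))%N) q = expsum (fun n => f (s + n)%N) q.
    by apply: eq_expsum => n _; rewrite addnA.
  by apply: le_trans Sq; rewrite ler_wpM2r ?ler0n //; lra.
have [a2 [l2 [al2 sg3 S2]]] := @sign_cut R (fun n => f (s + n)%N) (dlk j.+1 F) q (eps / 4) sgF Sq'.
(* Giving up [j + 3] blocks keeps every point that enters a difference of [Ft] of order at most j +
   2 inside the piece. *)
pose l3 := (l2 %/ pp - (j + 3))%N.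
have l3l2 : (pp * l3 <= l2)%N.
  by rewrite mulnBr; apply: leq_trans (leq_subr _ _) _; rewrite mulnC leq_trunc_div.
have l2l3 : (l2 - pp * l3 <= pp * (j + 4))%N.
  rewrite leq_subLR -mulnDr; apply: leq_trans (ltnW (ltn_ceil l2 pp0)) _.
  by rewrite mulnC leq_mul2l; apply/orP; right; rewrite /l3; clear; lia.
have qc2 : (pp * (j + 4))%N%:R <= eps / 16 * q%:R.
  apply: le_trans (_ : eps / 16 * (c2 * L%:R) <= _); last by rewrite ler_pM2l.
  rewrite mulrA -ler_pdivrMl ?mulr_gt0 // mulrC; apply: le_trans L3R.
  by apply: le_trans L3b; rewrite lerDr; pos.
pose G n := f (s + (a2 + n))%N.
have S3 : eps / 16 * q%:R <= nc (expsum G (pp * l3)).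
  have := ncD (expsum G (pp * l3)) (expsum (fun n => G (pp * l3 + n)%N) (l2 - pp * l3)).
  rewrite -expsumD subnKC //.
  have : nc (expsum (fun n => G (pp * l3 + n)%N) (l2 - pp * l3)) <= (pp * (j + 4))%N%:R.
    by apply: le_trans (expsum_le _ _) _; rewrite ler_nat.
  move: S2; rewrite -/G; set x := nc _; set y := nc _; set z := nc _; move: qc2; clear; lra.
have ppl3 : eps / 16 * q%:R <= (pp * l3)%N%:R by exact: le_trans S3 (expsum_le _ _).
have l3q : (pp * l3 <= q)%N by apply: leq_trans l3l2 _; apply: leq_trans al2; rewrite leq_addl.
have [|r rp Sr] := @expsum_residue_large R (eps / 16) pp G l3 pp0.
  by apply: le_trans S3; rewrite ler_pM2l // ler_nat.
have l3c : c3 * L%:R <= l3%:R.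
  have -> : c3 * L%:R = eps / 16 * (c2 * L%:R) / pp%:R by rewrite /c3; ring.
  rewrite ler_pdivrMr // [leRHS]mulrC -natrM; apply: le_trans ppl3.
  by rewrite ler_pM2l.
have L'3 : (L' <= l3)%N.
  rewrite -(ler_nat R); apply: le_trans l3c; rewrite mulrC -ler_pdivrMr //.
  apply: le_trans L3R; apply: le_trans L3b; rewrite lerDl; pos.
pose Ft m := F (a2 + (r + pp * m))%N.
have room i m : (i <= j.+2)%N -> (m < l3)%N -> (r + pp * m < l2 - i * pp)%N.
  move=> ij ml; rewrite ltn_subRL.
  apply: leq_trans (_ : (pp * (i + m.+1) <= l2)%N); last first.
    apply: leq_trans (leq_trunc_div l2 pp); rewrite mulnC leq_mul2r; apply/orP; right.
    by move: ij ml; rewrite /l3; clear; lia.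
  by rewrite mulnDr mulnS [(i * pp)%N]mulnC -addnS leq_add2l -addSn leq_add2r.
have Ftk i m : dlk i Ft m = dhs (nseq i pp) (fun n => F (a2 + n)%N) (r + pp * m)%N.
  exact: (@dlk_step R i pp r (fun n => F (a2 + n)%N) m).
have room2 i : (i <= j.+2)%N -> (0 < l3)%N -> (l2 - i * pp + sumn (nseq i pp) = l2)%N.
  move=> ij l30; rewrite sumn_nseq_mul subnK //; have := room i 0%N ij l30; clear; lia.
have bdFt m : (m < l3)%N -> `|dlk j.+1 Ft m| <= d'.
  move=> ml; rewrite Ftk.
  have := @dhs_bounds R (nseq j.+1 pp) (fun n => F (a2 + n)%N) (l2 - j.+1 * pp)%N (- eta) eta _ _ (room _ _ (leqnSn _) ml).
  rewrite size_prod_nseq size_nseq => H; rewrite ler_norml.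
  have -> : d' = (pp ^ j.+1)%N%:R * eta by rewrite mulrC /eta divfK ?gt_eqF.
  rewrite -mulrN; apply: H => n; rewrite room2 //; last exact: leq_ltn_trans ml.
  move=> nl; rewrite dlk_shift; apply: nearF.
  by apply: leq_trans al2; rewrite -addnS leq_add2l.
have sgFt i : (i <= j.+2)%N -> csign (fun n => dlk i F (a2 + n)%N) l2 -> csign (dlk i Ft) l3.
  move=> ij sg; have [->|l30] := posnP l3; first by left.
  have := @dhs_csign R (nseq i pp) (fun n => F (a2 + n)%N) (l2 - i * pp)%N.
  rewrite room2 // size_nseq => H.
  have {}H : csign (dhs (nseq i pp) (fun n => F (a2 + n)%N)) (l2 - i * pp).
    by apply: H; apply: eq_csign sg => n _; rewrite dlk_shift.
  by case: H => H; [left|right] => n nl; rewrite Ftk; apply: H; apply: room.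
have dvb : (b %| B`!)%N by apply: dvdn_fact.
have GF n : G n = F (a2 + n)%N + A%:~R / b%:R * ('C(a2 + n, j.+1))%:R by rewrite /F /G subrK.
(* Along the progression the binomial changes by multiples of [b], so the subtracted term changes by
   integers, which [ee] does not see. *)
have SFt : eps / 16 * l3%:R <= nc (expsum Ft l3).
  apply: le_trans Sr _; rewrite -(expsum_cst Ft (A%:~R / b%:R * ('C(a2 + r, j.+1))%:R)).
  rewrite le_eqVlt; apply/orP; left; apply/eqP; congr nc; apply: eq_bigr => m _.
  rewrite GF; have [z ez] := @binom_period_mul b B j.+1 (a2 + r) m bB.
  rewrite addnA -/pp in ez *; rewrite ez natrD natrM mulrDr addrA.
  have -> : A%:~R / b%:R * (b%:R * z%:R) = (A * z%:Z)%:~R :> R.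
    by rewrite intrM -pmulrn mulrA divfK ?gt_eqF.
  by rewrite eeDint /Ft addnA.
have sgj : csign (fun n => dlk j.+2 F (a2 + n)%N) l2.
  by apply: (@csign_sub _ _ _ _ q) => //; rewrite dlkS.
have [r' [l' [P' [cl' rl' DP' close]]]] := P3 Ft l3 L'3 bdFt (sgFt _ (leqnSn _) sg3) (sgFt _ (leqnn _) sgj) SFt.
pose B1 := (B`! %/ b)%N.
have B1E : B1%:R = (B`!)%:R / b%:R :> R.
  by rewrite -[in RHS](divnK dvb) natrM mulfK ?gt_eqF.
(* The factor M' B! clears the denominators of both P'/M' and A/b. *)
pose P m : int := (B`!)%:R * P' m + (M'%:Z * B1%:Z * A) * ('C(a2 + r + pp * r' + pp * p' * m, j.+1))%:R.
exists (s + a2 + r + pp * r')%N, l', P; split.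
- rewrite -mulrA; apply: le_trans cl'; rewrite ler_pM2l //.
- apply: leq_trans sq; rewrite -!addnA !leq_add2l.
  apply: leq_trans al2; rewrite leq_add2l.
  rewrite -mulnA -mulnDr; apply: leq_trans (_ : (pp * (l3 + 1) <= l2)%N).
    rewrite [leqRHS]mulnDr muln1 [leqRHS]addnC; apply: leq_add; first exact: ltnW.
    by rewrite leq_mul2l rl' orbT.
  have [l30|l30] := posnP l3.
    by exfalso; move: ppl3; rewrite l30 muln0 leNgt => /negP; apply; rewrite mulr_gt0 //; apply: lt_le_trans cq; rewrite mulr_gt0.
  have : (l3.-1 < l3)%N by rewrite prednK.
  move=> /(room 2%N _ isT); have -> : (pp * (l3 + 1) = pp * l3.-1 + 2 * pp)%N.
    by rewrite -{1}(prednK l30) addn1 !mulnS mul2n -addnn addnA addnC.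
  move: pp0; clear; lia.
- move=> m; rewrite (dlk_add _ (fun m => (B`!)%:R * P' m)) dlkM dlkM dlkS /dl !DP' subrr mulr0 add0r.
  by rewrite (@dlk_binom_affine j.+1 (pp * p') (a2 + r + pp * r') j.+2 m) ?mulr0.
move=> m ml.
have idx i : (s + a2 + r + pp * r' + pp * p' * i = s + (a2 + (r + pp * (r' + p' * i))))%N.
  by rewrite mulnDr mulnA !addnA.
have idx2 i : (a2 + r + pp * r' + pp * p' * i = a2 + (r + pp * (r' + p' * i)))%N.
  by rewrite mulnDr mulnA !addnA.
have fE i : f (s + a2 + r + pp * r' + pp * p' * i)%N = Ft (r' + p' * i)%N + A%:~R / b%:R * ('C(a2 + r + pp * r' + pp * p' * i, j.+1))%:R.
  by rewrite idx -/(G _) GF idx2.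
have dE : (M' * B`!)%:R * (f (s + a2 + r + pp * r' + pp * p' * m.+1)%N - f (s + a2 + r + pp * r' + pp * p' * m)%N) - (dl P m)%:~R
   = (B`!)%:R * (M'%:R * (Ft (r' + p' * m.+1)%N - Ft (r' + p' * m)%N) - (dl P' m)%:~R).
  rewrite !fE /P /dl; move: (Ft _) (Ft _) (binomial _ _) (binomial _ _) (P' _) (P' _) => x y u v z w.
  rewrite !natz !(intrB, intrD, intrM) -!pmulrn B1E natrM.
  by field; rewrite gt_eqF.
rewrite dE normrM (ger0_norm (ltW fB0)) -!mulrA ler_pM2l //.
apply: le_trans (close m ml) _; rewrite ler_pM2l // -invfM lef_pV2 ?posrE //.
  by apply: lt_le_trans l3c; rewrite mulr_gt0.
by rewrite mulr_gt0.
Qed.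

Lemma inverse_thm (R : realType) (k : nat) : inverse_prop R k.
Proof. by elim: k => [|k IH]; [exact: inverse0|exact: inverse_step]. Qed.

(** * Sums x + y in dense sets *)

Lemma ee_neq1 (R : realType) (s : R) : 0 < `|s| < 1 -> ee s != 1.
Proof.
move=> /andP[s0 s1]; apply/eqP => e; have := nc_ee_sub1 s; rewrite e subrr nc0.
have [p2 p4] := pi_bounds R; have p0 : 0 < pi :> R by lra.
have h : 0 < sin (pi * `|s|) by apply: sin_gt0_pi; rewrite mulr_gt0 //= gtr_pMr.
have -> : `|sin (pi * s)| = sin (pi * `|s|).
  have [s2|s2] := ger0P s; first by rewrite gtr0_norm //; move: h; rewrite ger0_norm.
  by rewrite mulrN sinN ltr0_norm // -oppr_gt0 -sinN -mulrN; move: h; rewrite ltr0_norm.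
lra.
Qed.

Lemma geom_sum (R : realType) (s : R) (N : nat) :
  (ee s - 1) * (\sum_(j < N) ee (j%:R * s)) = ee (N%:R * s) - 1.
Proof. by rewrite -eeX subrX1; congr (_ * _); apply: eq_bigr => i _; rewrite eeX. Qed.

(** The Fejer kernel of period [T] in [t], with integral 1 over a period and value [J] at 0. *)
Definition fejer (R : realType) (T J : nat) (t : R) : R :=
  nc (\sum_(j < J * T) ee (j%:R * (t / T%:R))) ^+ 2 / (J%:R * T%:R ^+ 2).

Lemma fejer_le (R : realType) (T J : nat) (t : R) : (0 < T)%N -> (0 < J)%N ->
  0 < `|t| <= 7 / 8 * T%:R -> fejer T J t <= 256 / J%:R / t ^+ 2.
Proof.
move=> T0 J0 /andP[t0 tT]; have TR : 0 < T%:R :> R by rewrite ltr0n.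
have JR : 0 < J%:R :> R by rewrite ltr0n.
have t20 : 0 < t ^+ 2 by rewrite -real_normK ?num_real // exprn_gt0.
have nT : `|t / T%:R| = `|t| / T%:R by rewrite normrM normfV (ger0_norm (ltW TR)).
have h : `|t| / T%:R / 8 <= nc (ee (t / T%:R) - 1).
  by rewrite -nT; apply: ee_sub1_ge; rewrite nT ler_pdivrMr.
have h2 : `|t| / T%:R / 8 * nc (\sum_(j < J * T) ee (j%:R * (t / T%:R))) <= 2.
  apply: le_trans (_ : nc (ee (t / T%:R) - 1) * nc (\sum_(j < J * T) ee (j%:R * (t / T%:R))) <= _).
    by rewrite ler_wpM2r ?nc_ge0.
  by rewrite -ncM geom_sum; apply: le_trans (ncD _ _) _; rewrite ncN nc1 nc_ee.
rewrite /fejer; set S := nc _ in h2 *.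
have S0 : 0 <= S by exact: nc_ge0.
have h3 : `|t| * S <= 16 * T%:R.
  have e : `|t| * S = (`|t| / T%:R / 8 * S) * (8 * T%:R) by field; rewrite gt_eqF.
  by rewrite e (_ : 16 * T%:R = 2 * (8 * T%:R)) ?ler_pM2r ?mulr_gt0 //; ring.
have h4 : t ^+ 2 * S ^+ 2 <= 256 * T%:R ^+ 2.
  have -> : 256 * T%:R ^+ 2 = (16 * T%:R) ^+ 2 :> R by ring.
  rewrite -[t ^+ 2]real_normK ?num_real // -exprMn lerXn2r // nnegrE.
    by rewrite mulr_ge0.
  by rewrite mulr_ge0 // ler0n.
rewrite ler_pdivrMr; last by pos.
have -> : 256 / J%:R / t ^+ 2 * (J%:R * T%:R ^+ 2) = 256 * T%:R ^+ 2 / t ^+ 2.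
  by have tn0 : t != 0 by [rewrite -normr_gt0]; field; rewrite ?tn0 ?gt_eqF.
by rewrite ler_pdivlMr // mulrC.
Qed.

Lemma fejer_int0 (R : realType) (T : nat) (t : int) : (0 < T)%N ->
  (0 < `|t| < T)%N -> fejer T 1 (t%:~R : R) = 0.
Proof.
move=> T0 /andP[t0 tT]; have TR : 0 < T%:R :> R by rewrite ltr0n.
have ne : ee (t%:~R / T%:R : R) - 1 != 0.
  rewrite subr_eq0; apply: ee_neq1.
  rewrite normrM normfV (ger0_norm (ltW TR)) ltr_pdivrMr // mul1r -intr_norm.
  by rewrite divr_gt0 //= -abszE -pmulrn ?ltr0n ?ltr_nat.
have := geom_sum (t%:~R / T%:R : R) (1 * T).
have -> : (1 * T)%N%:R * (t%:~R / T%:R) = t%:~R :> R by rewrite mul1n mulrC divfK ?gt_eqF.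
rewrite ee_int subrr => /eqP.
by rewrite mulf_eq0 (negbTE ne) /= /fejer => /eqP ->; rewrite nc0 expr0n mul0r.
Qed.

(** The [J * T] consecutive frequencies run through all characters of Z/T exactly [J] times,
    whatever the offset [h]. *)
Lemma parseval (R : realType) (T J h : nat) (A : {set 'I_T}) : (0 < T)%N ->
  \sum_(j < J * T) nc (\sum_(x in A) ee (- ((h%:R - j%:R) * (x%:R / T%:R) : R))) ^+ 2
  = (J * T)%N%:R * #|A|%:R.
Proof.
move=> T0; have TR : 0 < T%:R :> R by rewrite ltr0n.
have key (j : nat) (x y : 'I_T) : ee (- ((h%:R - j%:R) * (x%:R / T%:R)) : R) * (ee (- ((h%:R - j%:R) * (y%:R / T%:R))))^*%C
    = ee (h%:R * ((y%:R - x%:R) / T%:R)) * ee (j%:R * ((x%:R - y%:R) / T%:R)).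
  by rewrite ee_conj -!eeD; congr ee; ring.
apply: (@complexI R); rewrite rmorph_sum /=.
under eq_bigr => j _.
  rewrite nc_sqrE rmorph_sum mulr_suml /=.
  under eq_bigr => x _.
    rewrite mulr_sumr.
    under eq_bigr => y _ do rewrite key.
    over.
  over.
rewrite exchange_big /=.
transitivity (\sum_(x in A) ((J * T)%N%:R : R[i])).
  apply: eq_bigr => x xA; rewrite exchange_big /= (bigD1 x) //= subrr mul0r.
  under eq_bigr => j _ do rewrite !mulr0 ee0 mulr1.
  rewrite sumr_const card_ord big1 ?addr0 // => y /andP[yA yx].
  rewrite -mulr_sumr; apply/eqP; rewrite mulf_eq0; apply/orP; right.
  have ne : ee ((x%:R - y%:R) / T%:R : R) - 1 != 0.
    rewrite subr_eq0; apply: ee_neq1.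
    rewrite normrM normfV (ger0_norm (ltW TR)) ltr_pdivrMr // mul1r divr_gt0 //=; last first.
      by rewrite normr_gt0 subr_eq0 eqr_nat eq_sym.
    have := ltn_ord x; have := ltn_ord y; rewrite -!(ltr_nat R) => h1 h2.
    by rewrite ltr_norml; apply/andP; split; have := ler0n R x; have := ler0n R y; lra.
  have := geom_sum ((x%:R - y%:R) / T%:R : R) (J * T).
  have -> : (J * T)%N%:R * ((x%:R - y%:R) / T%:R) = (J%:Z * (x%:Z - y%:Z))%:~R :> R.
    by rewrite intrM intrB -!pmulrn natrM; field; rewrite gt_eqF.
  by rewrite ee_int subrr => /eqP; rewrite mulf_eq0 (negbTE ne).
rewrite sumr_const -[LHS]mulr_natr; apply/esym; rewrite -natrM.
by rewrite (rmorph_nat (real_complex R)) natrM.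
Qed.

(** Expanding the squared kernel gives a double sum over frequencies a, b. The diagonal is the
    expected count; off it the sum over [m] is at most [eps * K], and the product of the sums over
    [A] and [B] is split by the inequality between arithmetic and geometric means and summed by
    Parseval. *)
Lemma density (R : realType) (T J K : nat) (u : nat -> R) (eps h : R) (A B : {set 'I_T}) :
  (0 < T)%N -> (0 < J)%N -> 0 <= eps ->
  (forall j, (0 < j < J * T)%N -> nc (expsum (fun m => j%:R * (u m / T%:R)) K) <= eps * K%:R) ->
  K%:R * #|A|%:R * #|B|%:R / T%:R - eps * J%:R * K%:R * ((#|A|%:R + #|B|%:R) / 2) <=
  \sum_(m < K) \sum_(x in A) \sum_(y in B) fejer T J (u m - h - x%:R - y%:R).
Proof.
move=> T0 J0 eps0 small.
have TR : 0 < T%:R :> R by rewrite ltr0n.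
have JR : 0 < J%:R :> R by rewrite ltr0n.
pose w (a b : nat) (t : R) := ee ((a%:R - b%:R) * (t / T%:R)).
pose E a b : R[i] := \sum_(m < K) w a b (u m).
pose Ah (C : {set 'I_T}) (a b : nat) : R[i] := \sum_(x in C) ee (- ((a%:R - b%:R) * (x%:R / T%:R))).
pose X := \sum_(m < K) \sum_(x in A) \sum_(y in B)
  nc (\sum_(j < J * T) ee (j%:R * ((u m - h - x%:R - y%:R) / T%:R))) ^+ 2.
have XE : \sum_(m < K) \sum_(x in A) \sum_(y in B) fejer T J (u m - h - x%:R - y%:R)
    = X / (J%:R * T%:R ^+ 2).
  rewrite /X mulr_suml; apply: eq_bigr => m _; rewrite mulr_suml; apply: eq_bigr => x _.
  by rewrite mulr_suml.
have XC : X%:C%C = \sum_(a < J * T) \sum_(b < J * T) E a b * (w a b (- h) * (Ah A a b * Ah B a b)).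
  rewrite /X rmorph_sum /=.
  under eq_bigr => m _.
    rewrite rmorph_sum /=.
    under eq_bigr => x _.
      rewrite rmorph_sum /=.
      under eq_bigr => y _.
        rewrite (@nc_sum_sqr _ (J * T) (fun j => ee (j%:R * ((u m - h - x%:R - y%:R) / T%:R)))).
        over.
      rewrite exchange_big /=; under eq_bigr => a _ do rewrite exchange_big /=.
      over.
    rewrite exchange_big /=; under eq_bigr => a _ do rewrite exchange_big /=.
    over.
  rewrite exchange_big /=; apply: eq_bigr => a _; rewrite exchange_big /=; apply: eq_bigr => b _.
  rewrite /E mulr_suml; apply: eq_bigr => m _.
  rewrite mulrA /Ah mulr_suml mulr_sumr; apply: eq_bigr => x _.
  rewrite !mulr_sumr; apply: eq_bigr => y _.
  by rewrite ee_conj -!eeD; congr ee; field; rewrite gt_eqF.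
pose D : R := K%:R * #|A|%:R * #|B|%:R.
have diag (a : 'I_(J * T)) : E a a * (w a a (- h) * (Ah A a a * Ah B a a)) = D%:C%C.
  have w1 t : w a a t = 1 by rewrite /w subrr mul0r ee0.
  have A1 C : Ah C a a = #|C|%:R.
    by rewrite /Ah; under eq_bigr do rewrite subrr mul0r oppr0 ee0; rewrite sumr_const.
  rewrite /E; under eq_bigr do rewrite w1; rewrite sumr_const card_ord w1 mul1r !A1.
  by rewrite /D !rmorphM /= !rmorph_nat mulrA.
have Esm (a b : nat) : (a < J * T)%N -> (b < J * T)%N -> a != b -> nc (E a b) <= eps * K%:R.
  move=> aN bN ab; have lem (c d : nat) : (d < c < J * T)%N -> nc (E c d) <= eps * K%:R.
    move=> /andP[dc cN]; have := small (c - d)%N; rewrite subn_gt0 dc /= => H.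
    apply: le_trans (H _); last by apply: leq_ltn_trans cN; rewrite leq_subr.
    rewrite le_eqVlt; apply/orP; left; apply/eqP; congr nc; apply: eq_bigr => m _.
    by rewrite /w natrB // ltnW.
  case: (ltngtP a b) => [ba|ba|e]; last by rewrite e eqxx in ab.
    rewrite -nc_conj rmorph_sum /=; apply: le_trans (lem b a _); last by rewrite ba.
    rewrite le_eqVlt; apply/orP; left; apply/eqP; congr nc; apply: eq_bigr => m _.
    by change ((w a b (u m))^*%C = w b a (u m)); rewrite ee_conj -mulNr opprB.
  by apply: lem; rewrite ba.
have off (a b : nat) : (a < J * T)%N -> (b < J * T)%N -> a != b ->
    nc (E a b * (w a b (- h) * (Ah A a b * Ah B a b))) <=
    eps * K%:R * ((nc (Ah A a b) ^+ 2 + nc (Ah B a b) ^+ 2) / 2).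
  move=> aN bN ab; rewrite ncM; apply: ler_pM; rewrite ?nc_ge0 //; first exact: Esm.
  rewrite !ncM nc_ee mul1r; have := sqr_ge0 (nc (Ah A a b) - nc (Ah B a b)).
  by set x := nc _; set y := nc _; clear => ?; nra.
have N0 : ((J * T)%N%:R : R) = J%:R * T%:R by rewrite natrM.
have main : nc (X%:C%C - ((J * T)%N%:R * D)%:C%C) <=
    (J * T)%N%:R * (eps * K%:R * (((J * T)%N%:R * #|A|%:R + (J * T)%N%:R * #|B|%:R) / 2)).
  have -> : ((J * T)%N%:R * D)%:C%C = \sum_(a < J * T) D%:C%C.
    by rewrite sumr_const card_ord rmorphM /= rmorph_nat mulr_natl.
  rewrite XC -sumrB [leRHS]mulrC.
  apply: (@nc_sum_le R (J * T) (fun a => \sum_(b < J * T) E a b * (w a b (- h) * (Ah A a b * Ah B a b)) - D%:C%C)).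
  move=> a aN; rewrite (bigD1 (Ordinal aN)) //= (diag (Ordinal aN)) addrAC subrr add0r.
  apply: le_trans (nc_sum _ _ _) _.
  apply: le_trans (_ : \sum_(b < J * T) eps * K%:R * ((nc (Ah A a b) ^+ 2 + nc (Ah B a b) ^+ 2) / 2) <= _); last first.
    rewrite -mulr_sumr ler_wpM2l ?mulr_ge0 ?ler0n // -mulr_suml big_split /=.
    by rewrite !parseval.
  rewrite [leRHS](bigD1 (Ordinal aN)) //=; apply: ler_wpDl.
    by rewrite !mulr_ge0 ?ler0n // addr_ge0 ?sqr_ge0.
  apply: ler_sum => b ba; apply: off => //.
  by apply: contra ba => /eqP e; apply/eqP/val_inj.
rewrite -rmorphB /= nc_real ler_norml in main; case/andP: main => main _.
rewrite XE ler_pdivlMr; last by pos.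
have -> : (D / T%:R - eps * J%:R * K%:R * ((#|A|%:R + #|B|%:R) / 2)) * (J%:R * T%:R ^+ 2)
  = (J * T)%N%:R * D - (J * T)%N%:R * (eps * K%:R * (((J * T)%N%:R * #|A|%:R + (J * T)%N%:R * #|B|%:R) / 2)).
  by rewrite N0; field; rewrite gt_eqF.
lra.
Qed.

Lemma tail_below (R : realType) (n : nat) (c : R) :
  \sum_(y < n) (if y%:R <= c - 1 / 2 then (c - y%:R)^-2 else 0) <= 8.
Proof.
(* The induction carries the majorant 2/(c - n + 3/4): for s >= 1/2 the difference 2/(s - 1/4) -
   2/(s + 3/4) dominates s^-2, and the majorant never exceeds 8. *)
suff : \sum_(y < n) (if y%:R <= c - 1 / 2 then (c - y%:R)^-2 else 0) <= 8 /\
    (n%:R <= c + 1 / 2 -> \sum_(y < n) (if y%:R <= c - 1 / 2 then (c - y%:R)^-2 else 0) <= 2 / (c - n%:R + 3 / 4)) by case.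
elim: n => [|n [IH1 IH2]].
  rewrite big_ord0; split=> // h; rewrite divr_ge0 //; lra.
rewrite big_ord_recr /=; case: ifPn => [h|]; last first.
  rewrite -ltNge addr0 => h; split=> //; rewrite -natr1; lra.
have n1 : n%:R <= c + 1 / 2 by lra.
have {IH2} IH2 := IH2 n1.
have b : \sum_(y < n) (if y%:R <= c - 1 / 2 then (c - y%:R)^-2 else 0) + (c - n%:R)^-2
    <= 2 / (c - n.+1%:R + 3 / 4).
  apply: le_trans (lerD IH2 (lexx _)) _; rewrite -[n.+1%:R]natr1.
  set s := c - n%:R in h *; have s1 : 1 / 2 <= s by rewrite /s; lra.
  have -> : c - (n%:R + 1) + 3 / 4 = s - 1 / 4 by rewrite /s; lra.
  rewrite -subr_ge0; have -> : 2 / (s - 1 / 4) - (2 / (s + 3 / 4) + s^-2)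
     = (s ^+ 2 - s / 2 + 3 / 16) / ((s - 1 / 4) * (s + 3 / 4) * s ^+ 2).
    by field; rewrite ?gt_eqF //; lra.
  by rewrite divr_ge0 // ?mulr_ge0 ?sqr_ge0 //; nra.
split=> //; apply: le_trans b _; rewrite -natr1 ler_pdivrMr; lra.
Qed.

(** The terms above [c] become terms below a centre when the range is reversed, so [tail_below]
    serves both sides. *)
Lemma tail_sum (R : realType) (n : nat) (c : R) (P : pred 'I_n) :
  (forall y : 'I_n, P y -> 1 / 2 <= `|c - y%:R|) ->
  \sum_(y < n | P y) (c - y%:R)^-2 <= 16.
Proof.
move=> h.
have h1 := tail_below n c; have h2 := tail_below n (n%:R - 1 - c).
have e2 : \sum_(y < n) (if y%:R <= n%:R - 1 - c - 1 / 2 then (n%:R - 1 - c - y%:R)^-2 else 0)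
   = \sum_(y < n) (if c <= y%:R - 1 / 2 then (c - y%:R)^-2 else 0).
  rewrite (reindex_inj rev_ord_inj) /=; apply: eq_bigr => y _.
  have -> : (n - y.+1)%N%:R = n%:R - 1 - y%:R :> R by rewrite natrB ?ltn_ord // -natr1; ring.
  have -> : n%:R - 1 - c - (n%:R - 1 - y%:R) = - (c - y%:R) by ring.
  rewrite sqrrN; congr (if _ then _ else _); apply/idP/idP; lra.
rewrite e2 in h2.
apply: le_trans (_ : _ <= 8 + 8) _; last by rewrite -natrD.
apply: le_trans (lerD h1 h2); rewrite -big_split /= big_mkcond /=; apply: ler_sum => y _.
have p : 0 <= (c - y%:R)^-2 by rewrite invr_ge0 sqr_ge0.
case: ifP => [/h|_]; last by apply: addr_ge0; case: ifP.
have [c0|c0] := ger0P (c - y%:R) => hh.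
  by rewrite (_ : y%:R <= c - 1 / 2); [rewrite lerDl; case: ifP|lra].
by have -> : c <= y%:R - 1 / 2 by [lra]; rewrite lerDr; case: ifP.
Qed.

(* Pairs with [u m - h - x - y] at distance at least 1/2 from 0 contribute only
   O(1/J) to the smoothed count, because of the decay of the Fejer kernel. *)
Lemma dense_hit (R : realType) (T J K n : nat) (u : nat -> R) (eps h : R) (A B : {set 'I_T}) :
  (0 < T)%N -> (0 < J)%N -> (0 < K)%N -> (0 < n)%N -> 0 <= eps -> #|A| = n -> #|B| = n ->
  eps * J%:R + 4096 / J%:R < n%:R / T%:R ->
  (forall j, (0 < j < J * T)%N -> nc (expsum (fun m => j%:R * (u m / T%:R)) K) <= eps * K%:R) ->
  (forall m x y, (m < K)%N -> x \in A -> y \in B -> `|u m - h - x%:R - y%:R| <= 7 / 8 * T%:R) ->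
  exists (m : nat) (x y : 'I_T), [/\ (m < K)%N, x \in A, y \in B & `|u m - h - x%:R - y%:R| < 1 / 2].
Proof.
move=> T0 J0 K0 n0 eps0 An Bn big small range.
apply: contrapT => hno.
have TR : 0 < T%:R :> R by rewrite ltr0n.
have JR : 0 < J%:R :> R by rewrite ltr0n.
have nR : 0 < n%:R :> R by rewrite ltr0n.
have KR : 0 < K%:R :> R by rewrite ltr0n.
have far m x y : (m < K)%N -> x \in A -> y \in B -> 1 / 2 <= `|u m - h - x%:R - y%:R|.
  by move=> mK xA yB; rewrite leNgt; apply/negP => hl; apply: hno; exists m, x, y.
have := density h A B T0 J0 eps0 small; rewrite An Bn => low.
have up : \sum_(m < K) \sum_(x in A) \sum_(y in B) fejer T J (u m - h - x%:R - y%:R)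
    <= K%:R * (n%:R * (256 / J%:R * 16)).
  rewrite -{1}An mulr_natl -[X in _ *+ X](card_ord K) -sumr_const; apply: ler_sum => m _.
  rewrite mulr_natl -sumr_const; apply: ler_sum => x xA.
  apply: le_trans (_ : \sum_(y in B) 256 / J%:R * (u m - h - x%:R - y%:R)^-2 <= _).
    apply: ler_sum => y yB; apply: fejer_le => //; rewrite range // andbT.
    by apply: lt_le_trans (far m x y _ xA yB) => //; lra.
  rewrite -mulr_sumr ler_pM2l; last by pos.
  by apply: tail_sum => y yB; apply: far.
have := le_trans low up.
have -> : K%:R * n%:R * n%:R / T%:R - eps * J%:R * K%:R * ((n%:R + n%:R) / 2)
    = K%:R * (n%:R * (n%:R / T%:R - eps * J%:R)) by field; rewrite gt_eqF.
rewrite !ler_pM2l //.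
have -> : 256 / J%:R * 16 = 4096 / J%:R :> R by rewrite mulrAC -natrM.
by move: big; clear; lra.
Qed.

(** For integers the kernel with [J = 1] vanishes exactly off the multiples of [T], so there is no
    tail to estimate and only frequencies below 1 occur. *)
Lemma dense_hit_int (R : realType) (T K n : nat) (u : nat -> int) (eps : R) (A B : {set 'I_T}) :
  (0 < T)%N -> (0 < K)%N -> (0 < n)%N -> 0 <= eps -> #|A| = n -> #|B| = n ->
  eps < n%:R / T%:R ->
  (forall j, (0 < j < T)%N -> nc (expsum (fun m => j%:R * ((u m)%:~R / T%:R) : R) K) <= eps * K%:R) ->
  (forall m x y, (m < K)%N -> x \in A -> y \in B -> - T%:Z < u m - x%:Z - y%:Z < T%:Z) ->
  exists (m : nat) (x y : 'I_T), [/\ (m < K)%N, x \in A, y \in B & u m = (x + y)%N%:Z].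
Proof.
move=> T0 K0 n0 eps0 An Bn big small range.
apply: contrapT => hno.
have TR : 0 < T%:R :> R by rewrite ltr0n.
have nR : 0 < n%:R :> R by rewrite ltr0n.
have KR : 0 < K%:R :> R by rewrite ltr0n.
have small' j : (0 < j < 1 * T)%N -> nc (expsum (fun m => j%:R * ((u m)%:~R / T%:R) : R) K) <= eps * K%:R.
  by rewrite mul1n; exact: small.
have := density 0 A B T0 (ltnSn 0) eps0 small'; rewrite An Bn.
rewrite big1 => [|m _]; last first.
  rewrite big1 // => x xA; rewrite big1 // => y yB.
  have -> : (u m)%:~R - 0 - x%:R - y%:R = (u m - x%:Z - y%:Z)%:~R :> R.
    by rewrite !intrB -!pmulrn subr0.
  apply: fejer_int0 => //; apply/andP; split; last by have := range m x y (ltn_ord m) xA yB; clear; lia.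
  rewrite lt0n absz_eq0; apply/eqP => e; apply: hno; exists m, x, y; split=> //.
  by move: e; rewrite -addrA -opprD PoszD => /eqP; rewrite subr_eq0 => /eqP.
have -> : K%:R * n%:R * n%:R / T%:R - eps * 1%:R * K%:R * ((n%:R + n%:R) / 2)
    = K%:R * n%:R * (n%:R / T%:R - eps) by field; rewrite gt_eqF.
by rewrite pmulr_rle0 ?mulr_gt0 // subr_le0 leNgt big.
Qed.

(** * Growth in Hardy fields *)

Definition evt (R : realType) (P : R -> Prop) : Prop := exists X, forall x, X <= x -> P x.

Lemma evt_near (R : realType) (P : R -> Prop) : (\forall x \near +oo, P x) -> evt P.
Proof.
by move=> [X [_ h]]; exists (X + 1) => x Xx; apply: h; lra.
Qed.

Lemma near_evt (R : realType) (P : R -> Prop) : evt P -> \forall x \near +oo, P x.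
Proof. by move=> [X h]; exists X; split=> [|x /ltW /h //]; exact: num_real. Qed.

Lemma evtI (R : realType) (P Q : R -> Prop) : evt P -> evt Q -> evt (fun x => P x /\ Q x).
Proof.
move=> [X h] [Y g]; exists (Num.max X Y) => x; rewrite ge_max => /andP[hx gx].
by split; [exact: h|exact: g].
Qed.

Lemma evt_imp (R : realType) (P Q : R -> Prop) : (forall x, P x -> Q x) -> evt P -> evt Q.
Proof. by move=> PQ [X h]; exists X => x /h /PQ. Qed.

Lemma evt_ge (R : realType) (c : R) : evt (fun x => c <= x).
Proof. by exists c. Qed.

Lemma evt_all (R : realType) (n : nat) (P : nat -> R -> Prop) :
  (forall i, (i < n)%N -> evt (P i)) -> evt (fun x => forall i, (i < n)%N -> P i x).
Proof.
elim: n => [|n IH] h; first by exists 0.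
have [|X hX] := evtI (IH _) (h n (ltnSn n)); first by move=> i ni; apply: h; apply: ltnW.
exists X => x /hX[h1 h2] i; rewrite ltnS leq_eqVlt => /orP[/eqP -> //|]; exact: h1.
Qed.

Lemma evt_unif (R : realType) (n : nat) (P : nat -> R -> R -> Prop) :
  (forall i C D x, C <= D -> P i C x -> P i D x) ->
  (forall i, (i < n)%N -> exists C, evt (P i C)) ->
  exists2 C, 0 < C & evt (fun x => forall i, (i < n)%N -> P i C x).
Proof.
move=> mono; elim: n => [|n IH] h; first by exists 1 => //; exists 0.
have [|C C0 hC] := IH; first by move=> i ni; apply: h; apply: ltnW.
have [D hD] := h n (ltnSn n).
exists (Num.max C D); first by rewrite lt_max C0.
apply: evt_imp (evtI hC hD) => x [h1 h2] i; rewrite ltnS leq_eqVlt => /orP[/eqP ->|ni].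
  by apply: mono h2; rewrite le_max lexx orbT.
by apply: mono (h1 i ni); rewrite le_max lexx.
Qed.

Lemma least_nat (P : nat -> Prop) : (exists n, P n) ->
  exists2 n, P n & forall m, (m < n)%N -> ~ P m.
Proof.
move=> [n Pn]; have ex : exists n, `[< P n >] by exists n; apply/asboolP.
exists (ex_minn ex); first by case: ex_minnP => m /asboolP.
move=> m; case: ex_minnP => q _ h mq /asboolP /h; by rewrite leqNgt mq.
Qed.

Lemma hardy_cst0 (R : realType) (H : set (R -> R)) : hardy_field H -> H (cst 0).
Proof.
move=> hH; have := hardy_sub hH (hardy_one hH) (hardy_one hH).
by congr H; apply/funext => x /=; rewrite subrr.
Qed.

Lemma hardy_add (R : realType) (H : set (R -> R)) (f g : R -> R) : hardy_field H ->
  H f -> H g -> H (f \+ g).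
Proof.
move=> hH Hf Hg; have := hardy_sub hH Hf (hardy_sub hH (hardy_cst0 hH) Hg).
by congr H; apply/funext => x /=; rewrite sub0r opprK.
Qed.

(** A Hardy field contains the rational constants but perhaps no other ones, which is why sizes are
    compared with the inverses of integers. *)
Lemma hardy_natV (R : realType) (H : set (R -> R)) (n : nat) : hardy_field H ->
  H (cst n.+1%:R^-1).
Proof.
move=> hH; have Hn : H (cst n.+1%:R).
  elim: n => [|n IH]; first exact: hardy_one.
  have := hardy_add hH IH (hardy_one hH); congr H; apply/funext => x /=.
  by rewrite natr1.
have [|g Hg e] := hardy_inv hH Hn.
  move=> /evt_near[X h]; have := h X (lexx X); rewrite /cst /= => /eqP.
  by rewrite pnatr_eq0.
apply: hardy_germ Hg => //; apply: near_evt; apply: evt_imp (evt_near e) => x /= h.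
by apply: (mulfI (_ : n.+1%:R != 0)); rewrite ?h ?divff ?pnatr_eq0.
Qed.

(** An element that is not eventually 0 has an inverse, hence eventually no zero, and continuity
    then excludes sign changes. *)
Lemma hardy_sign (R : realType) (H : set (R -> R)) (f : R -> R) : hardy_field H -> H f ->
  [\/ evt (fun x => f x = 0), evt (fun x => 0 < f x) | evt (fun x => f x < 0)].
Proof.
move=> hH Hf; have [z|nz] := pselect (germ_eq f (cst 0)).
  by apply: Or31; apply: evt_near.
have [g Hg e] := hardy_inv hH Hf nz.
have [X h] := evtI (evt_near e) (evt_near (hardy_continuous hH Hf)).
have fne x : X <= x -> f x != 0.
  move=> /h[/= h1 _]; apply/eqP => f0; move: h1; rewrite f0 mul0r => /eqP.
  by rewrite eq_sym oner_eq0.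
have ivt a b : X <= a -> a <= b -> ~ (Num.min (f a) (f b) <= 0 <= Num.max (f a) (f b)).
  move=> Xa ab s; have [|c] := @IVT R f a b 0 ab _ s.
    apply: continuous_in_subspaceT => x; rewrite inE /= in_itv /= => /andP[ax _].
    by case: (h x (le_trans Xa ax)).
  rewrite in_itv /= => /andP[ac _] fc; have := fne c (le_trans Xa ac).
  by rewrite fc eqxx.
have [fX|fX|fX] := ltgtP (f X) 0; last by have := fne X (lexx X); rewrite fX eqxx.
  apply: Or33; exists X => x Xx; rewrite ltNge; apply/negP => fx.
  by apply: (ivt X x) => //; rewrite ge_min le_max (ltW fX) fx orbT.
apply: Or32; exists X => x Xx; rewrite ltNge; apply/negP => fx.
by apply: (ivt X x) => //; rewrite ge_min le_max (ltW fX) fx orbT.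
Qed.

Lemma hardy_size (R : realType) (H : set (R -> R)) (f : R -> R) (m : nat) : hardy_field H -> H f ->
  [\/ evt (fun x => `|f x| <= m.+1%:R^-1), evt (fun x => m.+1%:R^-1 <= f x) |
      evt (fun x => f x <= - m.+1%:R^-1)].
Proof.
move=> hH Hf; have := hardy_natV m hH; set v := m.+1%:R^-1 => Hm.
have a : evt (fun x => v <= f x) \/ evt (fun x => f x <= v).
  case: (hardy_sign hH (hardy_sub hH Hf Hm)) => h; [left|left|right];
    by apply: evt_imp h => x; rewrite /= /cst; clear; lra.
have b : evt (fun x => f x <= - v) \/ evt (fun x => - v <= f x).
  case: (hardy_sign hH (hardy_add hH Hf Hm)) => h; [left|right|left];
    by apply: evt_imp h => x; rewrite /= /cst; clear; lra.
case: a => a; first by apply: Or32.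
case: b => b; first by apply: Or33.
apply: Or31; apply: evt_imp (evtI a b) => x [h1 h2]; by rewrite ler_norml h1 h2.
Qed.

Lemma inv_nat_small (R : realType) (e : R) : 0 < e -> exists m : nat, m.+1%:R^-1 <= e.
Proof.
move=> e0; have [n n0 h] := natr_above e^-1; exists n.-1.
by rewrite prednK // invf_ple ?posrE ?ltr0n.
Qed.

Lemma mvt_ge (R : realType) (f df : R -> R) (a b c : R) : a <= b ->
  (forall x, a <= x -> is_derive x 1 f (df x)) -> (forall x, a <= x <= b -> c <= df x) ->
  c * (b - a) <= f b - f a.
Proof.
move=> ab fd h; have [x xab ->] := mvt_closed ab (fun x h => fd x (proj1 (andP h))).
by rewrite ler_wpM2r ?subr_ge0 // h.
Qed.

(** The mean value theorem on [[x / 2, x]] gives twice the claimed growth; the spare half absorbs a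
    negative [f X]. *)
Lemma growth_up (R : realType) (f df : R -> R) (c : R) (j : nat) : 0 < c ->
  evt (fun x => is_derive x 1 f (df x)) -> evt (fun x => c * x ^+ j <= df x) ->
  exists2 c', 0 < c' & evt (fun x => c' * x ^+ j.+1 <= f x).
Proof.
move=> c0 h1 h2; have [X h] := evtI (evtI h1 h2) (evt_ge (1 : R)).
have X1 : 1 <= X by case: (h X (lexx X)).
exists (c / 4 ^+ j.+1); first by pos.
have Y0 : 0 < c / 4 ^+ j.+1 by pos.
exists (4 * X + 4 * `|f X| / c) => x hx.
have hf : 0 <= 4 * `|f X| / c by pos.
have x4 : 4 * X <= x by lra.
have x0 : 0 < x by lra.
have fx2 : f X <= f (x / 2).
  rewrite -subr_ge0; apply: le_trans (_ : 0 * (x / 2 - X) <= _); first by rewrite mul0r.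
  apply: (@mvt_ge R f df) => [|y Xy|y /andP[Xy _]]; [lra|by case: (h y Xy) => -[]|].
  case: (h y Xy) => -[_ h3] y1; apply: le_trans h3; rewrite mulr_ge0 ?exprn_ge0 //; lra.
have : c * (x / 2) ^+ j * (x - x / 2) <= f x - f (x / 2).
  apply: (@mvt_ge R f df) => [|y Xy|y /andP[Xy _]]; [lra|by case: (h y (le_trans _ Xy)) => [|[]//]; lra|].
  case: (h y) => [|[_ h3] y1]; first lra.
  apply: le_trans h3; rewrite ler_pM2l // lerXn2r ?nnegrE; lra.
have e : c / 4 ^+ j.+1 * x ^+ j.+1 = c * (x / 4) ^+ j * (x / 4).
  by rewrite -[RHS]mulrA -exprSr expr_div_n; ring.
rewrite e; have -> : x - x / 2 = x / 4 + x / 4 by field.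
rewrite mulrDr => h3.
have b1 : c * (x / 4) ^+ j * (x / 4) <= c * (x / 2) ^+ j * (x / 4).
  rewrite ler_pM2r; last lra.
  by rewrite ler_pM2l // lerXn2r ?nnegrE; lra.
have b2 : `|f X| <= c * (x / 2) ^+ j * (x / 4).
  have : 4 * `|f X| / c <= x by lra.
  rewrite ler_pdivrMr // => h4.
  have : 1 <= (x / 2) ^+ j by rewrite exprn_ege1 //; lra.
  move=> h5; have : c * (x / 4) <= c * (x / 4) * (x / 2) ^+ j by rewrite ler_peMr // mulr_ge0 //; lra.
  rewrite [c * (x / 4) * _]mulrAC; lra.
have := ler_norm (- f X); rewrite normrN; lra.
Qed.

Lemma growth_iter (R : realType) (n : nat) (a : nat -> R -> R) (c : R) : 0 < c ->
  (forall i, (i < n)%N -> evt (fun x => is_derive x 1 (a i) (a i.+1 x))) ->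
  evt (fun x => c <= a n x) -> exists2 c', 0 < c' & evt (fun x => c' * x ^+ n <= a 0%N x).
Proof.
move=> c0; elim: n a => [|n IH] a hd hn.
  by exists c => //; apply: evt_imp hn => x; rewrite expr0 mulr1.
have [|c' c'0 h] := IH (fun i => a i.+1) _ hn; first by move=> i ni; apply: hd.
exact: growth_up c'0 (hd 0%N _) h.
Qed.

(* Doubling and logarithmic-derivative bounds for positive functions
   [a 0, ..., a k], each the derivative of the previous one, with [a k.+1]
   tending to 0. *)
Definition tame (R : realType) (k : nat) (a : nat -> R -> R) (X C : R) : Prop :=
  [/\ 1 <= X, 0 < C,
   forall i x, (i <= k.+1)%N -> X <= x -> is_derive x 1 (a i) (a i.+1 x) &
   forall i x, (i <= k)%N -> X <= x -> 0 < a i x] /\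
  [/\ forall i x, (i <= k)%N -> X <= x -> x * `|a i.+1 x| <= C * a i x,
   forall i x, (i < k)%N -> X <= x -> a i x <= C * (x * a i.+1 x),
   forall i x u v, (i <= k)%N -> X <= x -> x <= u <= 2 * x -> x <= v <= 2 * x -> a i u <= C * a i v &
   forall u v, X <= u -> u <= v -> `|a k.+1 v| <= `|a k.+1 u|] /\
  [/\ forall e, 0 < e -> evt (fun x => `|a k.+1 x| <= e),
   (forall x, X <= x -> 0 <= a k.+1 x) \/ (forall x, X <= x -> a k.+1 x <= 0) &
   (forall x, X <= x -> 0 <= a k.+2 x) \/ (forall x, X <= x -> a k.+2 x <= 0)].

Definition ders (R : realType) (f : R -> R) (i : nat) : R -> R := iter i (@derive1 R R) f.

Lemma hardy_ders (R : realType) (H : set (R -> R)) (f : R -> R) (i : nat) :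
  hardy_field H -> H f -> H (ders f i).
Proof. by move=> hH Hf; elim: i => //= i; exact: hardy_derive. Qed.

Lemma hardy_is_derive (R : realType) (H : set (R -> R)) (f : R -> R) (i : nat) :
  hardy_field H -> H f -> evt (fun x => is_derive x 1 (ders f i) (ders f i.+1 x)).
Proof.
move=> hH Hf; have := hardy_derivable hH (hardy_ders i hH Hf).
move=> /evt_near; apply: evt_imp => x dx.
by rewrite /ders iterS derive1E; apply: DeriveDef.
Qed.

Lemma mono_nonneg (R : realType) (f df : R -> R) (X : R) :
  (forall x, X <= x -> is_derive x 1 f (df x)) -> (forall x, X <= x -> 0 <= df x) ->
  forall u v, X <= u -> u <= v -> f u <= f v.
Proof.
move=> hd h u v Xu uv; rewrite -subr_ge0; apply: le_trans (_ : 0 * (v - u) <= _).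
  by rewrite mul0r.
apply: (@mvt_ge R f df) => // x; first by move=> ux; apply: hd; apply: le_trans ux.
by move=> /andP[ux _]; apply: h; apply: le_trans ux.
Qed.

Lemma is_derive_opp_fun (R : realType) (f df : R -> R) (x : R) :
  is_derive x 1 f (df x) -> is_derive x 1 (fun y => - f y) (- df x).
Proof. by move=> h; exact: is_deriveN. Qed.

Lemma abs_noninc (R : realType) (f df : R -> R) :
  evt (fun x => is_derive x 1 f (df x)) -> (forall e, 0 < e -> evt (fun x => `|f x| <= e)) ->
  evt (fun x => 0 <= f x) \/ evt (fun x => f x <= 0) ->
  evt (fun x => 0 <= df x) \/ evt (fun x => df x <= 0) ->
  exists X, forall u v, X <= u -> u <= v -> `|f v| <= `|f u|.
Proof.
wlog : f df / evt (fun x => 0 <= f x).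
  move=> H hd h0 [h1 h2|h1 h2]; first by apply: (H f df) => //; left.
  have [|||||X hX] := H (fun x => - f x) (fun x => - df x).
  - by apply: evt_imp h1 => x; rewrite oppr_ge0.
  - by apply: evt_imp hd => x; exact: is_derive_opp_fun.
  - by move=> e /h0; apply: evt_imp => x; rewrite normrN.
  - by left; apply: evt_imp h1 => x; rewrite oppr_ge0.
  - by case: h2 => h2; [right|left]; apply: evt_imp h2 => x; rewrite ?oppr_ge0 ?oppr_le0.
  by exists X => u v Xu uv; have := hX u v Xu uv; rewrite !normrN.
move=> h1 hd h0 _ [] h2.
  have [X h] := evtI (evtI h1 hd) h2.
  have mono := @mono_nonneg R f df X (fun x Xx => proj2 (proj1 (h x Xx))) (fun x Xx => proj2 (h x Xx)).
  have pos x : X <= x -> 0 <= f x by move=> /h[[]].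
  (* A nonnegative nondecreasing function with limit 0 vanishes. *)
  have z x : X <= x -> f x = 0.
    move=> Xx; apply/eqP; rewrite eq_le pos // andbT leNgt; apply/negP => f0.
    have [|Y hY] := h0 (f x / 2); first by pos.
    have := hY (Num.max x Y); rewrite le_max lexx orbT => /(_ isT).
    have xm : x <= Num.max x Y by rewrite le_max lexx.
    rewrite ger0_norm ?pos ?(le_trans Xx) //; have := mono x _ Xx xm; lra.
  by exists X => u v Xu uv; rewrite !z // (le_trans Xu).
have [X h] := evtI (evtI h1 hd) h2.
exists X => u v Xu uv.
have Xv := le_trans Xu uv.
rewrite !ger0_norm; [|by case: (h u Xu) => -[]|by case: (h v Xv) => -[]].
rewrite -lerN2; apply: (@mono_nonneg R (fun x => - f x) (fun x => - df x) X) => // x Xx.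
  by apply: is_derive_opp_fun; case: (h x Xx) => -[].
by rewrite oppr_ge0; case: (h x Xx).
Qed.

Definition dbl (R : realType) (f : R -> R) (C x : R) : Prop :=
  forall u v, x <= u <= 2 * x -> x <= v <= 2 * x -> f u <= C * f v.

(** If [df >= 0], then [f] is eventually concave and positive, whence [x * df x <= 2 * f x]. If
    [df <= 0], then [f] stays between [v] and [f X], so all its values are comparable. *)
Lemma top_growth (R : realType) (f df : R -> R) (v : R) : 0 < v ->
  evt (fun x => is_derive x 1 f (df x)) -> evt (fun x => v <= f x) ->
  (exists X, forall u w, X <= u -> u <= w -> `|df w| <= `|df u|) ->
  evt (fun x => 0 <= df x) \/ evt (fun x => df x <= 0) ->
  exists2 C, 0 < C & evt (fun x => [/\ dbl f C x, x * `|df x| <= C * f x &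
    forall u, x <= u -> f x <= C * f u]).
Proof.
move=> v0 hd hv [X0 h0] [] hs.
  have [X h] := evtI (evtI (evtI hd hv) hs) (evt_ge (Num.max X0 1)).
  have X0X : X0 <= X /\ 1 <= X.
    by case: (h X (lexx X)) => _; rewrite ge_max => /andP[].
  have mono := @mono_nonneg R f df X (fun x Xx => proj1 (proj1 (proj1 (h x Xx)))) (fun x Xx => proj2 (proj1 (h x Xx))).
  have fv x : X <= x -> v <= f x by move=> /h[[[]]].
  have dp x : X <= x -> 0 <= df x by move=> /h[[_]].
  have dd x y : X <= x -> x <= y -> df y <= df x.
    move=> Xx xy; have := h0 x y (le_trans (proj1 X0X) Xx) xy.
    by rewrite !ger0_norm ?dp // (le_trans Xx).
  have key x : 2 * X <= x -> x * df x <= 2 * f x.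
    move=> x2; have Xx : X <= x by lra.
    have : df x * (x - X) <= f x - f X.
      apply: (@mvt_ge R f df) => // y; first by move=> Xy; case: (h y Xy) => -[[]].
      by move=> /andP[Xy yx]; apply: dd.
    have := fv X (lexx X); have := dp x Xx; nra.
  exists 3 => //; exists (2 * X) => x x2; have Xx : X <= x by lra.
  have x0 : 0 <= x by lra.
  split=> [u w /andP[xu ux] /andP[xw wx]||u xu].
  - apply: le_trans (_ : f (2 * x) <= _); first by apply: mono => //; lra.
    apply: le_trans (_ : 3 * f x <= _); last by rewrite ler_pM2l // mono.
    have [c /andP[c1 c2] e] := @mvt_closed R f df x (2 * x) (ltac:(lra)) (fun y hy => proj1 (proj1 (proj1 (h y (le_trans Xx (proj1 (andP hy))))))).
    have := key x x2; have := dd x c Xx c1; nra.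
  - rewrite ger0_norm ?dp //; have := key x x2; have := fv x Xx; lra.
  - have := mono x u Xx xu; have := fv x Xx; lra.
have [X h] := evtI (evtI (evtI hd hv) hs) (evt_ge (Num.max X0 1)).
have X0X : X0 <= X /\ 1 <= X.
  by case: (h X (lexx X)) => _; rewrite ge_max => /andP[].
pose F : R -> R := fun y => - f y.
have hN x : X <= x -> is_derive x 1 F (- df x).
  by move=> /h[[[+ _] _] _]; exact: is_derive_opp_fun.
have hN0 x : X <= x -> 0 <= - df x by move=> /h[[_ +] _]; rewrite oppr_ge0.
have mono u w : X <= u -> u <= w -> f w <= f u.
  by move=> Xu uw; rewrite -lerN2; apply: (@mono_nonneg R F (fun x => - df x) X).
have fv x : X <= x -> v <= f x by move=> /h[[[]]].
pose C := f X / v; have C1 : 1 <= C by rewrite ler_pdivlMr // mul1r fv.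
have big u w : X <= u -> X <= w -> f u <= C * f w.
  move=> Xu Xw; apply: le_trans (mono X u (lexx X) Xu) _.
  by rewrite /C mulrAC ler_pdivlMr // ler_pM2l ?fv //; apply: lt_le_trans (fv X (lexx X)).
exists (2 * C); first lra.
exists (2 * X) => x x2; have Xx : X <= x by lra.
have d2 u w : X <= u -> X <= w -> f u <= 2 * C * f w.
  move=> Xu Xw; have := big u w Xu Xw; have := fv w Xw; nra.
split=> [u w /andP[xu ux] /andP[xw wx]||u xu]; try by apply: d2; lra.
have : `|df x| * (x - x / 2) <= F x - F (x / 2).
  apply: (@mvt_ge R F (fun x => - df x)) => [|y hy|y /andP[y1 y2]]; [lra|by apply: hN; lra|].
  have Xy : X <= y by lra.
  rewrite -[- df y]ger0_norm ?hN0 // normrN; apply: h0 => //; lra.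
have := big (x / 2) x; have := fv x Xx; have := fv (x / 2).
have -> : X <= x / 2 by lra.
rewrite Xx /F => /(_ isT) h1 h2 /(_ isT isT) h3; lra.
Qed.

(** Passage from a derivative to its primitive: the mean value theorem on [[x / 2, x]] and on
    [[X, x]] compares [f x] with [x * g x] from both sides, and the doubling property of [f] follows
    from that of [g]. *)
Lemma step_growth (R : realType) (f g : R -> R) (C : R) : 0 < C ->
  evt (fun x => is_derive x 1 f (g x)) -> evt (fun x => 0 < f x) -> evt (fun x => 0 < g x) ->
  evt (fun x => dbl g C x /\ forall u, x <= u -> g x <= C * g u) ->
  exists2 D, 0 < D & evt (fun x => [/\ dbl f D x, x * `|g x| <= D * f x,
    f x <= D * (x * g x) & forall u, x <= u -> f x <= D * f u]).
Proof.
move=> C0 hd hf hg hq.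
have [X h] := evtI (evtI (evtI hd hf) (evtI hg hq)) (evt_ge 1).
have X1 : 1 <= X by case: (h X (lexx X)).
have fp x : X <= x -> 0 < f x by move=> /h[[[]]].
have gp x : X <= x -> 0 < g x by move=> /h[[_ []]].
have dd x : X <= x -> is_derive x 1 f (g x) by move=> /h[[[]]].
have qm u x : X <= u -> u <= x -> g u <= C * g x.
  by move=> Xu ux; have [[_ [_ [_ q]]] _] := h u Xu; exact: q.
have dg x : X <= x -> dbl g C x by move=> /h[[_ [_ []]]].
have mono := @mono_nonneg R f g X dd (fun x Xx => ltW (gp x Xx)).
pose B := f X * C / g X.
have B0 : 0 < B by rewrite divr_gt0 ?mulr_gt0 ?fp ?gp.
have low x : 2 * X <= x -> x * g x <= 2 * C * f x.
  move=> x2; have [y /andP[y1 y2] e] := @mvt_closed R f g (x / 2) x (ltac:(lra)) (fun y hy => dd y (ltac:(case/andP: hy; lra))).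
  have : g x <= C * g y by apply: (dg (x / 2)); [lra|lra|apply/andP; split; lra].
  have := fp (x / 2); have -> : X <= x / 2 by lra.
  move=> /(_ isT); nra.
have upb x : 2 * X <= x -> f x <= (B + C) * (x * g x).
  move=> x2; have Xx : X <= x by lra.
  have [y /andP[y1 y2] e] := @mvt_closed R f g X x Xx (fun y hy => dd y (proj1 (andP hy))).
  have h1 : g y <= C * g x by apply: qm.
  have h2 : f X <= B * g x.
    rewrite /B mulrAC ler_pdivlMr ?gp // -mulrA ler_pM2l ?fp //.
    by apply: qm.
  have h3 : B * g x <= B * (x * g x).
    by rewrite ler_pM2l // ler_peMl ?ltW ?gp //; lra.
  have h4 : g y * (x - X) <= C * g x * x.
    apply: ler_pM => //; [by rewrite ltW // gp|lra|lra].
  rewrite mulrDl; have -> : C * (x * g x) = C * g x * x by ring.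
  lra.
pose D := 1 + 2 * C + (B + C) + (B + C) * 2 * C * (2 * C).
have BC : 0 < (B + C) * 2 * C * (2 * C) by pos.
have D0 : 0 < D by rewrite /D; lra.
exists D => //; exists (2 * X) => x x2; have Xx : X <= x by lra.
have fx := fp x Xx; have gx := gp x Xx; have xg : 0 < x * g x by rewrite mulr_gt0 //; lra.
split.
- move=> u w /andP[xu ux] /andP[xw wx].
  apply: le_trans (_ : f (2 * x) <= _); first by apply: mono => //; lra.
  apply: le_trans (_ : D * f x <= _); last by rewrite ler_pM2l // mono.
  apply: le_trans (upb (2 * x) _) _; first lra.
  have h1 : g (2 * x) <= C * g x by apply: (dg x) => //; apply/andP; split; lra.
  have h2 := low x x2.
  have h3 : (B + C) * (2 * x * g (2 * x)) <= (B + C) * (2 * x * (C * g x)).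
    by rewrite !ler_pM2l //; lra.
  have h4 : (B + C) * (2 * x * (C * g x)) <= (B + C) * 2 * C * (2 * C) * f x.
    have -> : (B + C) * (2 * x * (C * g x)) = (B + C) * 2 * C * (x * g x) by ring.
    by rewrite -[leRHS]mulrA ler_pM2l //; pos.
  apply: le_trans h3 (le_trans h4 _); rewrite ler_pM2r // /D; lra.
- rewrite (gtr0_norm gx); apply: le_trans (low x x2) _; rewrite ler_pM2r // /D; lra.
- apply: le_trans (upb x x2) _; rewrite ler_pM2r // /D; lra.
- move=> u xu; apply: le_trans (mono x u Xx xu) _; rewrite ler_peMl //; last by rewrite /D; lra.
  by rewrite ltW // fp // (le_trans Xx).
Qed.

(** Downward induction: [top_growth] treats [a k], and [step_growth] descends to [a 0]. *)
Lemma tame_intro (R : realType) (k : nat) (a : nat -> R -> R) (v : R) : 0 < v ->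
  (forall i, (i <= k.+1)%N -> evt (fun x => is_derive x 1 (a i) (a i.+1 x))) ->
  (forall i, (i <= k)%N -> evt (fun x => 0 < a i x)) ->
  evt (fun x => v <= a k x) -> (forall e, 0 < e -> evt (fun x => `|a k.+1 x| <= e)) ->
  evt (fun x => 0 <= a k.+1 x) \/ evt (fun x => a k.+1 x <= 0) ->
  evt (fun x => 0 <= a k.+2 x) \/ evt (fun x => a k.+2 x <= 0) ->
  exists X C, tame k a X C.
Proof.
move=> v0 hd hp hv h0 s1 s2.
have [X1 hX1] := abs_noninc (hd k.+1 (leqnn _)) h0 s1 s2.
have [Ck Ck0 hk] := top_growth v0 (hd k (leqnSn k)) hv (ex_intro _ X1 hX1) s1.
have all i : (i <= k)%N -> exists2 C, 0 < C & evt (fun x => [/\ dbl (a i) C x,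
    x * `|a i.+1 x| <= C * a i x, (i < k)%N -> a i x <= C * (x * a i.+1 x) &
    forall u, x <= u -> a i x <= C * a i u]).
  move=> ik; rewrite -(subKn ik); have : (k - i <= k)%N by rewrite leq_subr.
  elim: (k - i)%N => [|j IH] jk.
    exists Ck => //; rewrite subn0; apply: evt_imp hk => x [h1 h2 h3]; split=> //.
    by rewrite ltnn.
  have [C C0 h] := IH (ltnW jk).
  have e : (k - j = (k - j.+1).+1)%N by rewrite subnSK.
  rewrite e in h.
  have [||||D D0 hD] := @step_growth R (a (k - j.+1)%N) (a (k - j.+1).+1) C C0.
  - by apply: hd; apply: leq_trans (leq_subr _ _) _.
  - by apply: hp; rewrite leq_subr.
  - by apply: hp; rewrite -e leq_subr.
  - by apply: evt_imp h => x [].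
  by exists D => //; apply: evt_imp hD => x [].
(* The positivity premises make the property monotone in [C], as [evt_unif] requires. *)
have [||C C0 hC] := @evt_unif R k.+1 (fun i C x => 0 < a i x -> 0 < a i.+1 x \/ (k <= i)%N -> 0 < x ->
    (forall u, x <= u -> 0 < a i u) ->
    [/\ dbl (a i) C x,
    x * `|a i.+1 x| <= C * a i x & (i < k)%N -> a i x <= C * (x * a i.+1 x)]).
- move=> i C D x CD H h1 h2 x0 ap; case: (H h1 h2 x0 ap) => g1 g2 g3; split.
  + move=> u w hu hw; apply: le_trans (g1 u w hu hw) _; rewrite ler_wpM2r // ltW // ap //.
    by case/andP: hw.
  + by apply: le_trans g2 _; rewrite ler_wpM2r // ltW.
  + move=> ik; apply: le_trans (g3 ik) _; rewrite ler_wpM2r // mulr_ge0 ?ltW //.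
    by case: h2 => //; rewrite leqNgt ik.
- move=> i ik; have [C C0 h] := all i ik; exists C; apply: evt_imp h => x [h1 h2 h3 _] _ _ _ _.
  by split.
have hp' : evt (fun x => forall i, (i < k.+1)%N -> 0 < a i x) by apply: evt_all.
have hd' : evt (fun x => forall i, (i < k.+2)%N -> is_derive x 1 (a i) (a i.+1 x)) by apply: evt_all.
have [Y hY] := evtI (evtI (evtI hC hp') hd') (evt_ge (Num.max X1 1)).
have [Z1 hZ1] : exists Z, (forall x, Z <= x -> 0 <= a k.+1 x) \/ (forall x, Z <= x -> a k.+1 x <= 0).
  by case: s1 => -[Z h]; exists Z; [left|right].
have [Z2 hZ2] : exists Z, (forall x, Z <= x -> 0 <= a k.+2 x) \/ (forall x, Z <= x -> a k.+2 x <= 0).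
  by case: s2 => -[Z h]; exists Z; [left|right].
pose X := Num.max Y (Num.max Z1 Z2).
have XY x : X <= x -> Y <= x by rewrite /X ge_max => /andP[].
have XZ1 x : X <= x -> Z1 <= x by rewrite /X !ge_max => /and3P[].
have XZ2 x : X <= x -> Z2 <= x by rewrite /X !ge_max => /and3P[].
have Y1 : X1 <= Y /\ 1 <= Y by case: (hY Y (lexx Y)) => _; rewrite ge_max => /andP[].
have pos i x : (i <= k)%N -> X <= x -> 0 < a i x.
  by move=> ik /XY/hY[[[_ h] _] _]; apply: h.
have big i x : (i <= k)%N -> X <= x -> [/\ dbl (a i) C x,
    x * `|a i.+1 x| <= C * a i x & (i < k)%N -> a i x <= C * (x * a i.+1 x)].
  move=> ik Xx; have [[[h _] _] _] := hY x (XY x Xx); apply: h => //.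
  - exact: pos.
  - by move: ik; rewrite leq_eqVlt => /orP[/eqP ->|ik]; [right|left; exact: pos].
  - have := XY x Xx; lra.
  - by move=> u xu; apply: pos => //; apply: le_trans xu.
exists X, C; split; last split.
- split=> //; first by apply: le_trans (proj2 Y1) _; exact: XY.
  by move=> i x ik /XY/hY[[_ h] _]; apply: h.
- split.
  + by move=> i x ik Xx; case: (big i x ik Xx).
  + by move=> i x ik Xx; case: (big i x (ltnW ik) Xx) => _ _; apply.
  + by move=> i x u w ik Xx; case: (big i x ik Xx) => h _ _; apply: h.
  + move=> u w Xu uw; apply: hX1 => //; have := XY u Xu; lra.
- split=> //.
  + by case: hZ1 => h; [left|right] => x /XZ1; apply: h.
  + by case: hZ2 => h; [left|right] => x /XZ2; apply: h.
Qed.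

(** Here [k.+1] is the least positive order whose derivative tends to 0; it exists because a
    derivative bounded below forces power growth. A derivative that does not tend to 0 is eventually
    at least a positive constant, since an eventual negative upper bound is incompatible with the
    limit of [alpha]. *)
Lemma hardy_tame (R : realType) (alpha : R -> R) :
  sub_polynomial alpha -> alpha x @[x --> +oo] --> +oo ->
  exists k X C, tame k (ders alpha) X C.
Proof.
move=> [[H hH Ha] [l l0 hl]] hoo.
have aoo (c : R) : evt (fun x => c <= alpha x) by apply: evt_near; move/cvgryPge: hoo; apply.
have HD i := hardy_ders i hH Ha.
have hd i := hardy_is_derive i hH Ha.
pose to0 (f : R -> R) := forall e, 0 < e -> evt (fun x => `|f x| <= e).
have neg n c : 0 < c -> evt (fun x => ders alpha n x <= - c) -> False.
  move=> c0 hn; pose b i x := - ders alpha i x.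
  have [||c' c'0 h] := @growth_iter R n b c c0.
  - by move=> i _; apply: evt_imp (hd i) => x; exact: is_derive_opp_fun.
  - by apply: evt_imp hn => x; rewrite /b lerNr.
  have [X hX] := evtI (evtI h (aoo 1)) (evt_ge 0).
  have [[h1 h2] x0] := hX X (lexx X).
  have : 0 <= c' * X ^+ n by rewrite mulr_ge0 ?exprn_ge0 // ltW.
  move: h1; rewrite /b /ders /=; lra.
have pos n : ~ to0 (ders alpha n) -> exists2 c, 0 < c & evt (fun x => c <= ders alpha n x).
  move=> nt; have [e e0 ne] : exists2 e, 0 < e & ~ evt (fun x => `|ders alpha n x| <= e).
    apply: contrapT => no; apply: nt => e e0; apply: contrapT => ne; apply: no.
    by exists e.
  have [m hm] := inv_nat_small e0.
  have v0 : 0 < m.+1%:R^-1 :> R by rewrite invr_gt0 ltr0n.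
  case: (hardy_size m hH (HD n)) => h.
  - by exfalso; apply: ne; apply: evt_imp h => x hx; apply: le_trans hm.
  - by exists m.+1%:R^-1.
  - by exfalso; apply: (neg n _ v0).
have ex : exists n, (0 < n)%N /\ to0 (ders alpha n).
  have [n n0 nl] := natr_above l.
  exists n; split=> //; apply: contrapT => /pos[c c0 hc].
  have [|c' c'0 h] := @growth_iter R n (ders alpha) c c0 _ hc; first by move=> i _; exact: hd.
  have c'20 : 0 < c' / 2 by pos.
  have hl' : evt (fun x => `|alpha x / x `^ l| <= c' / 2).
    by apply: evt_near; move/cvgr0Pnorm_le: hl; apply.
  have [X hX] := evtI (evtI h hl') (evt_ge 1).
  have [[h1 h2] x1] := hX X (lexx X).
  have x0 : 0 < X `^ l by rewrite powR_gt0 //; lra.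
  have p : X `^ l <= X ^+ n by rewrite -powR_mulrn; [rewrite ler_powR|lra].
  have : c' * X `^ l <= alpha X by apply: le_trans h1; rewrite ler_pM2l.
  rewrite -ler_pdivlMr // => h3; have := ler_norm (alpha X / X `^ l); lra.
have [n [n0 hn] least] := least_nat ex.
case: n n0 hn least => // k _ hk least.
have [v v0 hv] : exists2 c, 0 < c & evt (fun x => c <= ders alpha k x).
  case: k least {hk} => [|k] least; first by exists 1 => //; exact: aoo.
  by apply: pos => h; apply: (least k.+1).
have sg i : evt (fun x => 0 <= ders alpha i x) \/ evt (fun x => ders alpha i x <= 0).
  by case: (hardy_sign hH (HD i)) => h; [left|left|right]; apply: evt_imp h => x; rewrite ?le_eqVlt => -> //; rewrite ?eqxx ?orbT.
exists k; apply: (tame_intro v0) => //.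
move=> i ik; have [||c' c'0 h] := @growth_iter R (k - i) (fun j => ders alpha (i + j)) v v0.
- by move=> j _; apply: evt_imp (hd (i + j)%N) => x; rewrite addnS.
- by rewrite subnKC.
apply: evt_imp (evtI h (evt_ge 1)) => x [h1 h2]; rewrite addn0 in h1.
apply: lt_le_trans h1; rewrite mulr_gt0 // exprn_gt0 //; lra.
Qed.

(** * Windows with a large exponential sum *)

Lemma is_derive_translate (R : realType) (f : R -> R) (df y x : R) :
  is_derive (x + y) 1 f df -> is_derive x 1 (fun z => f (z + y)) df.
Proof.
move=> h; rewrite -[df]mulr1.
apply: (@is_derive1_comp R f (fun z => z + y) x df 1) => //.
rewrite -[X in is_derive _ _ _ X]addr0; apply: is_deriveD.
Qed.

(** The mean value theorem for iterated differences. The induction replaces the family [a] by its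
    differences of step [y], which is again a family of successive derivatives. *)
Lemma mvt_iter (R : realType) (j : nat) (a : nat -> R -> R) (X y : R) : 0 <= y ->
  (forall i x, (i < j)%N -> X <= x -> is_derive x 1 (a i) (a i.+1 x)) ->
  forall x (m : nat), X <= x -> exists2 xi, x + y * m%:R <= xi <= x + y * (m + j)%N%:R &
    dlk j (fun m => a 0%N (x + y * m%:R)) m = y ^+ j * a j xi.
Proof.
move=> y0; elim: j a => [|j IH] a hd x m Xx.
  by exists (x + y * m%:R); rewrite ?addn0 ?lexx // expr0 mul1r.
pose b i z := a i (z + y) - a i z.
have hb i z : (i < j)%N -> X <= z -> is_derive z 1 (b i) (b i.+1 z).
  move=> ij Xz; apply: is_deriveB; last by apply: hd => //; apply: ltnW.
  apply: is_derive_translate; apply: hd; [exact: ltnW|lra].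
have [xi /andP[h1 h2] e] := IH b hb x m Xx.
have ym : 0 <= y * m%:R by rewrite mulr_ge0.
have Xxi : X <= xi by lra.
have [z /andP[z1 z2] ez] := @mvt_closed R (a j) (a j.+1) xi (xi + y) (ltac:(lra)) (fun w hw => hd j w (ltnSn j) (le_trans Xxi (proj1 (andP hw)))).
exists z.
  rewrite (le_trans h1 z1) /=; apply: le_trans z2 _; rewrite addnS -natr1 mulrDr mulr1; lra.
rewrite dlkSr (_ : dl _ = fun m => b 0%N (x + y * m%:R)).
  by rewrite e /b ez addrAC subrr add0r exprSr -mulrA [y * _]mulrC.
by apply/funext => i; rewrite /dl /b -natr1 mulrDr mulr1 addrA.
Qed.

Lemma dlk_bound (R : realType) (g : nat -> R) (i : nat) (B : R) (n : nat) :
  (forall s, (s < n)%N -> `|dl g s| <= B) ->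
  forall m, (m + i.+1 <= n)%N -> `|dlk i.+1 g m| <= 2 ^+ i * B.
Proof.
move=> h; elim: i => [|i IH] m mn.
  by rewrite expr0 mul1r; apply: h; rewrite -addn1.
rewrite dlkS /dl; apply: le_trans (ler_normB _ _) _.
have -> : 2 ^+ i.+1 * B = 2 ^+ i * B + 2 ^+ i * B by rewrite exprS; ring.
apply: lerD; apply: IH; move: mn; rewrite !addnS ?addSn // => /ltnW //.
Qed.

Lemma dl0_const (V : zmodType) (g : nat -> V) : (forall n, dl g n = 0) -> forall n, g n = g 0%N.
Proof.
move=> h; elim=> // n <-; apply/eqP; rewrite -subr_eq0; exact/eqP/h.
Qed.

Lemma dlk_stride (R : numDomainType) (P : nat -> R) (d y : nat) (c : R) :
  (forall n, dlk d P n = c) -> dlk d (fun s => P (y * s)%N) 0%N = (y ^ d)%N%:R * c.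
Proof.
move=> h; rewrite -[fun s => _](funext (fun s => erefl (P (0 + y * s)%N))) dlk_step.
have := @dhs_bounds R (nseq d y) P (0 + y * 0).+1 c c _ _ (ltnSn _).
rewrite size_prod_nseq => H; apply/eqP; rewrite eq_le andbC; apply: H => n _.
by rewrite size_nseq h lexx.
Qed.

Lemma degree_of (P : nat -> int) (k : nat) : (forall n, dlk k.+1 P n = 0) ->
  exists d c, [/\ (d <= k)%N, forall n, dlk d P n = c & (0 < d)%N -> c != 0].
Proof.
move=> h; have [d hd least] := @least_nat (fun d => forall n, dlk d.+1 P n = 0) (ex_intro _ k h).
exists d, (dlk d P 0%N); split=> [|n|d0].
- by rewrite leqNgt; apply/negP => kd; exact: (least k kd).
- exact: dl0_const.
case: d hd least d0 => // d hd least _; apply/eqP => c0; apply: (least d (ltnSn d)) => n.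
exact: etrans (@dl0_const _ (dlk d.+1 P) hd n) c0.
Qed.

(** Sampling at the coarse step [y], later comparable to the window, turns the errors of single
    steps into [y * B], whereas the differences of [P] of orders d and d + 1 become [y ^ d * c] and
    0. This reads off the sizes of [a d] and [a d.+1] on the window. *)
Lemma window_degree (R : realType) (a : nat -> R -> R) (X : R) (d : nat) (P : nat -> int) (c : int)
  (th B N : R) (M p y n : nat) :
  (forall i x, (i <= d)%N -> X <= x -> is_derive x 1 (a i) (a i.+1 x)) -> X <= N ->
  (forall n, dlk d P n = c) -> (y * d.+1 <= n)%N ->
  (forall m, (m < n)%N -> `|M%:R * th * (a 0%N (N + (p * m.+1)%N%:R) - a 0%N (N + (p * m)%N%:R)) - (dl P m)%:~R| <= B) ->
  (exists2 xi, N <= xi <= N + (p * y * d.+1)%N%:R &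
     `|M%:R * th * ((p * y)%N%:R ^+ d.+1 * a d.+1 xi)| <= 2 ^+ d * (y%:R * B)) /\
  ((0 < d)%N -> exists2 xi, N <= xi <= N + (p * y * d)%N%:R &
     `|M%:R * th * ((p * y)%N%:R ^+ d * a d xi) - (y ^ d)%N%:R * c%:~R| <= 2 ^+ d.-1 * (y%:R * B)).
Proof.
move=> hd XN hP yn close.
pose g s := M%:R * th * a 0%N (N + (p * y)%N%:R * s%:R) - (P (y * s)%N)%:~R.
have gd s : (s < d.+1)%N -> `|dl g s| <= y%:R * B.
  move=> sd; have -> : dl g s = \sum_(i < y) (M%:R * th *
     (a 0%N (N + (p * (y * s + i).+1)%N%:R) - a 0%N (N + (p * (y * s + i))%N%:R)) - (dl P (y * s + i)%N)%:~R).
    pose G m := M%:R * th * a 0%N (N + (p * m)%N%:R) - (P m)%:~R.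
    have GE m : g m = G (y * m)%N by rewrite /g /G -natrM mulnA.
    rewrite /dl !GE (_ : (y * s.+1 = y * s + y)%N); last by rewrite mulnS addnC.
    rewrite telescope_dl; apply: eq_bigr => i _.
    by rewrite /dl /G intrB; ring.
  apply: le_trans (ler_norm_sum _ _ _) _.
  have -> : y%:R * B = \sum_(i < y) B by rewrite sumr_const card_ord mulr_natl.
  apply: ler_sum => i _; apply: close; apply: leq_trans yn; apply: leq_trans (_ : (y * s.+1 <= _)%N); last by rewrite leq_mul2l sd orbT.
  by rewrite mulnS addnC ltn_add2r.
have gk i : (i <= d.+1)%N -> dlk i g 0%N = M%:R * th * dlk i (fun s => a 0%N (N + (p * y)%N%:R * s%:R)) 0%N - (dlk i (fun s => P (y * s)%N) 0%N)%:~R.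
  by move=> _; rewrite (dlk_sub _ (fun s => M%:R * th * a 0%N (N + (p * y)%N%:R * s%:R))) dlkM (@dlk_intr R i (fun s => P (y * s)%N)).
have pos : 0 <= (p * y)%N%:R :> R by rewrite ler0n.
split.
  have [xi h e] := @mvt_iter R d.+1 a X _ pos (fun i x h => hd i x h) N 0%N XN.
  rewrite mulr0 addr0 add0n -natrM in h; exists xi => //.
  have := @dlk_bound R g d _ d.+1 gd 0%N (leqnn _); rewrite gk // e.
  by rewrite (@dlk_stride _ P d.+1 y 0) ?mulr0 ?subr0 // => m; rewrite dlkS /dl !hP subrr.
case: d hd hP yn gd gk => // d hd hP yn gd gk _ /=.
have [xi h e] := @mvt_iter R d.+1 a X _ pos (fun i x h => hd i x (ltnW h)) N 0%N XN.
rewrite mulr0 addr0 add0n -natrM in h; exists xi => //.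
have := @dlk_bound R g d _ d.+2 gd 0%N (leqnSn _); rewrite gk // e (dlk_stride y hP).
by rewrite natz intrM -pmulrn.
Qed.

Definition incr (R : realType) (f : R -> R) (N m : nat) : R := f (N%:R + m%:R) - f N%:R.

Lemma tame_C1 (R : realType) (k : nat) (a : nat -> R -> R) (X C : R) : tame k a X C -> 1 <= C.
Proof.
move=> [[X1 C0 _ pos] [[_ _ db _] _]].
have a0 := pos 0%N X (leq0n k) (lexx X).
have := db 0%N X X X (leq0n k) (lexx X).
have -> : X <= X <= 2 * X by apply/andP; split; lra.
by move=> /(_ isT isT); rewrite ler_pMl.
Qed.

Lemma tame_mono (R : realType) (k : nat) (a : nat -> R -> R) (X C : R) (i : nat) :
  tame k a X C -> (i < k)%N -> forall u v, X <= u -> u <= v -> a i u <= a i v.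
Proof.
move=> [[X1 C0 hd pos] _] ik; apply: (@mono_nonneg R (a i) (a i.+1)) => x Xx.
  by apply: hd => //; apply: leq_trans (ltnW ik) _.
by rewrite ltW // pos.
Qed.

Lemma incr_linear (R : realType) (k : nat) (a : nat -> R -> R) (X C eta : R) (N K m : nat) :
  tame k a X C -> (0 < k)%N -> X <= N%:R -> 0 <= eta <= 1 -> (0 < K)%N -> K%:R <= eta * N%:R ->
  (m <= K)%N ->
  `|incr (a 0%N) N m - m%:R / K%:R * incr (a 0%N) N K| <= eta * C ^+ 2 * incr (a 0%N) N K.
Proof.
move=> tm k0 XN /andP[eta0 eta1] K0 Ke mK.
have C1 := tame_C1 tm; have [[X1 C0 hd pos] [[grow _ db _] _]] := tm.
have N0 : 0 < N%:R :> R by lra.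
have KR : 0 < K%:R :> R by rewrite ltr0n.
have KN : K%:R <= N%:R :> R by apply: le_trans Ke _; rewrite ger_pMl.
have mKR : m%:R <= K%:R :> R by rewrite ler_nat.
have mR : 0 <= m%:R :> R by rewrite ler0n.
have [x /andP[x1 x2] ex] := @mvt_closed R (a 0%N) (a 1%N) N%:R (N%:R + m%:R) (ltac:(lra)) (fun z hz => hd 0%N z isT (le_trans XN (proj1 (andP hz)))).
have [y /andP[y1 y2] ey] := @mvt_closed R (a 0%N) (a 1%N) N%:R (N%:R + K%:R) (ltac:(lra)) (fun z hz => hd 0%N z isT (le_trans XN (proj1 (andP hz)))).
rewrite /incr ex ey; set A := a 1%N x; set B := a 1%N y.
have B0 : 0 < B by apply: pos => //; lra.
have -> : A * (N%:R + m%:R - N%:R) - m%:R / K%:R * (B * (N%:R + K%:R - N%:R)) = m%:R * (A - B).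
  by field; rewrite gt_eqF.
have -> : eta * C ^+ 2 * (B * (N%:R + K%:R - N%:R)) = K%:R * (eta * C ^+ 2 * B) by ring.
rewrite normrM (ger0_norm mR); apply: ler_pM => //.
have lip u v : N%:R <= u -> u <= v -> v <= N%:R + K%:R -> `|a 1%N v - a 1%N u| <= eta * C ^+ 2 * B.
  move=> Nu uv vK.
  have [z /andP[z1 z2] ->] := @mvt_closed R (a 1%N) (a 2%N) u v uv (fun z hz => hd 1%N z isT (le_trans XN (le_trans Nu (proj1 (andP hz))))).
  rewrite normrM (ger0_norm (_ : 0 <= v - u)); last lra.
  have h1 : z * `|a 2%N z| <= C * a 1%N z by apply: grow => //; lra.
  have h2 : a 1%N z <= C * B by apply: (db 1%N N%:R) => //; apply/andP; split; lra.
  have h3 : `|a 2%N z| * N%:R <= C * (C * B).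
    apply: le_trans (_ : C * a 1%N z <= _); last by rewrite ler_pM2l.
    by apply: le_trans h1; rewrite mulrC ler_wpM2r //; lra.
  have h4 : `|a 2%N z| * (v - u) <= `|a 2%N z| * (eta * N%:R) by rewrite ler_wpM2l //; lra.
  apply: le_trans h4 _; have -> : `|a 2%N z| * (eta * N%:R) = eta * (`|a 2%N z| * N%:R) by ring.
  have -> : eta * C ^+ 2 * B = eta * (C * (C * B)) by ring.
  by rewrite ler_wpM2l.
have [xy|yx] := lerP x y; first by rewrite distrC; apply: lip; lra.
by apply: lip; lra.
Qed.

(** The exactly linear phase [j m / K] with 0 < j < K has sum 0. *)
Lemma expsum_linear_multiple (R : realType) (u : nat -> R) (T K j : nat) (e : R) :
  (0 < K)%N -> (0 < j < K)%N ->
  (forall m, (m < K)%N -> `|u m / T%:R - m%:R / K%:R| <= e) ->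
  nc (expsum (fun m => j%:R * (u m / T%:R)) K) <= 8 * (j%:R * e) * K%:R.
Proof.
move=> K0 /andP[j0 jK] h; have KR : 0 < K%:R :> R by rewrite ltr0n.
have z : expsum (fun m => m%:R * (j%:R / K%:R) : R) K = 0.
  have ne : ee (j%:R / K%:R : R) - 1 != 0.
    rewrite subr_eq0; apply: ee_neq1; rewrite ger0_norm ?divr_ge0 ?ler0n //.
    by rewrite divr_gt0 ?ltr0n //= ltr_pdivrMr // mul1r ltr_nat.
  have := geom_sum (j%:R / K%:R : R) K; rewrite [K%:R * _]mulrC divfK ?gt_eqF // ee_nat subrr.
  by move=> /eqP; rewrite mulf_eq0 (negbTE ne) => /eqP.
rewrite -[X in nc X]subr0 -z; apply: expsum_close => m mK.
have -> : j%:R * (u m / T%:R) - m%:R * (j%:R / K%:R) = j%:R * (u m / T%:R - m%:R / K%:R) by ring.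
by rewrite normrM (ger0_norm (ler0n _ _)) ler_wpM2l ?ler0n // h.
Qed.

Lemma tame_dlk (R : realType) (k : nat) (a : nat -> R -> R) (X C th : R) (N i m : nat) :
  tame k a X C -> (i <= k.+2)%N -> X <= N%:R ->
  exists2 xi, N%:R + m%:R <= xi & dlk i (fun m => th * a 0%N (N%:R + m%:R)) m = th * a i xi.
Proof.
move=> [[X1 C0 hd pos] _] ik XN.
have [xi /andP[h1 h2] e] := @mvt_iter R i a X 1 ler01 (fun j x h => hd j x (leq_trans h ik)) N%:R m XN.
exists xi; first by rewrite mul1r in h1.
rewrite dlkM; congr (_ * _); move: e; rewrite expr1n mul1r => <-.
by apply: eq_dlk => s; rewrite mul1r.
Qed.

(** The polynomial supplied by the inverse theorem must have degree exactly [k]. Degree 0 would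
    bound [j] and make the phase almost linear, with a small sum; a degree strictly between 0 and
    [k] would make a derivative flatter than its power-like growth allows. *)
Lemma window_inverse (R : realType) (k : nat) (a : nat -> R -> R) (X C : R) (J : nat) (eps eta1 : R)
  (p M L0 : nat) (C1 c d : R) : inverse_at k eps p M L0 C1 c d ->
  tame k a X C -> (0 < k)%N -> (forall c, evt (fun x => c <= a 0%N x)) -> (0 < J)%N -> 0 < eps ->
  0 < eta1 <= 1 ->
  exists (eta D c1 : R) (N0 : nat), [/\ 0 < eta <= eta1, 0 < D & 0 < c1] /\
  forall N : nat, (N0 <= N)%N ->
  let K := Num.truncn (eta * N%:R) in let T := (Num.truncn (incr (a 0%N) N K)).+1 in
  forall j, (0 < j < J * T)%N ->
  eps * K%:R < nc (expsum (fun m => j%:R * (incr (a 0%N) N m / T%:R)) K) ->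
  let th := j%:R / T%:R : R in
  exists (r l : nat) (P : nat -> int) (c : int),
    [/\ 0 < th <= J%:R, c1 * N%:R <= l%:R, (r + p * l <= N)%N, (forall n, dlk k P n = c) & c != 0] /\
    (forall m, (m < l)%N -> `|M%:R * th * (a 0%N ((N + r + p * m.+1)%N%:R) - a 0%N ((N + r + p * m)%N%:R))
       - (dl P m)%:~R| <= D / N%:R) /\
    exists xi, [/\ N%:R <= xi <= 2 * N%:R, N%:R ^+ k.+1 * `|a k.+1 xi| <= D * a k xi &
      `|c|%:~R <= D * (1 + a k xi)].
Proof.
move=> [[p0 M0 C10 c0 d0] IT] tm k0 hoo J0 eps0 /andP[eta10 eta11].
have Cge1 := tame_C1 tm; have [[X1 C0 hd pos] [[grow grow2 db _] [small s1 s2]]] := tm.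
have pR : 1 <= p%:R :> R by rewrite ler1n.
have MR : 1 <= M%:R :> R by rewrite ler1n.
pose kk : R := (k.+1)%:R; have kk0 : 0 < kk by rewrite ltr0n.
pose c4 := c / (2 * kk); have c40 : 0 < c4 by rewrite /c4; pos.
pose C3 := 2 * C1 * C / c4; have C30 : 0 < C3 by rewrite /C3; pos.
(* So small that for every [j <= C3] the almost linear phase has a sum below [eps * K]. *)
pose eta := Num.min eta1 (eps / (32 * C3 * C ^+ 2)).
have etab : 0 < eps / (32 * C3 * C ^+ 2) by pos.
have eta0 : 0 < eta by rewrite lt_min eta10.
have etal : eta <= eta1 by rewrite ge_min lexx.
have eta1e : eta <= 1 by apply: le_trans etal eta11.
have etae : eta * (32 * C3 * C ^+ 2) <= eps.
  by rewrite -ler_pdivlMr; [rewrite ge_min lexx orbT|pos].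
pose c5 := c4 * (eta / 2); have c50 : 0 < c5 by rewrite /c5; pos.
pose W := 2 ^+ k.+1 * C1 * C; have W0 : 0 < W by rewrite /W; pos.
pose D := C1 * (2 / eta) + W / c5 ^+ k.+1 + 2 * (M%:R * J%:R * p%:R ^+ k * C) + 2.
have [D1 D2 D3] : [/\ C1 * (2 / eta) <= D, W / c5 ^+ k.+1 <= D & 2 * (M%:R * J%:R * p%:R ^+ k * C) + 2 <= D].
  have q1 : 0 < C1 * (2 / eta) by pos.
  have q2 : 0 < W / c5 ^+ k.+1 by pos.
  have q3 : 0 <= 2 * (M%:R * J%:R * p%:R ^+ k * C) by pos.
  by rewrite /D; split; lra.
have D0 : 0 < D by have : 0 < C1 * (2 / eta) by [pos]; lra.
have [Z hZ] : exists Z : R, [/\ X <= Z, 1 <= Z, (L0%:R + C3 + 2 + 2 / c4 + 2 ^+ k.+1 * C1 / c4) / (eta / 2) <= Z,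
   (W * (2 * C)) / c5 ^+ 2 < Z & forall x, Z <= x -> `|a k.+1 x| <= d / J%:R /\
   (1 + 16 * C3 / eps) * (4 * C / eta) <= a 0%N x].
  have dJ : 0 < d / J%:R by rewrite divr_gt0 // ltr0n.
  have [Z1 h1] := evtI (small _ dJ) (hoo ((1 + 16 * C3 / eps) * (4 * C / eta))).
  exists (Num.max Z1 (Num.max X (Num.max 1 (Num.max ((L0%:R + C3 + 2 + 2 / c4 + 2 ^+ k.+1 * C1 / c4) / (eta / 2)) ((W * (2 * C)) / c5 ^+ 2 + 1))))).
  split; rewrite ?le_max ?lt_max ?lexx ?orbT //.
    by rewrite (_ : W * (2 * C) / c5 ^+ 2 < W * (2 * C) / c5 ^+ 2 + 1) ?orbT // ltrDl ltr01.
  by move=> x; rewrite ge_max => /andP[/h1].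
case: hZ => XZ Z1 Z2 Z3 Z4.
have [N0 _ N0b] := natr_above Z.
exists eta, D, (c * (eta / 2)), N0; split.
  by split=> //; [rewrite eta0|pos].
move=> N NN K T j /andP[j0 jJ] big th.
have ZN : Z <= N%:R by apply: le_trans N0b _; rewrite ler_nat.
have XN : X <= N%:R := le_trans XZ ZN.
have N1 : 1 <= N%:R :> R := le_trans Z1 ZN.
have etaN : 0 <= eta * N%:R by rewrite mulr_ge0 // ltW.
have [K1 K2] : K%:R <= eta * N%:R /\ eta * N%:R < K%:R + 1.
  by have /andP[h1 h2] := truncn_itv etaN; split=> //; rewrite natr1.
have Kbig : L0%:R + C3 + 2 + 2 / c4 + 2 ^+ k.+1 * C1 / c4 <= eta / 2 * N%:R.
  by rewrite [leRHS]mulrC -ler_pdivrMr; [apply: le_trans ZN|pos].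
have q1 : 0 <= L0%:R :> R by rewrite ler0n.
have q2 : 0 < 2 / c4 by pos.
have q3 : 0 < 2 ^+ k.+1 * C1 / c4 by pos.
have q4 : C3 + 2 <= eta / 2 * N%:R by lraw Kbig q1 q2 q3.
have L0b : L0%:R <= eta / 2 * N%:R by lraw Kbig q2 q3 C30.
have c4b : 2 / c4 <= eta / 2 * N%:R by lraw Kbig q1 q3 C30.
have w4b : 2 ^+ k.+1 * C1 / c4 <= eta / 2 * N%:R by lraw Kbig q1 q2 C30.
have K3 : eta / 2 * N%:R <= K%:R by lraw K2 q4 C30.
have KR : 0 < K%:R :> R by lraw K3 q4 C30.
have K0 : (0 < K)%N by rewrite -(ltr0n R).
have KN : K%:R <= N%:R :> R by apply: le_trans K1 _; rewrite ger_pMl //; lraw N1.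
pose U := incr (a 0%N) N K.
have [y /andP[y1 y2] ey] := @mvt_closed R (a 0%N) (a 1%N) N%:R (N%:R + K%:R) 
    (ltac:(lraw KR)) (fun z hz => hd 0%N z isT (le_trans XN (proj1 (andP hz)))).
have Xy : X <= y := le_trans XN y1.
have UE : U = K%:R * a 1%N y by rewrite /U /incr ey; ring.
have a1y : 0 < a 1%N y by apply: pos.
have U0 : 0 <= U by rewrite UE mulr_ge0 // ltW.
have [T1 T2] : U <= T%:R /\ T%:R <= U + 1.
  by have /andP[h1 h2] := truncn_itv U0; rewrite /T -natr1; split; [rewrite natr1 ltW|lraw h1].
have Ubig : 1 + 16 * C3 / eps <= U.
  have h1 := grow2 0%N y k0 Xy.
  have h2 : a 0%N N%:R <= a 0%N y by apply: (tame_mono tm k0).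
  have [_ h3] := Z4 _ ZN.
  have h4 : (1 + 16 * C3 / eps) * (4 * C / eta) <= C * (2 * N%:R * a 1%N y).
    apply: le_trans h3 (le_trans h2 (le_trans h1 _)); rewrite ler_pM2l // ler_pM2r //; lraw y2 KN.
  have h5 : C * (2 * N%:R * a 1%N y) <= C * (4 / eta * U).
    rewrite ler_pM2l // UE mulrA ler_pM2r //.
    have : 2 * N%:R = 4 / eta * (eta / 2 * N%:R) by field; rewrite gt_eqF.
    by move=> ->; rewrite ler_pM2l //; pos.
  have := le_trans h4 h5; have -> : C * (4 / eta * U) = U * (4 * C / eta) by ring.
  by rewrite ler_pM2r //; pos.
have e16 : 0 < 16 * C3 / eps by pos.
have TR : 0 < T%:R :> R by lraw e16 Ubig T1.
have JR : 0 < J%:R :> R by rewrite ltr0n.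
have jR : 1 <= j%:R :> R by rewrite ler1n.
have thE : th = j%:R / T%:R by [].
clearbody th.
have th0 : 0 < th by rewrite thE; apply: divr_gt0 => //; lraw jR.
have thJ : th <= J%:R by rewrite thE ler_pdivrMr // -natrM ler_nat ltnW.
pose f m := th * a 0%N (N%:R + m%:R).
have Sf : eps * K%:R <= nc (expsum f K).
  rewrite ltW //; move: big; rewrite -(expsum_cst _ (th * a 0%N N%:R)).
  congr (_ < nc _); apply: eq_expsum => m _; rewrite /f /incr thE; field; rewrite gt_eqF //.
have fk i m : (i <= k.+2)%N -> exists2 xi, N%:R <= xi & dlk i f m = th * a i xi.
  move=> ik; have [xi h e] := tame_dlk th m tm ik XN; exists xi => //.
  by have m0 := ler0n R m; lraw m0 h.
have LK : (L0 <= K)%N by rewrite -(ler_nat R); lraw L0b K3.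
have [||||r [l [P [cl rl DP close]]]] := IT f K LK.
- move=> m mK; have [xi Nx ->] := fk k.+1 m (leqnSn _).
  rewrite normrM (ger0_norm (ltW th0)).
  have [h _] := Z4 xi (le_trans ZN Nx).
  apply: le_trans (_ : J%:R * (d / J%:R) <= _); last by rewrite mulrC divfK ?gt_eqF.
  by apply: ler_pM => //; exact: ltW.
- case: s1 => h; [left|right] => m _; have [xi Nx ->] := fk k.+1 m (leqnSn _).
    by apply: mulr_ge0; [exact: ltW|exact: h (le_trans XN Nx)].
  by apply: mulr_ge0_le0; [exact: ltW|exact: h (le_trans XN Nx)].
- case: s2 => h; [left|right] => m _; have [xi Nx ->] := fk k.+2 m (leqnn _).
    by apply: mulr_ge0; [exact: ltW|exact: h (le_trans XN Nx)].
  by apply: mulr_ge0_le0; [exact: ltW|exact: h (le_trans XN Nx)].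
- exact: Sf.
have [dd [cc [dk dP cc0]]] := degree_of DP.
(* The coarse step: k + 1 steps of this length fit into the progression. *)
pose y' := (l %/ k.+1)%N.
have y'l : (y' * k.+1 <= l)%N by rewrite leq_trunc_div.
have y'K : (y' <= K)%N.
  apply: leq_trans (leq_trans _ rl); first exact: leq_div.
  by apply: leq_trans (leq_addl _ _); rewrite leq_pmull.
have y'Kr : y'%:R <= K%:R :> R by rewrite ler_nat.
have y'c : c4 * K%:R <= y'%:R.
  have h1 : l%:R < (y'%:R + 1) * kk by rewrite natr1 -natrM ltr_nat; exact: ltn_ceil.
  have h2 : c * K%:R < (y'%:R + 1) * kk by apply: le_lt_trans h1.
  have h3 : c * K%:R = 2 * (c4 * K%:R) * kk by rewrite /c4; field; rewrite gt_eqF.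
  rewrite h3 ltr_pM2r // in h2.
  have h4 : 1 <= c4 * K%:R.
    rewrite mulrC -ler_pdivrMr // div1r; have e2 : 2 / c4 = c4^-1 + c4^-1 by ring.
    have c4i : 0 < c4^-1 by rewrite invr_gt0.
    lraw e2 c4i c4b K3.
  lraw h2 h4.
have y'5 : c5 * N%:R <= y'%:R.
  by apply: le_trans y'c; rewrite /c5 -mulrA ler_pM2l.
have y'1 : 2 ^+ k.+1 * C1 <= y'%:R.
  apply: le_trans y'c; rewrite [leRHS]mulrC -ler_pdivrMr //; lraw w4b K3.
have y'0 : 0 < y'%:R :> R by apply: lt_le_trans y'1; pos.
have y'n0 : (0 < y')%N by rewrite -(ltr0n R).
have yge1 : 1 <= y'%:R :> R by rewrite ler1n.
have yB : y'%:R * (C1 / K%:R) <= C1 by rewrite mulrCA ger_pMr // ler_pdivrMr // mul1r.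
have yd : (y' * dd.+1 <= l)%N by apply: leq_trans y'l; rewrite leq_mul2l ltnS dk orbT.
have r0 := ler0n R r.
have XNr : X <= N%:R + r%:R by lraw r0 XN.
have close' m : (m < l)%N -> `|M%:R * th * (a 0%N (N%:R + r%:R + (p * m.+1)%N%:R) - a 0%N (N%:R + r%:R + (p * m)%N%:R)) - (dl P m)%:~R| <= C1 / K%:R.
  move=> ml; have := close m ml; rewrite /f; congr (`|_| <= _).
  by rewrite !natrD !addrA; ring.
have hd' i x : (i <= dd)%N -> X <= x -> is_derive x 1 (a i) (a i.+1 x).
  by move=> idd; apply: hd; apply: leq_trans idd (leq_trans dk (leqnSn _)).
have [[xi hxi b1] b2] := window_degree hd' XNr dP yd close'.
have inW (z : R) i : (i <= dd.+1)%N -> N%:R + r%:R <= z <= N%:R + r%:R + (p * y' * i)%N%:R -> N%:R <= z <= N%:R + K%:R.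
  move=> idd /andP[h1 h2]; apply/andP; split; first by lraw h1 r0.
  apply: le_trans h2 _; rewrite -addrA lerD2l -natrD ler_nat; apply: leq_trans rl.
  rewrite leq_add2l -mulnA leq_mul2l; apply/orP; right; apply: leq_trans yd.
  by rewrite leq_mul2l idd orbT.
have {hxi} hxi := inW xi _ (leqnn _) hxi.
have M0r : 0 < M%:R :> R by rewrite ltr0n.
have p0r : 0 < p%:R :> R by rewrite ltr0n.
have [hxi1 hxi2] := andP hxi.
have Xxi : X <= xi := le_trans XN hxi1.
case: (posnP dd) => [d00|dd0].
  exfalso; subst dd; rewrite expr0 mul1r expr1 in b1.
  have a1xi : 0 < a 1%N xi by apply: pos.
  have h1 : y'%:R * th * a 1%N xi <= C1.
    apply: le_trans yB; apply: le_trans b1; apply: le_trans (ler_norm _).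
    have e : M%:R * th * ((p * y')%N%:R * a 1%N xi) = (M%:R * p%:R) * (y'%:R * th * a 1%N xi) by rewrite natrM; ring.
    rewrite e ler_peMl //; first by rewrite ltW // !mulr_gt0.
    by rewrite -natrM ler1n muln_gt0 M0 p0.
  have h2 : a 1%N y <= C * a 1%N xi.
    by apply: (db 1%N N%:R) => //; apply/andP; split=> //; lraw y2 hxi2 KN.
  have h3 : T%:R <= 2 * (K%:R * (C * a 1%N xi)).
    have h3 : U <= K%:R * (C * a 1%N xi) by rewrite UE ler_pM2l.
    lraw h3 T2 Ubig e16.
  (* [th * a 1] is O(1/K) while [T] is O(K a 1), so the frequency [j] is bounded. *)
  have jC3 : j%:R <= C3.
    have h4 : y'%:R * j%:R * a 1%N xi <= C1 * T%:R.
      rewrite -ler_pdivrMr //; apply: le_trans h1; rewrite thE le_eqVlt; apply/orP; left.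
      by apply/eqP; ring.
    have h5 : y'%:R * j%:R * a 1%N xi <= C1 * (2 * (K%:R * (C * a 1%N xi))).
      by apply: le_trans h4 _; rewrite ler_pM2l.
    have e : C1 * (2 * (K%:R * (C * a 1%N xi))) = (2 * C1 * C * K%:R) * a 1%N xi by ring.
    rewrite e ler_pM2r // in h5.
    have h6 : c4 * K%:R * j%:R <= 2 * C1 * C * K%:R.
      by apply: le_trans h5; rewrite ler_pM2r //; lraw jR.
    have e2 : c4 * K%:R * j%:R = (c4 * j%:R) * K%:R by ring.
    rewrite e2 ler_pM2r // in h6.
    by rewrite /C3 ler_pdivlMr // mulrC.
  have jK : (0 < j < K)%N.
    by rewrite j0 -(ltr_nat R); lraw jC3 q4 K3.
  have lin m : (m < K)%N -> `|incr (a 0%N) N m / T%:R - m%:R / K%:R| <= eta * C ^+ 2 + 1 / T%:R.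
    move=> mK; have mKR : m%:R <= K%:R :> R by rewrite ler_nat ltnW.
    have eb : 0 <= eta <= 1 by rewrite (ltW eta0) eta1e.
    have h1' := incr_linear tm k0 XN eb K0 K1 (ltnW mK).
    rewrite -/U in h1'.
    have e : incr (a 0%N) N m / T%:R - m%:R / K%:R = (incr (a 0%N) N m - m%:R / K%:R * U) / T%:R + (m%:R / K%:R) * ((U - T%:R) / T%:R).
      by field; rewrite !gt_eqF.
    rewrite e; apply: le_trans (ler_normD _ _) _; apply: lerD.
      rewrite normrM (ger0_norm (_ : 0 <= T%:R^-1)); last by rewrite invr_ge0 ltW.
      rewrite ler_pdivrMr //; apply: le_trans h1' _; rewrite ler_wpM2l //.
      by rewrite mulr_ge0 ?sqr_ge0 // ltW.
    rewrite normrM -[leRHS]mul1r; apply: ler_pM => //.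
      by rewrite ger0_norm ?divr_ge0 ?ler0n // ler_pdivrMr // mul1r.
    rewrite normrM (ger0_norm (_ : 0 <= T%:R^-1)); last by rewrite invr_ge0 ltW.
    rewrite ler_pM2r ?invr_gt0 // ler_norml; apply/andP; split; lraw T1 T2.
  have := expsum_linear_multiple K0 jK lin; apply/negP; rewrite -ltNge; apply: le_lt_trans big.
  rewrite ler_pM2r //.
  have h7 : j%:R * (eta * C ^+ 2 + 1 / T%:R) <= C3 * (eta * C ^+ 2 + 1 / T%:R).
    by rewrite ler_wpM2r // addr_ge0 // ?divr_ge0 // ?ltW // mulr_gt0 // exprn_gt0.
  have h8 : C3 * (1 / T%:R) <= eps / 16.
    rewrite mulrA mulr1 ler_pdivrMr //.
    have h10 : 16 * C3 / eps <= T%:R by lraw Ubig T1.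
    rewrite ler_pdivrMr // in h10; lraw h10.
  have h9 : C3 * (eta * C ^+ 2) <= eps / 32 by lraw etae.
  rewrite mulrDr in h7; lraw h7 h8 h9 eps0.
have [z hz b3] := b2 dd0.
have {hz} hz := inW z _ (leqnSn _) hz.
have cc1 : 1 <= `|cc|%:~R :> R.
  have : (1 <= `|cc|)%R by rewrite -gtz0_ge1 normr_gt0 cc0.
  by rewrite -(ler_int R).
have [hz1 hz2] := andP hz.
have Xz : X <= z := le_trans XN hz1.
have adz : 0 < a dd z by apply: pos.
have adxi : 0 < a dd xi by apply: pos.
have dbz : a dd z <= C * a dd xi.
  by apply: (db dd N%:R) => //; apply/andP; split=> //; [lraw hz2 KN|lraw hxi2 KN].
pose Q := M%:R * th * (p * y')%N%:R ^+ dd.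
have py0 : 0 < (p * y')%N%:R :> R by rewrite ltr0n muln_gt0 p0.
have Q0 : 0 < Q by rewrite /Q; pos.
have two k1 : (k1 <= k)%N -> 2 ^+ k1 <= 2 ^+ k :> R.
  by move=> h; rewrite -!natrX ler_nat leq_pexp2l.
have b1' : Q * ((p * y')%N%:R * `|a dd.+1 xi|) <= 2 ^+ k * C1.
  apply: le_trans (_ : _ <= 2 ^+ dd * (y'%:R * (C1 / K%:R))) _; last first.
    by apply: ler_pM; [pos|pos|exact: two|exact: yB].
  apply: le_trans b1; rewrite exprSr !normrM normrX !(ger0_norm (ler0n _ _)) (ger0_norm (ltW th0)).
  by rewrite /Q -!mulrA.
have b3' : `|Q * a dd z - (y' ^ dd)%N%:R * cc%:~R| <= y'%:R / 2.
  apply: le_trans (_ : 2 ^+ dd.-1 * (y'%:R * (C1 / K%:R)) <= _).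
    by have -> : Q * a dd z = M%:R * th * ((p * y')%N%:R ^+ dd * a dd z) by rewrite /Q mulrA.
  apply: le_trans (_ : 2 ^+ k * C1 <= _).
    by apply: ler_pM; [pos|pos|apply: two; apply: leq_trans (leq_pred _) dk|exact: yB].
  rewrite exprS in y'1; lraw y'1.
have yd1 : y'%:R <= (y' ^ dd)%N%:R :> R.
  by rewrite ler_nat -{1}[y']expn1 leq_pexp2l.
have ydR : 0 < (y' ^ dd)%N%:R :> R by apply: lt_le_trans yd1.
have nrm : `|(y' ^ dd)%N%:R * cc%:~R| = (y' ^ dd)%N%:R * `|cc|%:~R :> R.
  by rewrite normrM (ger0_norm (ltW ydR)) -intr_norm.
have ydc : (y' ^ dd)%N%:R <= (y' ^ dd)%N%:R * `|cc|%:~R :> R by rewrite ler_peMr // ltW.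
have QA : 0 < Q * a dd z by rewrite mulr_gt0.
have Qlow : (y' ^ dd)%N%:R / 2 <= Q * a dd z.
  have h := ler_distD (Q * a dd z) ((y' ^ dd)%N%:R * cc%:~R) 0.
  rewrite !subr0 nrm (gtr0_norm QA) distrC in h; lraw h b3' yd1 ydc.
(* Order [dd] bounds the factor [Q] from below; order [dd.+1] then says that [a dd] varies
   slowly. *)
have star : y'%:R ^+ dd.+1 * `|a dd.+1 xi| <= W * a dd xi.
  have h1 : (y' ^ dd)%N%:R / 2 * (y'%:R * `|a dd.+1 xi|) <= Q * a dd z * ((p * y')%N%:R * `|a dd.+1 xi|).
    apply: ler_pM; [pos|by rewrite mulr_ge0|exact: Qlow|].
    by rewrite ler_wpM2r // ler_nat leq_pmull.
  have h2 : Q * a dd z * ((p * y')%N%:R * `|a dd.+1 xi|) <= 2 ^+ k * C1 * (C * a dd xi).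
    have -> : Q * a dd z * ((p * y')%N%:R * `|a dd.+1 xi|) = Q * ((p * y')%N%:R * `|a dd.+1 xi|) * a dd z by ring.
    apply: ler_pM; [|exact: ltW adz|exact: b1'|exact: dbz].
    by apply: mulr_ge0; [exact: ltW|apply: mulr_ge0; [exact: ltW|exact: normr_ge0]].
  have := le_trans h1 h2; rewrite natrX /W exprSr exprS.
  set A := y'%:R ^+ dd; set E := `|_|; set F := 2 ^+ k; set G := a dd xi; clear; lra.
have xi2 : N%:R <= xi <= 2 * N%:R by apply/andP; split=> //; lraw hxi2 KN.
(* For [dd < k] the bound of [a dd] by [C * (x * a dd.+1 x)] turns [star] into y'^(dd + 1) = O(N),
   impossible since dd + 1 >= 2 and y' is at least [c5 * N]. *)
move: dk; rewrite leq_eqVlt => /orP[/eqP dk|dk]; last first.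
  exfalso; have h1 := grow2 dd xi dk Xxi.
  have ap : 0 < a dd.+1 xi by apply: pos.
  have h2 : y'%:R ^+ dd.+1 * a dd.+1 xi <= W * (C * (2 * N%:R * a dd.+1 xi)).
    rewrite -{1}(gtr0_norm ap); apply: le_trans star _; rewrite ler_pM2l //; apply: le_trans h1 _.
    by rewrite ler_pM2l // ler_pM2r //; case/andP: xi2.
  have e : W * (C * (2 * N%:R * a dd.+1 xi)) = (W * (2 * C) * N%:R) * a dd.+1 xi by ring.
  rewrite e ler_pM2r // in h2.
  have h3 : (c5 * N%:R) ^+ 2 <= y'%:R ^+ dd.+1.
    apply: le_trans (_ : y'%:R ^+ 2 <= _); last by apply: ler_weXn2l.
    by apply: lerXn2r; rewrite ?nnegrE //; pos.
  have h4 : c5 ^+ 2 * N%:R * N%:R <= W * (2 * C) * N%:R.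
    by have := le_trans h3 h2; congr (_ <= _); ring.
  have NR0 : 0 < N%:R :> R by lraw N1.
  rewrite ler_pM2r // leNgt in h4; move/negP: h4; apply.
  by rewrite [ltRHS]mulrC -ltr_pdivrMr; [exact: lt_le_trans ZN|pos].
subst dd; exists r, l, P, cc; split; first split=> //.
- by rewrite th0.
- by apply: le_trans cl; rewrite -mulrA ler_pM2l.
- by apply: leq_trans rl _; rewrite -(ler_nat R).
- exact: cc0.
split.
  move=> m ml; have := close' m ml; rewrite -!natrD => h; apply: le_trans h _.
  apply: le_trans (_ : C1 * (2 / eta) / N%:R <= _); last by rewrite ler_pM2r // invr_gt0; lraw N1.
  rewrite -mulrA ler_pM2l //.
  have -> : 2 / eta / N%:R = (eta / 2 * N%:R)^-1 by field; rewrite !gt_eqF //; lraw N1.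
  by rewrite lef_pV2 ?posrE // mulr_gt0 //; [rewrite divr_gt0|lraw N1].
exists xi; split=> //.
  have h1 : (c5 * N%:R) ^+ k.+1 * `|a k.+1 xi| <= W * a k xi.
    apply: le_trans star; rewrite ler_wpM2r // lerXn2r ?nnegrE // mulr_ge0 // ltW //; lra.
  apply: le_trans (_ : W / c5 ^+ k.+1 * a k xi <= _); last by rewrite ler_pM2r.
  rewrite mulrAC ler_pdivlMr; last by pos.
  by move: h1; rewrite exprMn; congr (_ <= _); ring.
have h1 : (y' ^ k)%N%:R * `|cc|%:~R <= Q * a k z + y'%:R / 2.
  have h := ler_distD (Q * a k z) ((y' ^ k)%N%:R * cc%:~R) 0.
  rewrite !subr0 nrm (gtr0_norm QA) distrC in h; lraw h b3'.
have h2 : Q * a k z <= (y' ^ k)%N%:R * (M%:R * J%:R * p%:R ^+ k * C * a k xi).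
  have -> : Q = (y' ^ k)%N%:R * (M%:R * th * p%:R ^+ k) by rewrite /Q natrM exprMn natrX; ring.
  rewrite -[leLHS]mulrA ler_pM2l // -[leRHS]mulrA; apply: ler_pM => //.
  - by rewrite !mulr_ge0 ?exprn_ge0 ?ler0n // ltW.
  - exact: ltW.
  - by rewrite ler_pM2r ?exprn_gt0 // ler_pM2l.
have h3 : (y' ^ k)%N%:R * `|cc|%:~R <= (y' ^ k)%N%:R * (M%:R * J%:R * p%:R ^+ k * C * a k xi + 1) :> R.
  rewrite mulrDr mulr1; lraw h1 h2 yd1 y'0.
rewrite ler_pM2l // in h3; apply: le_trans h3 _.
have : 0 <= M%:R * J%:R * p%:R ^+ k * C by rewrite !mulr_ge0 ?exprn_ge0 ?ler0n // ltW.
by move: D3 adxi; set V := _ * _ * _ * C; set A := a k xi; clear; nra.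
Qed.

(** * The graph argument on a window *)

Lemma color_pair (T r n : nat) (V : {set 'I_T}) (col : 'I_T -> 'I_r) : (2 * n * r <= #|V|)%N ->
  (0 < r)%N -> (0 < n)%N ->
  exists A B : {set 'I_T}, [/\ #|A| = n, #|B| = n,
    (forall x, x \in A -> x \in V), (forall x, x \in B -> x \in V) &
    forall x y, x \in A -> y \in B -> x != y /\ col x = col y].
Proof.
move=> Vn r0 n0.
have [i hi] : exists i : 'I_r, (2 * n <= #|[set x in V | col x == i]|)%N.
  apply: contrapT => no.
  have : (#|V| < 2 * n * r)%N.
    rewrite -sum1_card (partition_big col predT) //=.
    apply: leq_trans (_ : \sum_(i < r) (2 * n).-1 < _)%N.
      rewrite ltnS; apply: leq_sum => i _.
      rewrite -ltnS prednK ?muln_gt0 // ltnNge; apply/negP => h; apply: no; exists i.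
      by rewrite -sum1_card (eq_bigl (fun x => (x \in V) && (col x == i))) // => x; rewrite inE.
    by rewrite sum_nat_const card_ord mulnC ltn_pmul2r // prednK // muln_gt0.
  by rewrite ltnNge Vn.
set S := [set x in V | col x == i] in hi.
have un : uniq (enum S) by exact: enum_uniq.
have szS : size (enum S) = #|S| by rewrite -cardE.
pose s1 := take n (enum S); pose s2 := take n (drop n (enum S)).
have sz1 : size s1 = n by rewrite size_takel // szS; apply: leq_trans hi; rewrite leq_pmull.
have sz2 : size s2 = n by rewrite size_takel // size_drop szS leq_subRL ?addnn -?mul2n // (leq_trans _ hi) // leq_pmull.
have inS x : x \in enum S -> x \in V /\ col x = i by rewrite mem_enum inE => /andP[-> /eqP ->].
have s1S x : x \in s1 -> x \in enum S by exact: mem_take.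
have s2S x : x \in s2 -> x \in enum S by move=> /mem_take/mem_drop.
exists [set x in s1], [set x in s2]; split.
- by rewrite cardsE (card_uniqP _) // take_uniq.
- by rewrite cardsE (card_uniqP _) // take_uniq // drop_uniq.
- by move=> x; rewrite inE => /s1S/inS[].
- by move=> x; rewrite inE => /s2S/inS[].
move=> x y; rewrite !inE => xs ys; split; last first.
  by have [_ ->] := inS x (s1S x xs); have [_ ->] := inS y (s2S y ys).
apply/eqP => e; move: un; rewrite -(cat_take_drop n (enum S)) cat_uniq => /and3P[_ /hasPn h _].
by have := h y (mem_take ys); rewrite /= -/s1 -e xs.
Qed.

(** Sums of two elements of [[q, 3q)] lie in [[2q, 6q)]; with T about 8q they differ from any number
    of [[0, T]] by little more than 3/4 of T, within the range of the kernel estimate. *)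
Lemma middle_set (T q : nat) : (3 * q <= T)%N ->
  exists V : {set 'I_T}, (#|V| = 2 * q)%N /\ forall x, x \in V -> (q <= x < 3 * q)%N.
Proof.
move=> qT; have lt (i : 'I_(2 * q)) : (q + i < T)%N.
  by apply: leq_trans qT; have := ltn_ord i; lia.
pose f i := Ordinal (lt i); exists (f @: 'I_(2 * q)); split.
  rewrite card_imset ?card_ord // => i j /(congr1 val) /= /eqP.
  by rewrite eqn_add2l => /eqP/val_inj.
move=> x /imsetP[i _ ->] /=; have := ltn_ord i; lia.
Qed.

Lemma floor_intro (R : realType) (x : R) (z : int) : z%:~R <= x < z%:~R + 1 -> Num.floor x = z.
Proof. by move=> h; apply/eqP; rewrite floor_eq intrD. Qed.

(** Contrapositive of [dense_hit] for two disjoint parts of a colour class; disjointness makes the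
    summands distinct. [J] and [eps] depend on the number of colours only, so that [eta] may be
    chosen after the inverse theorem. *)
Lemma graph_hit (R : realType) (a : nat -> R -> R) (k : nat) (X C : R) (r : nat) (color : nat -> 'I_r) :
  tame k a X C -> (0 < k)%N -> (forall c, evt (fun x => c <= a 0%N x)) ->
  ~ (exists x y n : nat, [/\ (0 < x)%N, (0 < y)%N & (0 < n)%N] /\
     [/\ x <> y, color x = color y & (x + y)%:Z = Num.floor (a 0%N n%:R)]) ->
  exists (J : nat) (eps : R), [/\ (0 < J)%N, 0 < eps & forall eta : R, 0 < eta <= 1 ->
    exists N0 : nat, forall N : nat, (N0 <= N)%N ->
    let K := Num.truncn (eta * N%:R) in let T := (Num.truncn (incr (a 0%N) N K)).+1 in
    exists2 j, (0 < j < J * T)%N & eps * K%:R < nc (expsum (fun m => j%:R * (incr (a 0%N) N m / T%:R)) K)].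
Proof.
move=> tm k0 hoo nosol.
have r0 : (0 < r)%N by case: (color 0%N) => i; exact: leq_ltn_trans.
have rR : 0 < r%:R :> R by rewrite ltr0n.
have Cge1 := tame_C1 tm; have [[X1 C0 hd pos] [[grow grow2 db _] [small s1 s2]]] := tm.
have [J J0 Jb] := natr_above (128 * 4096 * r%:R : R).
have JR : 0 < J%:R :> R by rewrite ltr0n.
(* [eps * J] and 4096/J are each at most 1/(128 r), against a density n/T of at least 1/(32 r). *)
pose eps : R := (128 * r%:R * J%:R)^-1.
have eps0 : 0 < eps by rewrite invr_gt0; pos.
exists J, eps; split=> // eta /andP[eta0 eta1].
have [Z hZ] := evtI (hoo ((32 * r%:R + 40) * (4 * C / eta))) (evt_ge (Num.max (Num.max X 1) (2 / eta))).
have [N0 _ N0b] := natr_above Z.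
exists N0 => N NN K T; apply: contrapT => hno.
have ZN : Z <= N%:R by apply: le_trans N0b _; rewrite ler_nat.
have [big] := hZ _ ZN; rewrite !ge_max => /andP[/andP[XN N1] Ne].
have etaN : 0 <= eta * N%:R by rewrite mulr_ge0 // ltW.
have [K1 K2] : K%:R <= eta * N%:R /\ eta * N%:R < K%:R + 1.
  by have /andP[h1 h2] := truncn_itv etaN; split=> //; rewrite natr1.
have eN : 2 <= eta * N%:R by rewrite mulrC -ler_pdivrMr.
have K3 : eta / 2 * N%:R <= K%:R by lraw K2 eN.
have KR : 0 < K%:R :> R by lraw K3 eN.
have K0 : (0 < K)%N by rewrite -(ltr0n R).
have KN : K%:R <= N%:R :> R by apply: le_trans K1 _; rewrite ger_pMl //; lraw N1.
pose U := incr (a 0%N) N K.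
have [y /andP[y1 y2] ey] := @mvt_closed R (a 0%N) (a 1%N) N%:R (N%:R + K%:R) 
    (ltac:(lraw KR)) (fun z hz => hd 0%N z isT (le_trans XN (proj1 (andP hz)))).
have Xy : X <= y := le_trans XN y1.
have UE : U = K%:R * a 1%N y by rewrite /U /incr ey; ring.
have a1y : 0 < a 1%N y by apply: pos.
have Ubig : 32 * r%:R + 40 <= U.
  have h1 := grow2 0%N y k0 Xy.
  have h2 : a 0%N N%:R <= a 0%N y by apply: (tame_mono tm k0).
  have h4 : (32 * r%:R + 40) * (4 * C / eta) <= C * (2 * N%:R * a 1%N y).
    apply: le_trans big (le_trans h2 (le_trans h1 _)); rewrite ler_pM2l // ler_pM2r //; lraw y2 KN.
  have h5 : C * (2 * N%:R * a 1%N y) <= C * (4 / eta * U).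
    rewrite ler_pM2l // UE mulrA ler_pM2r //.
    have : 2 * N%:R = 4 / eta * (eta / 2 * N%:R) by field; rewrite gt_eqF.
    by move=> ->; rewrite ler_pM2l //; pos.
  have := le_trans h4 h5; have -> : C * (4 / eta * U) = U * (4 * C / eta) by ring.
  by rewrite ler_pM2r //; pos.
have r32 : 0 < 32 * r%:R :> R by pos.
have U0 : 0 <= U by lraw Ubig r32.
have [T1 T2] : U <= T%:R /\ T%:R <= U + 1.
  by have /andP[h1 h2] := truncn_itv U0; rewrite /T -natr1; split; [rewrite natr1 ltW|lraw h1].
have T0 : (0 < T)%N by [].
have TR : 0 < T%:R :> R by rewrite ltr0n.
have Tr : (32 * r + 40 <= T)%N by rewrite -(ler_nat R) natrD natrM; lraw Ubig T1.
pose q := (T %/ 8)%N; pose n := (T %/ (16 * r))%N.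
have q8 : (8 * q <= T < 8 * q + 8)%N.
  by rewrite mulnC leq_trunc_div -mulSnr ltn_ceil.
have r16 : (0 < 16 * r)%N by rewrite muln_gt0.
have n16 : (16 * r * n <= T < 16 * r * n + 16 * r)%N.
  by rewrite mulnC leq_trunc_div addnC -mulSn ltn_ceil.
have qn : (2 * n * r <= 2 * q)%N.
  move: q8 n16 Tr; rewrite -!mulnA [(r * n)%N]mulnC; clear; set z := (n * r)%N; lia.
have nT : T%:R <= 32 * r%:R * n%:R :> R.
  rewrite -!natrM ler_nat; move: n16 Tr; rewrite -!mulnA; clear; set z := (r * n)%N; lia.
have n0 : (0 < n)%N by move: n16 Tr; case: (n) => // ; clear; lia.
have [V [cV hV]] := @middle_set T q (ltac:(move: q8; clear; lia)).
have aN0 : 0 < a 0%N N%:R by apply: pos.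
have [X0 X01 X02] := @floor_nat R (a 0%N N%:R / 2) (ltac:(lraw aN0)).
have [A [B [cA cB AV BV AB]]] := @color_pair T r n V (fun x => color (X0.+1 + x)%N) (ltac:(by rewrite cV)) r0 n0.
(* Vertices are translated by [X0.+1], about half of [a 0 N]. The summand 1/2 centres the unit
   interval, so that distance less than 1/2 means 0 < a(N + m) - x - y < 1 for the translated x, y,
   which determines the floor. *)
pose h : R := 2 * X0.+1%:R - a 0%N N%:R + 1 / 2.
have hb : 1 / 2 <= h <= 5 / 2.
  rewrite /h -[X0.+1%:R]natr1; apply/andP; split; lraw X01 X02.
have [|||m [x [z [mK xA zB hit]]]] := @dense_hit R T J K n (incr (a 0%N) N) eps h A B T0 J0 K0 n0 (ltW eps0) cA cB.
- have e1 : eps * J%:R = (128 * r%:R)^-1 by rewrite /eps; field; rewrite !gt_eqF.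
  have e2 : 4096 / J%:R <= (128 * r%:R)^-1 :> R.
    have gen (c : R) : 128 * c * r%:R <= J%:R -> c / J%:R <= (128 * r%:R)^-1.
      have r128 : 0 < 128 * r%:R :> R by pos.
      by move=> hc; rewrite ler_pdivrMr // mulrC ler_pdivlMr //; lraw hc.
    exact: gen.
  have e3 : 32^-1 * r%:R^-1 <= n%:R / T%:R :> R.
    rewrite -invfM -[leLHS]mul1r ler_pdivrMr ?mulr_gt0 // mulrAC ler_pdivlMr // mul1r; lraw nT.
  have e4 : (128 * r%:R)^-1 = 128^-1 * r%:R^-1 :> R by rewrite invfM.
  have ri : 0 < r%:R^-1 :> R by rewrite invr_gt0.
  rewrite e4 in e1 e2; rewrite e1; lraw e2 e3 ri.
- by move=> j hj; rewrite leNgt; apply/negP => hl; apply: hno; exists j.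
- move=> m x z mK xA zB.
  have := hV x (AV x xA); have := hV z (BV z zB) => /andP[z1 z2] /andP[x1 x2].
  have mR : m%:R <= K%:R :> R by rewrite ler_nat ltnW.
  have u1 : 0 <= incr (a 0%N) N m.
    rewrite /incr subr_ge0; apply: (tame_mono tm k0) => //; by rewrite lerDl ler0n.
  have u2 : incr (a 0%N) N m <= T%:R.
    apply: le_trans T1; rewrite /U /incr lerD2r; apply: (tame_mono tm k0) => //; last by rewrite lerD2l.
    by apply: le_trans XN _; rewrite lerDl ler0n.
  have s1' : (2 * q <= x + z)%N by move: x1 z1; clear; lia.
  have s2' : (x + z <= 6 * q)%N by move: x2 z2; clear; lia.
  have s3 : (8 * q <= T)%N by case/andP: q8.
  have s4 : (T <= 8 * q + 8)%N by case/andP: q8 => _ /ltnW.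
  rewrite -(ler_nat R) natrM natrD in s1'; rewrite -(ler_nat R) natrM natrD in s2'.
  rewrite -(ler_nat R) natrM in s3; rewrite -(ler_nat R) natrD natrM in s4.
  have T40 : 40 <= T%:R :> R by rewrite ler_nat; apply: leq_trans Tr; rewrite leq_addl.
  case/andP: hb => hb1 hb2.
  rewrite ler_norml; apply/andP; split; [lraw hb2 u1 s2' s3 T40|lraw hb1 u2 s1' s4 T40].
apply: nosol; exists (X0.+1 + x)%N, (X0.+1 + z)%N, (N + m)%N.
have [xz cxz] := AB x z xA zB.
have N0' : (0 < N)%N by rewrite -(ltr0n R); lraw N1.
split; split=> //; first by rewrite addn_gt0 N0'.
  by move=> /eqP; rewrite eqn_add2l => /eqP/val_inj e; rewrite e eqxx in xz.
apply/esym/floor_intro; move: hit; rewrite /incr /h ltr_norml -pmulrn !natrD => /andP[h1 h2].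
by apply/andP; split; [lraw h1|lraw h2].
Qed.

(** * Functions close to a polynomial at every scale *)

Lemma binom_le_expn (n k : nat) : ('C(n, k) <= n ^ k)%N.
Proof.
elim: k => [|k IH]; first by rewrite bin0.
rewrite -(leq_pmul2l (ltn0Sn k)) mul_bin_left expnS.
apply: leq_trans (_ : n * n ^ k <= _)%N; last by rewrite leq_pmull.
by apply: leq_mul => //; exact: leq_subr.
Qed.

Lemma leq_exp_base (m n k : nat) : (m <= n)%N -> (m ^ k <= n ^ k)%N.
Proof. by move=> mn; elim: k => // k IH; rewrite !expnS leq_mul. Qed.

(** The top difference is bounded by sampling at a step of about l/(k + 1); subtracting the
    corresponding binomial term lowers the degree. *)
Lemma poly_small (R : realType) (k : nat) : exists2 E : R, 0 < E &
  forall (Q : nat -> R) (B : R) (l : nat), (k < l)%N -> (forall n, dlk k.+1 Q n = 0) ->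
  (forall m, (m < l)%N -> `|dl Q m| <= B) ->
  forall i, (i < k)%N -> `|dlk i.+1 Q 0%N| * l%:R ^+ i <= E * B.
Proof.
elim: k => [|k [E E0 IH]]; first by exists 1.
pose F : R := (2 * k.+1%:R) ^+ k * 2 ^+ k.
have F0 : 0 < F by rewrite /F; pos.
exists (F + E * (1 + F)); first by pos.
move=> Q B l kl hQ hB.
have B0 : 0 <= B by apply: le_trans (normr_ge0 _) (hB 0%N _); exact: leq_ltn_trans kl.
pose q := dlk k.+1 Q 0%N.
have hq n : dlk k.+1 Q n = q by exact: (@dl0_const _ (dlk k.+1 Q)).
pose y := (l %/ k.+1)%N.
have y0 : (0 < y)%N by rewrite divn_gt0 // ltnW.
have yR : 0 < y%:R :> R by rewrite ltr0n.
have yl : (y * k.+1 <= l)%N by rewrite leq_trunc_div.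
have ly : (l <= y * (2 * k.+1))%N.
  apply: leq_trans (ltnW (ltn_ceil l (ltn0Sn k))) _; rewrite -/y mulSn mulnCA mul2n -addnn leq_add2r.
  by rewrite leq_pmull.
have lyR : l%:R <= y%:R * (2 * k.+1%:R) :> R by rewrite -!natrM ler_nat.
have top : `|q| * l%:R ^+ k <= F * B.
  have gd s : (s < k.+1)%N -> `|dl (fun s => Q (y * s)%N) s| <= y%:R * B.
    move=> sk; rewrite /dl mulnS addnC telescope_dl; apply: le_trans (ler_norm_sum _ _ _) _.
    have -> : y%:R * B = \sum_(i < y) B by rewrite sumr_const card_ord mulr_natl.
    apply: ler_sum => i _; apply: hB; apply: leq_trans yl.
    apply: leq_trans (_ : y * s.+1 <= _)%N; last by rewrite leq_mul2l sk orbT.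
    by rewrite mulnS addnC ltn_add2r.
  have := @dlk_bound R (fun s => Q (y * s)%N) k (y%:R * B) k.+1 gd 0%N (leqnn _).
  rewrite (dlk_stride y hq) normrM (ger0_norm (ler0n _ _)) natrX exprS.
  have -> : y%:R * y%:R ^+ k * `|q| = y%:R * (`|q| * y%:R ^+ k) by ring.
  rewrite [leRHS]mulrCA ler_pM2l // => h.
  apply: le_trans (_ : `|q| * (y%:R * (2 * k.+1%:R)) ^+ k <= _).
    by rewrite ler_wpM2l // lerXn2r ?nnegrE // mulr_ge0 // ltW.
  rewrite exprMn mulrA; apply: le_trans (_ : 2 ^+ k * B * (2 * k.+1%:R) ^+ k <= _).
    by rewrite ler_wpM2r // exprn_ge0 // mulr_ge0.
  by rewrite /F le_eqVlt; apply/orP; left; apply/eqP; ring.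
have le1 : F * B <= (F + E * (1 + F)) * B.
  by rewrite ler_wpM2r // lerDl; pos.
move=> i; rewrite ltnS leq_eqVlt => /orP[/eqP ->|ik]; first exact: le_trans top le1.
pose Q1 n := Q n - q * ('C(n, k.+1))%:R.
have DQ1 j n : dlk j Q1 n = dlk j Q n - q * (if (j <= k.+1)%N then ('C(n, k.+1 - j))%:R else 0).
  by rewrite (dlk_sub _ Q) dlkM dlk_binom.
have e0 : dlk i.+1 Q1 0%N = dlk i.+1 Q 0%N.
  by rewrite DQ1 ltnS (ltnW ik) subSS bin0n subn_eq0 leqNgt ik /= mulr0 subr0.
have hQ1 n : dlk k.+1 Q1 n = 0 by rewrite DQ1 leqnn subnn bin0 mulr1 hq subrr.
have hB1 m : (m < l)%N -> `|dl Q1 m| <= (1 + F) * B.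
  move=> ml; have -> : dl Q1 m = dl Q m - q * ('C(m, k))%:R.
    by have := DQ1 1%N m; rewrite subn1.
  have -> : (1 + F) * B = B + F * B by ring.
  apply: le_trans (ler_normB _ _) _; apply: lerD; first exact: hB.
  apply: le_trans top; rewrite normrM ler_wpM2l // ger0_norm ?ler0n // -natrX ler_nat.
  by apply: leq_trans (binom_le_expn _ _) _; apply: leq_exp_base; exact: ltnW.
rewrite -e0; apply: le_trans (IH Q1 ((1 + F) * B) l (ltnW kl) hQ1 hB1 i ik) _.
by rewrite mulrA ler_wpM2r // lerDr ltW.
Qed.

(** With [t m] the claimed error, [c - t] is nondecreasing and [c + t] nonincreasing, so they
    enclose a common value. *)
Lemma dl_tail (R : realType) (c : nat -> R) (D : R) (j : nat) : 0 <= D -> (0 < j)%N ->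
  (forall m, `|dl c m| <= D / m.+1%:R ^+ j.+1) ->
  exists g, forall m, `|c m - g| <= 2 * D / m.+1%:R ^+ j.
Proof.
move=> D0 j0 h; pose t m : R := 2 * D / m.+1%:R ^+ j.
have pos_ m : 0 < m.+1%:R :> R by rewrite ltr0n.
have t0 m : 0 <= t m by rewrite /t divr_ge0 ?mulr_ge0 // exprn_ge0 // ltW.
have step m : `|dl c m| <= t m - t m.+1.
  apply: le_trans (h m) _; rewrite /t -mulrBr.
  set x : R := m.+1%:R; have x1 : 1 <= x by rewrite ler1n.
  have e : m.+2%:R = x + 1 :> R by rewrite natr1.
  have xj : 0 < x ^+ j by rewrite exprn_gt0 //; lraw x1.
  have xj1 : 0 < (x + 1) ^+ j by rewrite exprn_gt0 //; lraw x1.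
  have k1 : (x + 1) * x ^+ j <= x * (x + 1) ^+ j.
    case: j j0 {h t t0 xj xj1} => // j _; rewrite !exprS.
    have : x ^+ j <= (x + 1) ^+ j by rewrite lerXn2r ?nnegrE //; lraw x1.
    have -> : (x + 1) * (x * x ^+ j) = x * (x + 1) * x ^+ j by ring.
    have -> : x * ((x + 1) * (x + 1) ^+ j) = x * (x + 1) * (x + 1) ^+ j by ring.
    by move=> hh; rewrite ler_pM2l // mulr_gt0 //; lraw x1.
  have k2 : ((x + 1) ^+ j)^-1 <= (x ^+ j)^-1 * (x / (x + 1)).
    rewrite mulrA ler_pdivlMr; last by lraw x1.
    rewrite -(ler_pM2l (mulr_gt0 xj xj1)).
    have -> : x ^+ j * (x + 1) ^+ j * (((x + 1) ^+ j)^-1 * (x + 1)) = (x + 1) * x ^+ j by field; rewrite gt_eqF.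
    by have -> : x ^+ j * (x + 1) ^+ j * ((x ^+ j)^-1 * x) = x * (x + 1) ^+ j by field; rewrite gt_eqF.
  have k3 : (x ^+ j)^-1 - (x ^+ j)^-1 * (x / (x + 1)) = (x ^+ j)^-1 / (x + 1).
    by field; rewrite ?gt_eqF //; lraw x1.
  have k4 : (x ^+ j.+1)^-1 <= 2 * ((x ^+ j)^-1 / (x + 1)).
    rewrite exprS invfM [x^-1 * _]mulrC mulrCA ler_pM2l ?invr_gt0 //.
    have x0 : 0 < x by lraw x1.
    rewrite ler_pdivlMr; last by lraw x1.
    by rewrite mulrC ler_pdivrMr //; lraw x1.
  rewrite e; have -> : D / x ^+ j.+1 = 2 * D * ((x ^+ j.+1)^-1 / 2) by field; rewrite gt_eqF // exprn_gt0 //; lraw x1.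
  apply: ler_wpM2l; first by rewrite mulr_ge0.
  lraw k2 k3 k4.
have up m n : (m <= n)%N -> c m - t m <= c n - t n /\ c n + t n <= c m + t m.
  move=> /subnKC <-; elim: (n - m)%N => [|i [h1 h2]]; first by rewrite addn0.
  have := step (m + i)%N; rewrite addnS /dl ler_norml => /andP[s1 s2].
  by split; [lraw h1 s1|lraw h2 s2].
have cross m n : c m - t m <= c n + t n.
  have [h1 _] := up m (m + n)%N (leq_addr _ _).
  have [_ h2] := up n (m + n)%N (leq_addl _ _).
  have := t0 (m + n)%N; lraw h1 h2.
pose S := [set c m - t m | m in [set: nat]].
have S0 : S (c 0%N - t 0%N) by exists 0%N.
have Sub n : ubound S (c n + t n) by move=> x [m _ <-]; exact: cross.
exists (sup S) => m; rewrite ler_norml; apply/andP; split.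
  have : sup S <= c m + t m by apply: ge_sup => //; exists (c 0%N - t 0%N).
  rewrite -/(t m); lra.
have : c m - t m <= sup S.
  by apply: ub_le_sup; [exists (c 0%N + t 0%N)|exists m].
rewrite -/(t m); lra.
Qed.

(** A Newton expansion without constant term, as only increments are controlled. *)
Definition newton (R : pzRingType) (k : nat) (g : nat -> R) (m : nat) : R :=
  \sum_(i < k) g i * ('C(m, i.+1))%:R.

Lemma dlk_newton (R : pzRingType) (k : nat) (g : nat -> R) (j s : nat) :
  dlk j (newton k g) s = \sum_(i < k) g i * (if (j <= i.+1)%N then ('C(s, i.+1 - j))%:R else 0).
Proof.
rewrite (@dlk_sum _ j k (fun i m => g i * ('C(m, i.+1))%:R)); apply: eq_bigr => i _.
by rewrite dlkM dlk_binom.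
Qed.

(** The highest difference that still converges has a limit with a rate, by [dl_tail]; this limit is
    the coefficient to subtract before the order is lowered. *)
Lemma newton_expand (R : realType) (k : nat) (D : R) (u : nat -> R) : 0 <= D ->
  (forall m, `|dlk k.+1 u m| <= D / m.+1%:R ^+ k.+1) ->
  exists (g : nat -> R) (D' : R), 0 <= D' /\
    forall m, `|dl (fun m => u m - newton k g m) m| <= D' / m.+1%:R.
Proof.
elim: k D u => [|k IH] D u D0 h.
  exists (fun=> 0), D; split=> // m; have := h m; rewrite expr1; congr (`|_| <= _).
  by rewrite /newton /dl !big_ord0 !subr0.
have [g hg] := @dl_tail R (dlk k.+1 u) D k.+1 D0 isT h.
pose u1 n := u n - g * ('C(n, k.+1))%:R.
have [||g1 [D' [D'0 h1]]] := IH (2 * D) u1; first by rewrite mulr_ge0.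
  by move=> m; rewrite (dlk_sub _ u) dlkM dlk_binom leqnn subnn bin0 mulr1.
exists (fun i => if i == k then g else g1 i), D'; split=> // m.
have := h1 m; congr (`|_| <= _); congr (dl _ m); apply/funext => n.
rewrite /u1 /newton big_ord_recr /= eqxx opprD addrA addrAC; congr (_ - _ - _).
by apply: eq_bigr => i _; rewrite lt_eqF // -[(_ < _)%O]/(i < k)%N ltn_ord.
Qed.

Lemma int_closed (R : realType) (x : R) :
  (forall e, 0 < e -> exists z : int, `|x - z%:~R| <= e) -> exists z : int, x = z%:~R.
Proof.
move=> h; have [z0 h0] := h (1 / 4) ltac:(lra); exists z0.
apply/eqP; rewrite -subr_eq0 -normr_le0 leNgt; apply/negP => p0.
have m0 : 0 < Num.min (1 / 4) (`|x - z0%:~R| / 2) by rewrite lt_min; apply/andP; split; lraw p0.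
have [z1 h1] := h _ m0.
move: h1; rewrite le_min => /andP[h1 h2].
have : `|(z1 - z0)%:~R : R| <= 1 / 2.
  rewrite intrB (_ : _ - _ = (x - z0%:~R) - (x - z1%:~R)); last by ring.
  by apply: le_trans (ler_normB _ _) _; lraw h0 h1.
rewrite -intr_norm => h3.
have : (`|z1 - z0| < 1)%R by rewrite -(ltr_int R); apply: le_lt_trans h3 _; lra.
move=> h4; have e : z1 = z0 by move: h4; clear; lia.
by rewrite e in h2; lraw h2 p0.
Qed.

Lemma inf_pigeon (T : finType) (Rel : nat -> T -> Prop) (N0 : nat) :
  (forall N, (N0 <= N)%N -> exists t, Rel N t) ->
  exists t, forall N1, exists2 N, (N1 <= N)%N & Rel N t.
Proof.
move=> h; apply: contrapT => no.
have ex t : exists N1, forall N, (N1 <= N)%N -> ~ Rel N t.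
  apply: contrapT => no2; apply: no; exists t => N1; apply: contrapT => no3; apply: no2.
  by exists N1 => N hN hr; apply: no3; exists N.
have [f hf] := boolp.choice ex.
have [t ht] := h (maxn N0 (\max_t f t)) (leq_maxl _ _).
by apply: hf ht; apply: leq_trans (leq_maxr _ _); exact: leq_bigmax.
Qed.

(* The windows determine [M * th] only up to O(1/N), but the top coefficient
   [A] is the same at all scales, which pins down the limit of [th]; the lower
   coefficients are then limits of integers, from the top down. *)
Lemma newton_integral (R : realType) (k : nat) (g : nat -> R) (M J : nat) (c1 D Cs : R) (A : int) :
  (0 < M)%N -> 0 < c1 -> 0 <= Cs -> A != 0 -> 0 <= D ->
  (forall N0 : nat, exists N : nat, (N0 <= N)%N /\ exists (th : R) (s l : nat) (P : nat -> int),
    [/\ 0 < th <= J%:R, s%:R <= Cs * N%:R, c1 * N%:R <= l%:R, (forall n, dlk k.+1 P n = A) &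
     forall m, (m < l)%N -> `|M%:R * th * dl (newton k.+1 g) (s + m)%N - (dl P m)%:~R| <= D / N%:R]) ->
  exists (th : R) (h : nat -> int), [/\ 0 <= th, h k = A & forall i, (i < k.+1)%N -> M%:R * th * g i = (h i)%:~R].
Proof.
move=> M0 c10 Cs0 A0 D0 data.
have MR : 0 < M%:R :> R by rewrite ltr0n.
have [E E0 small] := @poly_small R k.+1.
pose F := E * D * (c1^-1 + 1) ^+ k.+1.
have c1i : 0 < c1^-1 by rewrite invr_gt0.
have F0 : 0 <= F by rewrite /F mulr_ge0 ?mulr_ge0 ?(ltW E0) // exprn_ge0 //; lraw c1i.
(* [poly_small] turns closeness of increments into closeness of the differences of every order at
   the single point [s], gaining a power of N with each order. *)
have data1 N0 : exists N : nat, [/\ (N0 <= N)%N, (0 < N)%N & exists (th : R) (s : nat) (z : nat -> int),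
    [/\ 0 < th <= J%:R, s%:R <= Cs * N%:R, z k = A &
     forall i, (i < k.+1)%N -> `|M%:R * th * dlk i.+1 (newton k.+1 g) s - (z i)%:~R| * N%:R ^+ i.+1 <= F]].
  have [Nb _ hNb] := natr_above (k.+2%:R / c1).
  have [N [NN [th [s [l [P [hth hs hl hP hclose]]]]]]] := data (maxn N0 (maxn 1 Nb)).
  have [N1 N2] : (N0 <= N)%N /\ (0 < N)%N /\ (Nb <= N)%N by move: NN; rewrite !geq_max => /and3P[].
  case: N2 => N2 N3; exists N; split=> //.
  have NR : 0 < N%:R :> R by rewrite ltr0n.
  exists th, s, (fun i => dlk i.+1 P 0%N); split=> // i ik.
  pose Q m := M%:R * th * newton k.+1 g (s + m)%N - (P m)%:~R.
  have QE j n : dlk j Q n = M%:R * th * dlk j (newton k.+1 g) (s + n)%N - (dlk j P n)%:~R.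
    by rewrite (dlk_sub _ (fun m => M%:R * th * newton k.+1 g (s + m)%N)) dlkM dlk_shift (@dlk_intr R j P).
  have lk : (k.+1 < l)%N.
    rewrite -(ltr_nat R); apply: lt_le_trans hl.
    have : k.+2%:R / c1 <= N%:R by apply: le_trans hNb _; rewrite ler_nat.
    rewrite ler_pdivrMr // mulrC; apply: lt_le_trans; by rewrite ltr_nat.
  have hQ n : dlk k.+2 Q n = 0.
    have e1 : dlk k.+2 P n = 0 by rewrite dlkS /dl !hP subrr.
    have e2 : dlk k.+2 (newton k.+1 g) (s + n)%N = 0.
      by rewrite dlk_newton big1 // => j _; rewrite ltnS leqNgt ltn_ord mulr0.
    by rewrite QE e1 e2 mulr0 subr0.
  have hB m : (m < l)%N -> `|dl Q m| <= D / N%:R.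
    by move=> ml; have := hclose m ml; rewrite -[dl Q m]/(dlk 1 Q m) QE.
  have := small Q (D / N%:R) l lk hQ hB i ik; rewrite QE addn0.
  set V := `|_| => hV.
  have lN : N%:R <= l%:R * c1^-1 by rewrite ler_pdivlMr // mulrC.
  have V0 : 0 <= V := normr_ge0 _.
  have c11 : 1 <= c1^-1 + 1 by lraw c1i.
  apply: le_trans (_ : V * l%:R ^+ i * (c1^-1 + 1) ^+ i * N%:R <= _).
    rewrite exprSr mulrA ler_pM2r // -mulrA ler_wpM2l // -exprMn lerXn2r ?nnegrE ?mulr_ge0 ?ler0n //.
      lraw c1i.
    by apply: le_trans lN _; rewrite ler_wpM2l ?ler0n //; lraw c1i.
  apply: le_trans (_ : E * (D / N%:R) * (c1^-1 + 1) ^+ i * N%:R <= _).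
    by rewrite ler_pM2r // ler_wpM2r // exprn_ge0 //; lraw c11.
  have -> : E * (D / N%:R) * (c1^-1 + 1) ^+ i * N%:R = E * D * (c1^-1 + 1) ^+ i by field; rewrite gt_eqF.
  rewrite /F ler_wpM2l ?mulr_ge0 ?(ltW E0) //; apply: ler_weXn2l => //; exact: ltnW.
have gtop s : dlk k.+1 (newton k.+1 g) s = g k.
  rewrite dlk_newton big_ord_recr /= leqnn subnn bin0 mulr1 big1 ?add0r // => j _.
  by rewrite ltnS leqNgt ltn_ord mulr0.
have AR : 1 <= `|A%:~R : R|.
  by rewrite -intr_norm ler1z -gtz0_ge1 normr_gt0.
have gk0 : g k != 0.
  apply/eqP => gk; have [Nb _ hNb] := natr_above (2 * F).
  have [N [NN N0 [th [s [z [_ _ zA hz]]]]]] := data1 (Nb.+1).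
  have := hz k (ltnSn k); rewrite gtop gk mulr0 sub0r normrN zA.
  have : Nb.+1%:R <= N%:R :> R by rewrite ler_nat.
  rewrite -natr1 => hN.
  have N1 : 1 <= N%:R :> R by rewrite ler1n.
  have : N%:R <= `|A%:~R : R| * N%:R ^+ k.+1.
    rewrite exprS mulrCA -{1}[N%:R]mulr1 ler_pM2l ?ltr0n // -[leLHS]mulr1.
    by apply: ler_pM => //; rewrite exprn_ege1.
  lra.
(* [M * th * g k] lies within O(N^-(k + 1)) of [A], so every admissible [th] is that close to
   [th0]. *)
pose th0 := A%:~R / (M%:R * g k).
pose H := M%:R * (F / (M%:R * `|g k|)).
have gR : 0 < `|g k| by rewrite normr_gt0.
have MgR : 0 < M%:R * `|g k| by rewrite mulr_gt0.
have H0 : 0 <= H by rewrite /H mulr_ge0 ?divr_ge0 // ltW.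
have thN N th s (z : nat -> int) : z k = A -> `|M%:R * th * dlk k.+1 (newton k.+1 g) s - (z k)%:~R| * N%:R ^+ k.+1 <= F ->
    `|th - th0| * N%:R ^+ k.+1 <= F / (M%:R * `|g k|).
  move=> zA; rewrite gtop zA ler_pdivlMr //; apply: le_trans.
  have -> : M%:R * th * g k - A%:~R = (th - th0) * (M%:R * g k) by rewrite /th0; field; rewrite gk0 gt_eqF.
  by rewrite !normrM (ger0_norm (ler0n _ _)) mulrAC.
(* The difference of order i + 1 at [s] is [g i] plus integer multiples of the [g j] with j > i,
   which are integral after scaling. Replacing [th] by [th0] costs only O(N^-(i + 1)), because s =
   O(N). *)
have hh i : (i < k.+1)%N -> exists z : int, M%:R * th0 * g i = z%:~R.
  rewrite ltnS => ik; rewrite -(subKn ik); have : (k - i <= k)%N by rewrite leq_subr.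
  elim/ltn_ind: (k - i)%N => {i ik} n IH nk; pose i := (k - n)%N.
  have IH' j : (i < j < k.+1)%N -> exists z : int, M%:R * th0 * g j = z%:~R.
    move=> /andP[ij jk]; rewrite -(subKn (_ : j <= k)%N) //; apply: IH; last by rewrite leq_subr.
    by rewrite ltn_subLR // addnC -ltn_subLR -/i.
  have [zf hzf] : exists zf : nat -> int, forall j, (i < j < k.+1)%N -> M%:R * th0 * g j = (zf j)%:~R.
    have /boolp.choice[zf hzf] : forall j, exists z : int, (i < j < k.+1)%N -> M%:R * th0 * g j = z%:~R.
      by move=> j; case: (boolP (i < j < k.+1)%N) => [/IH'[z hz]|_]; [exists z|exists 0].
    by exists zf.
  apply: int_closed => e e0.
  pose S := \sum_(j < k.+1) `|g j|.
  have S0 : 0 <= S by apply: sumr_ge0.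
  pose B := F + H * S * (Cs + 1) ^+ k.
  have B0 : 0 <= B by apply: addr_ge0 => //; apply: mulr_ge0; [apply: mulr_ge0|apply: exprn_ge0; rewrite addr_ge0].
  have [Nb _ hNb] := natr_above (B / e).
  have [N [NN N0 [th [s [z [hth hs zA hz]]]]]] := data1 Nb.
  have N1 : 1 <= N%:R :> R by rewrite ler1n.
  have NR : 0 < N%:R :> R by rewrite ltr0n.
  have ik : (i < k.+1)%N by rewrite ltnS leq_subr.
  have hi := hz i ik.
  have ht := thN N th s z zA (hz k (ltnSn k)).
  pose w j : R := if (i <= j)%N then ('C(s, j - i))%:R else 0.
  have DE : dlk i.+1 (newton k.+1 g) s = \sum_(j < k.+1) g j * w j.
    by rewrite dlk_newton; apply: eq_bigr => j _; rewrite ltnS subSS.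
  have wN j : (j < k.+1)%N -> 0 <= w j <= ((Cs + 1) * N%:R) ^+ (k - i).
    move=> jk; have q : 1 <= (Cs + 1) * N%:R.
      by rewrite -[leLHS]mulr1; apply: ler_pM => //; rewrite lerDr.
    rewrite /w; case: ifP => ij; last by rewrite lexx exprn_ge0 //; lraw q.
    rewrite ler0n /=; apply: le_trans (_ : s%:R ^+ (j - i) <= _).
      by rewrite -natrX ler_nat binom_le_expn.
    apply: le_trans (_ : ((Cs + 1) * N%:R) ^+ (j - i) <= _).
      rewrite lerXn2r ?nnegrE ?ler0n //; first lraw q.
      by apply: le_trans hs _; rewrite mulrDl mul1r lerDl ler0n.
    by apply: ler_weXn2l => //; rewrite leq_sub2r.
  have diff : `|M%:R * th * dlk i.+1 (newton k.+1 g) s - M%:R * th0 * dlk i.+1 (newton k.+1 g) s| * N%:R ^+ i.+1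
      <= H * S * (Cs + 1) ^+ k.
    rewrite -mulrBl -mulrBr normrM normrM (ger0_norm (ler0n _ _)).
    have b1 : `|dlk i.+1 (newton k.+1 g) s| <= S * ((Cs + 1) * N%:R) ^+ (k - i).
      rewrite DE; apply: le_trans (ler_norm_sum _ _ _) _; rewrite /S mulr_suml.
      apply: ler_sum => j _; rewrite normrM ler_wpM2l //; have /andP[w0 w1] := wN j (ltn_ord j).
      by rewrite ger0_norm.
    apply: le_trans (_ : M%:R * `|th - th0| * (S * ((Cs + 1) * N%:R) ^+ (k - i)) * N%:R ^+ i.+1 <= _).
      by rewrite ler_pM2r ?exprn_gt0 // ler_wpM2l // mulr_ge0.
    have -> : M%:R * `|th - th0| * (S * ((Cs + 1) * N%:R) ^+ (k - i)) * N%:R ^+ i.+1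
       = M%:R * (`|th - th0| * N%:R ^+ k.+1) * S * (Cs + 1) ^+ (k - i).
      have -> : k.+1 = ((k - i) + i.+1)%N by rewrite addnS subnK.
      by rewrite exprMn exprD; ring.
    apply: ler_pM; rewrite ?exprn_ge0 ?mulr_ge0 ?ler0n ?exprn_ge0 ?ler0n ?addr_ge0 //.
      by rewrite ler_wpM2r // /H ler_pM2l.
    by apply: ler_weXn2l; [rewrite lerDr|rewrite leq_subr].
  have tot : `|M%:R * th0 * dlk i.+1 (newton k.+1 g) s - (z i)%:~R| * N%:R ^+ i.+1 <= B.
    apply: le_trans (lerD hi diff); rewrite -mulrDl ler_pM2r ?exprn_gt0 // [leRHS]addrC [X in _ <= X + _]distrC.
    apply: le_trans (ler_normD _ _); rewrite le_eqVlt; apply/orP; left; apply/eqP.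
    by congr (`|_|); ring.
  have totN : `|M%:R * th0 * dlk i.+1 (newton k.+1 g) s - (z i)%:~R| <= e.
    have : B <= e * N%:R by rewrite mulrC -ler_pdivrMr //; apply: le_trans hNb _; rewrite ler_nat.
    move=> hB; rewrite -(ler_pM2r NR); apply: le_trans hB; apply: le_trans tot.
    by rewrite ler_wpM2l // -{1}[N%:R]expr1 ler_weXn2l.
  exists (z i - \sum_(j < k.+1 | (i < j)%N) zf j * ('C(s, j - i))%:Z).
  apply: le_trans totN; rewrite le_eqVlt; apply/orP; left; apply/eqP; rewrite -/i; congr (`|_|).
  have wi : w i = 1 by rewrite /w leqnn subnn bin0.
  rewrite DE [in RHS](bigD1 (Ordinal ik)) //= wi mulr1 mulrDr intrB.
  have -> : M%:R * th0 * (\sum_(j < k.+1 | j != Ordinal ik) g j * w j)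
      = (\sum_(j < k.+1 | (i < j)%N) zf j * ('C(s, j - i))%:Z)%:~R.
    rewrite rmorph_sum /= mulr_sumr [RHS]big_mkcond [LHS]big_mkcond; apply: eq_bigr => j _.
    rewrite /w -(inj_eq val_inj) /= [(i <= j)%N]leq_eqVlt eq_sym; case: eqVneq => [<-|_] /=.
      by rewrite ltnn.
    case: ifP => ij; last by rewrite !mulr0.
    by rewrite mulrA hzf ?ij ?ltn_ord // intrM -pmulrn.
  ring.
have /boolp.choice[h0 hh0] : forall i, exists z : int, (i < k.+1)%N -> M%:R * th0 * g i = z%:~R.
  by move=> i; case: (boolP (i < k.+1)%N) => [/hh[z hz]|_]; [exists z|exists 0].
exists th0, h0; split=> //; last first.
  apply/eqP; rewrite -(eqr_int R) -(hh0 k (ltnSn k)) /th0; apply/eqP; field.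
  by rewrite gk0 gt_eqF.
rewrite leNgt; apply/negP => t0.
have [Nb _ hNb] := natr_above (F / (M%:R * `|g k|) / - th0).
have [N [NN N0 [th [s [z [/andP[hth _] hs zA hz]]]]]] := data1 Nb.+1.
have := thN N th s z zA (hz k (ltnSn k)).
have N1 : 1 <= N%:R :> R by rewrite ler1n.
have NR : 0 < N%:R :> R by rewrite ltr0n.
have tt : 0 < - th0 by rewrite oppr_gt0.
apply/negP; rewrite -ltNge; rewrite ler_pdivrMr // in hNb.
apply: le_lt_trans hNb _; rewrite mulrC.
apply: lt_le_trans (_ : - th0 * N%:R <= _).
  by rewrite ltr_pM2l // ltr_nat.
apply: ler_pM; rewrite ?(ltW tt) ?ler0n //.
  by apply: le_trans (ler_norm _); lraw hth.
by rewrite -{1}[N%:R]expr1 ler_weXn2l.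
Qed.

(* [a k * (1 + 2 * D1 / x)] is eventually nonincreasing, so [a k] is bounded. *)
Lemma top_decay (R : realType) (a : nat -> R -> R) (k : nat) (X C D : R) (N0 : nat) :
  tame k a X C -> (0 < k)%N -> 0 < D ->
  (forall N : nat, (N0 <= N)%N ->
    exists xi, N%:R <= xi <= 2 * N%:R /\ N%:R ^+ k.+1 * `|a k.+1 xi| <= D * a k xi) ->
  exists2 D', 0 < D' & evt (fun x => a k x <= D' /\ x ^+ k.+1 * `|a k.+1 x| <= D').
Proof.
move=> ta k0 D0 data; have C1 := tame_C1 ta.
case: (ta) => [[X1 C0 der pos0] [[_ _ dbl_ noninc] _]].
pose D1 := 4 ^+ k.+1 * (D * C ^+ 2).
have D10 : 0 < D1 by rewrite /D1; pos.
have [Nb _ hNb] := natr_above (X + 1).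
pose Y : R := 2 * (N0 + Nb + 1)%:R + 2 * D1.
have Y1 : 1 <= Y by rewrite /Y; have : 1 <= (N0 + Nb + 1)%:R :> R; [rewrite ler1n addn1|lra].
have XY : X <= Y.
  rewrite /Y !natrD; have := ler0n R N0; lra.
(* With N about x/2 the point [xi] lies to the left of [x], and the monotonicity of [|a k.+1|]
   carries the bound over to [x]. *)
have growth x : Y <= x -> x ^+ k.+1 * `|a k.+1 x| <= D1 * a k x.
  move=> Yx; have x20 : 0 <= x / 2 by lra.
  have [N N1 N2] := floor_nat x20.
  have NN : (N0 + Nb < N.+1)%N.
    rewrite -(ltr_nat R) -natr1; apply: le_lt_trans N2.
    move: Yx; rewrite /Y natrD -/D1; lra.
  have NX : X <= N%:R.
    have : (Nb <= N)%N by rewrite -ltnS; apply: leq_ltn_trans NN; rewrite leq_addl.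
    by rewrite -(ler_nat R) => ?; lra.
  have N01 : (N0 <= N)%N by rewrite -ltnS; apply: leq_ltn_trans NN; rewrite leq_addr.
  have [xi [/andP[xi1 xi2] hxi]] := data N N01.
  have NR : 1 <= N%:R :> R by lra.
  have a1 : `|a k.+1 x| <= `|a k.+1 xi| by apply: noninc; lra.
  have a2 : a k xi <= C * a k (2 * N%:R).
    by apply: (dbl_ k N%:R) => //; apply/andP; split; lra.
  have a3 : a k (2 * N%:R) <= C * a k x.
    by apply: (dbl_ k (2 * N%:R)) => //; first lra; apply/andP; split; lra.
  have a4 : a k xi <= C ^+ 2 * a k x.
    by apply: le_trans a2 _; rewrite expr2 -mulrA ler_pM2l.
  apply: le_trans (_ : (4 * N%:R) ^+ k.+1 * `|a k.+1 xi| <= _).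
    by apply: ler_pM => //; rewrite ?exprn_ge0 // ?lerXn2r ?nnegrE //; lra.
  rewrite exprMn -mulrA /D1 -mulrA ler_pM2l ?exprn_gt0 //.
  by apply: le_trans hxi _; rewrite -mulrA ler_pM2l.
pose psi x := a k x * (1 + 2 * D1 * x^-1).
pose dpsi x := a k x * (2 * D1 * (- (x ^+ 2)^-1)) + (1 + 2 * D1 * x^-1) * a k.+1 x.
have psiD x : Y <= x -> is_derive x 1 psi (dpsi x).
  move=> Yx; have dk := der k x (leqnSn k) (le_trans XY Yx).
  have x0 : x != 0 by rewrite gt_eqF //; lra.
  have dV : is_derive x 1 (fun y : R => y^-1) (- (x ^+ 2)^-1).
    by have := @is_deriveV R id x 1 1 x0 (is_derive_id x 1); rewrite /GRing.scale /= mulr1.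
  have dg : is_derive x 1 (fun y : R => 1 + 2 * D1 * y^-1) (2 * D1 * (- (x ^+ 2)^-1)).
    have := is_deriveD (is_derive_cst (1 : R) x 1) (is_deriveZ (2 * D1) dV).
    by rewrite add0r.
  exact: (@is_deriveM _ _ _ _ _ _ _ _ dk dg).
have psi_dec x : Y <= x -> psi x <= psi Y.
  move=> Yx; rewrite -lerN2.
  apply: (@mono_nonneg R (fun x => - psi x) (fun x => - dpsi x) Y (fun y hy => is_derive_opp_fun (psiD y hy))) => // y Yy.
  have y1 : 1 <= y by lra.
  have gy := growth y Yy.
  have ak : 0 < a k y by apply: pos0 => //; lra.
  have b1 : `|a k.+1 y| * y ^+ 2 <= D1 * a k y.
    by apply: le_trans gy; rewrite mulrC ler_wpM2r // ler_weXn2l.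
  have y2 : 0 < y ^+ 2 by rewrite exprn_gt0 //; lra.
  have b2 : `|a k.+1 y| <= D1 * a k y * (y ^+ 2)^-1 by rewrite ler_pdivlMr.
  have b3 : 2 * D1 * y^-1 <= 1.
    by rewrite ler_pdivrMr ?mul1r; [move: Yy; rewrite /Y natrD; have := ler0n R (N0 + Nb); lra|lra].
  have b4 : 0 <= 2 * D1 * y^-1 by rewrite mulr_ge0 ?invr_ge0 //; lra.
  have b5 := ler_norm (a k.+1 y).
  have b6 : (1 + 2 * D1 * y^-1) * a k.+1 y <= (1 + 2 * D1 * y^-1) * `|a k.+1 y| by rewrite ler_wpM2l //; lra.
  have b7 : (1 + 2 * D1 * y^-1) * `|a k.+1 y| <= 2 * `|a k.+1 y| by rewrite ler_wpM2r //; lra.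
  rewrite oppr_ge0 /dpsi.
  have -> : a k y * (2 * D1 * - (y ^+ 2)^-1) = - (2 * (D1 * a k y * (y ^+ 2)^-1)) by ring.
  by rewrite addrC subr_le0; apply: le_trans b6 (le_trans b7 _); rewrite ler_pM2l.
exists ((1 + D1) * (psi Y)).
  have : 0 < a k Y by apply: pos0 => //.
  move=> aY; have Yp : 0 < Y by lra.
  have : 0 < psi Y by rewrite /psi; clearbody Y D1; pos.
  by move=> ?; clearbody D1; pos.
exists Y => x Yx; have x1 : 0 < x by lra.
have akx : 0 < a k x by apply: pos0 => //; lra.
have h1 : a k x <= psi Y.
  by apply: le_trans (psi_dec x Yx); rewrite /psi mulrDr mulr1 lerDl; clearbody D1; pos.
have h2 := growth x Yx.
have h3 : D1 * a k x <= D1 * psi Y by rewrite ler_pM2l.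
by rewrite mulrDl mul1r; split; nra.
Qed.

Lemma no_hit_windows (R : realType) (a : nat -> R -> R) (k : nat) (X C : R) (r : nat) (color : nat -> 'I_r) :
  tame k a X C -> (0 < k)%N -> (forall c, evt (fun x => c <= a 0%N x)) ->
  ~ (exists x y n : nat, [/\ (0 < x)%N, (0 < y)%N & (0 < n)%N] /\
     [/\ x <> y, color x = color y & (x + y)%:Z = Num.floor (a 0%N n%:R)]) ->
  exists (p M J N0 : nat) (D c1 : R), [/\ (0 < p)%N, (0 < M)%N, 0 < D & 0 < c1] /\
  forall N : nat, (N0 <= N)%N -> exists (th : R) (s l : nat) (P : nat -> int) (c : int),
    [/\ 0 < th <= J%:R, c1 * N%:R <= l%:R, (s + p * l <= N)%N, (forall n, dlk k P n = c) & c != 0] /\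
    (forall m, (m < l)%N -> `|M%:R * th * (a 0%N ((N + s + p * m.+1)%N%:R) - a 0%N ((N + s + p * m)%N%:R))
       - (dl P m)%:~R| <= D / N%:R) /\
    exists xi, [/\ N%:R <= xi <= 2 * N%:R, N%:R ^+ k.+1 * `|a k.+1 xi| <= D * a k xi &
      `|c|%:~R <= D * (1 + a k xi)].
Proof.
move=> ta k0 ainf nos.
have [J [eps [J0 eps0 big]]] := graph_hit ta k0 ainf nos.
have [p [M [L0 [C1 [c [d inv]]]]]] := @inverse_thm R k eps eps0.
have [[p0 M0 _ _ _] _] := inv.
have [|eta [D [c1 [N0 [[/andP[eta0 eta1] D0 c10] win]]]]] := window_inverse inv ta k0 ainf J0 eps0 (eta1 := 1).
  by rewrite ltr01 lexx.
have [|N1 hN1] := big eta; first by rewrite eta0.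
exists p, M, J, (maxn N0 N1), D, c1; split=> // N; rewrite geq_max => /andP[h0 h1].
have [j hj hbig] := hN1 N h1.
have [s [l [P [c' H]]]] := win N h0 j hj hbig.
by eexists; exists s, l, P, c'; exact: H.
Qed.

(** [top_decay] bounds the top derivative, hence the leading coefficient in each window; together
    with the residue modulo [p] it takes finitely many values, and one pair occurs at infinitely
    many scales. *)
Lemma near_polynomial (R : realType) (a : nat -> R -> R) (k : nat) (X C : R) (r : nat) (color : nat -> 'I_r) :
  tame k.+1 a X C -> (forall c, evt (fun x => c <= a 0%N x)) ->
  ~ (exists x y n : nat, [/\ (0 < x)%N, (0 < y)%N & (0 < n)%N] /\
     [/\ x <> y, color x = color y & (x + y)%:Z = Num.floor (a 0%N n%:R)]) ->
  exists (p n0 : nat) (lam D : R) (h : nat -> int), [/\ (0 < p)%N, (0 < n0)%N, 0 < lam, 0 <= D & 0 < h k] /\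
    forall m, `|dl (fun m => a 0%N (n0 + p * m)%N%:R - lam * (newton k.+1 h m)%:~R) m| <= D / m.+1%:R.
Proof.
move=> ta ainf nos.
have [p [M [J [N0 [D [c1 [[p0 M0 D0 c10] data]]]]]]] := no_hit_windows ta (ltn0Sn k) ainf nos.
have [|D2 D20 [Y hY]] := top_decay (N0 := N0) ta (ltn0Sn k) D0.
  by move=> N /data[th [s [l [P [c [_ [_ [xi [h1 h2 _]]]]]]]]]; exists xi.
case: (ta) => [[X1 C0 der pos0] _].
have [B _ hB] := natr_above (D * (1 + D2)).
have [Z Z0 hZ] := natr_above (X + `|Y|).
have ZX : X <= Z%:R by apply: le_trans hZ; rewrite lerDl.
have ZY : Y <= Z%:R by apply: le_trans hZ; rewrite -[leLHS]add0r lerD ?ler_norm //; lraw X1.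
(* The pair holds the residue of [N + s] modulo [p] and the leading coefficient, shifted by [B] into
   the natural numbers. *)
pose Rel (N : nat) (t : 'I_p * 'I_(B + B).+1) : Prop :=
  exists (th : R) (s l : nat) (P : nat -> int),
    [/\ ((N + s) %% p)%N = t.1, 0 < th <= J%:R, c1 * N%:R <= l%:R, (s + p * l <= N)%N &
       (t.2 : nat)%:Z - B%:Z != 0] /\ (forall n, dlk k.+1 P n = (t.2 : nat)%:Z - B%:Z) /\
    (forall m, (m < l)%N -> `|M%:R * th * (a 0%N ((N + s + p * m.+1)%N%:R) - a 0%N ((N + s + p * m)%N%:R))
       - (dl P m)%:~R| <= D / N%:R).
have pig N : (maxn N0 Z <= N)%N -> exists t, Rel N t.
  rewrite geq_max => /andP[h0 h1].
  have [th [s [l [P [c [[hth hl hs hc c0] [hclose [xi [/andP[hx1 hx2] hx3 hx4]]]]]]]]] := data N h0.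
  have cB : (`|c| <= B%:Z).
    rewrite -(ler_int R); apply: le_trans hx4 _; apply: le_trans hB; rewrite ler_pM2l // lerD2l.
    by case: (hY xi) => //; apply: le_trans ZY (le_trans _ hx1); rewrite ler_nat.
  have hcB : (absz (c + B%:Z)%R < (B + B).+1)%N by clear -cB; lia.
  exists (Ordinal (ltn_pmod (N + s) p0), Ordinal hcB); exists th, s, l, P => /=.
  have -> : (absz (c + B%:Z))%:Z - B%:Z = c by clear -cB; lia.
  by rewrite /Rel.
have [[n1 c] hdata] := inf_pigeon pig.
pose A : int := (c : nat)%:Z - B%:Z.
(* A common origin in the chosen residue class: the progressions of all selected windows become
   segments of one progression. *)
pose n0 := (n1 + p * Z)%N.
pose u m : R := a 0%N (n0 + p * m)%N%:R.
have n0Z : (Z <= n0)%N by rewrite /n0; apply: leq_trans (leq_addl _ _); rewrite leq_pmull.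
have n0R : Z%:R <= n0%:R :> R by rewrite ler_nat.
have uE m : u m = a 0%N (n0%:R + p%:R * m%:R) by rewrite /u natrD natrM.
have mvt i m : (i <= k.+2)%N -> exists2 xi, n0%:R + p%:R * m%:R <= xi & dlk i u m = p%:R ^+ i * a i xi.
  move=> ik; have [|i' x i'i hx||xi /andP[h1 _] h2] := @mvt_iter R i a X p%:R _ _ n0%:R m.
  - exact: ler0n.
  - by apply: der => //; apply: leq_trans ik; exact: ltnW.
  - exact: le_trans ZX n0R.
  by exists xi => //; rewrite -h2; apply: eq_dlk => x; exact: uE.
have top m : `|dlk k.+2 u m| <= D2 / m.+1%:R ^+ k.+2.
  have [xi hxi ->] := mvt k.+2 m (leqnn _).
  have pm : p%:R * m.+1%:R <= xi.
    apply: le_trans hxi; rewrite -natrM -natrM -natrD ler_nat mulnS leq_add2r /n0.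
    by apply: leq_trans (leq_addl _ _); rewrite leq_pmulr.
  have Yxi : Y <= xi.
    by apply: le_trans ZY (le_trans n0R (le_trans _ hxi)); rewrite lerDl mulr_ge0.
  have [_ h2] := hY xi Yxi.
  rewrite ler_pdivlMr ?exprn_gt0 ?ltr0n // normrM normrX (ger0_norm (ler0n _ _)) mulrAC -exprMn.
  apply: le_trans h2; rewrite ler_wpM2r // lerXn2r ?nnegrE ?mulr_ge0 //.
  by apply: le_trans pm; rewrite mulr_ge0.
have [g [D' [D'0 hD']]] := newton_expand (ltW D20) top.
have JM : 0 <= 2 * p%:R * M%:R * J%:R * D' :> R by rewrite !mulr_ge0.
have [||||||th [h [th0 hk hg]]] := @newton_integral R k g M J c1 (D + 2 * p%:R * M%:R * J%:R * D') 2 A => //.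
- by have [N _ [th [s [l [P [[_ _ _ _ hA] _]]]]]] := hdata 0%N.
- by apply: addr_ge0 => //; exact: ltW.
- move=> N1; have [N NN [th [s [l [P [[hmod hth hl hs _] [hP hclose]]]]]]] := hdata (maxn N1 (2 * p * Z).+1).
  have [NN1 NN2] : (N1 <= N)%N /\ (2 * p * Z < N)%N by move: NN; rewrite geq_max => /andP[].
  exists N; split=> //; exists th, ((N + s) %/ p - Z)%N, l, P.
  pose s' := ((N + s) %/ p - Z)%N.
  have NR : 0 < N%:R :> R by rewrite ltr0n; apply: leq_ltn_trans NN2.
  have sN : (s <= N)%N by apply: leq_trans hs; rewrite leq_addr.
  have qZ : (Z <= (N + s) %/ p)%N.
    rewrite leq_divRL // mulnC; apply: leq_trans (leq_addr _ _); apply: leq_trans (ltnW NN2).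
    by rewrite -mulnA leq_pmull.
  have E m : (N + s + p * m)%N = (n0 + p * (s' + m))%N.
    rewrite {1}(divn_eq (N + s) p) hmod /n0 /s' /= -{1}(subnK qZ) -/s'; ring.
  split=> //.
    rewrite -natrM ler_nat; apply: leq_trans (leq_subr _ _) _.
    by apply: leq_trans (leq_div _ _) _; rewrite mul2n -addnn leq_add2l.
  move=> m ml; have := hclose m ml; rewrite !E -/(u _) -/(u _) addnS -/s' -/(dl u _) => h1.
  have := hD' (s' + m)%N; rewrite -[dl _ _]/(dlk 1 _ _) dlk_sub /= => h2.
  have s'N : N%:R <= 2 * p%:R * (s' + m).+1%:R :> R.
    rewrite -natrM -natrM ler_nat; apply: leq_trans (_ : (2 * p * s'.+1 <= _)%N); last first.
      by rewrite leq_mul2l ltnS leq_addr orbT.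
    have := ltn_ceil (N + s) p0; have := subnK qZ; rewrite -/s' => <-; clear -NN2 => h; nia.
  have h3 : D' / (s' + m).+1%:R <= 2 * p%:R * D' / N%:R.
    rewrite ler_pdivrMr ?ltr0n // mulrAC ler_pdivlMr // mulrAC [leRHS]mulrC.
    by rewrite [leRHS](_ : _ = D' * (2 * p%:R * (s' + m).+1%:R)); [rewrite ler_wpM2l|ring].
  have -> : M%:R * th * dl (newton k.+1 g) (s' + m)%N - (dl P m)%:~R =
     (M%:R * th * dl u (s' + m)%N - (dl P m)%:~R) - M%:R * th * (dl u (s' + m)%N - dl (newton k.+1 g) (s' + m)%N) by ring.
  apply: le_trans (ler_normB _ _) _; rewrite [leRHS]mulrDl; apply: lerD => //.
  have /andP[t0 t1] := hth.
  rewrite !normrM (ger0_norm (ler0n _ _)) (gtr0_norm t0).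
  have -> : 2 * p%:R * M%:R * J%:R * D' / N%:R = M%:R * J%:R * (2 * p%:R * D' / N%:R) by ring.
  apply: ler_pM; rewrite ?mulr_ge0 ?(ltW t0) //; last exact: le_trans h2 h3.
  by rewrite ler_wpM2l.
have hk0 : h k != 0.
  by rewrite hk; have [N _ [th' [s [l [P [[_ _ _ _ hA] _]]]]]] := hdata 0%N.
have thp : 0 < th.
  rewrite lt_neqAle th0 andbT; apply/eqP => th00; move: hk0.
  by have := hg k (ltnSn k); rewrite -th00 mulr0 mul0r => /esym/eqP; rewrite intr_eq0 => ->.
have MR : 0 < M%:R :> R by rewrite ltr0n.
pose lam := (M%:R * th)^-1.
have lam0 : 0 < lam by rewrite invr_gt0 mulr_gt0.
have gE i : (i < k.+1)%N -> g i = lam * (h i)%:~R.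
  by move=> ik; rewrite -hg // mulKf // gt_eqF // mulr_gt0.
have nE m : newton k.+1 g m = lam * (newton k.+1 h m)%:~R.
  rewrite /newton rmorph_sum /= mulr_sumr; apply: eq_bigr => i _.
  by rewrite gE // intrM mulrA natz.
have hD m : `|dl (fun m => u m - lam * (newton k.+1 h m)%:~R) m| <= D' / m.+1%:R.
  by have := hD' m; rewrite /dl !nE.
exists p, n0, lam, D', h; split; last exact: hD.
split=> //; first exact: leq_trans Z0 n0Z.
rewrite lt_neqAle eq_sym hk0 leNgt; apply/negP => hneg.
(* If [h k < 0], the difference of order k + 1 of [be] is at least [lam], although the increments of
   [be] tend to 0. *)
pose be m := u m - lam * (newton k.+1 h m)%:~R.
have top2 m : lam <= dlk k.+1 be m.
  rewrite /be dlk_sub dlkM (@dlk_intr R k.+1 (newton k.+1 h)).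
  have -> : dlk k.+1 (newton k.+1 h) m = h k.
    rewrite dlk_newton big_ord_recr /= leqnn subnn bin0 mulr1 big1 ?add0r // => j _.
    by rewrite ltnS leqNgt ltn_ord mulr0.
  have [xi hxi ->] := mvt k.+1 m (leqnSn _).
  have : 0 < p%:R ^+ k.+1 * a k.+1 xi.
    rewrite mulr_gt0 ?exprn_gt0 ?ltr0n //; apply: pos0 => //.
    by apply: le_trans (le_trans ZX n0R) (le_trans _ hxi); rewrite lerDl mulr_ge0.
  have : lam * (h k)%:~R <= lam * -1.
    by rewrite ler_pM2l // -[-1]/((-1)%:~R) ler_int; clear -hneg; lia.
  by rewrite mulrN1 => q1 q2; lraw q1 q2.
have [m0 _ hm0] := natr_above (2 ^+ k * D' / (lam / 2)).
have := @dlk_bound R (fun m => be (m0 + m)%N) k (D' / m0.+1%:R) k.+1 _ 0%N (leqnn _).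
rewrite dlk_shift addn0 => hb.
have : lam <= 2 ^+ k * (D' / m0.+1%:R).
  apply: le_trans (top2 m0) (le_trans (ler_norm _) (hb _)) => s _.
  rewrite -[dl _ _]/(dlk 1 _ _) dlk_shift; apply: le_trans (hD (m0 + s)%N) _.
  by rewrite ler_wpM2l // lef_pV2 ?posrE ?ltr0n // ler_nat ltnS leq_addr.
rewrite mulrA ler_pdivlMr ?ltr0n // -natr1; move: hm0; rewrite ler_pdivrMr ?divr_gt0 //.
move: (_ * D') => V; have := ler0n R m0; nra.
Qed.

(** * Integer valued polynomials *)

(** The falling factorial polynomials, a basis adapted to integer valued polynomials. *)
Definition fallp (F : comNzRingType) (i : nat) : {poly F} := \prod_(0 <= j < i) ('X - (j%:R)%:P).

Lemma size_fallp (F : comNzRingType) (i : nat) : size (fallp F i) = i.+1.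
Proof. by rewrite size_prod_XsubC size_iota subn0. Qed.

Lemma monic_fallp (F : comNzRingType) (i : nat) : fallp F i \is monic.
Proof. exact: monic_prod_XsubC. Qed.

Lemma fallp_eval (F : comNzRingType) (i n : nat) : (fallp F i).[n%:R] = (n ^_ i)%:R.
Proof.
elim: i => [|i IH]; first by rewrite /fallp big_geq // hornerE.
rewrite /fallp big_nat_recr //= -/(fallp F i) hornerM IH hornerXsubC ffactnSr natrM.
have [ni|/natrB -> //] := ltnP n i; by rewrite ffact_small // !mul0r.
Qed.

Lemma fallp_int (i : nat) : fallp rat i = map_poly intr (fallp int i).
Proof.
have E j : map_poly intr ('X - (j%:R)%:P) = 'X - (j%:R)%:P :> {poly rat}.
  by rewrite rmorphB /= map_polyX map_polyC /= rmorph_nat.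
by rewrite /fallp rmorph_prod; apply: eq_bigr => j _; rewrite -E.
Qed.

Lemma coef_Xadd1_exp (F : comNzRingType) (i n : nat) : (('X + 1%:P) ^+ i : {poly F})`_n = ('C(i, n))%:R.
Proof.
rewrite addrC exprDn coef_sum; have [ni|ni] := leqP n i; last first.
  rewrite bin_small // big1 // => j _; rewrite expr1n mul1r coefMn coefXn.
  by rewrite gtn_eqF ?mul0rn //; apply: leq_trans ni; rewrite ltn_ord.
rewrite (bigD1 (Ordinal (ni : (n < i.+1)%N))) //= expr1n mul1r coefMn coefXn eqxx big1 ?addr0 // => j jn.
by rewrite expr1n mul1r coefMn coefXn eq_sym; move: jn; rewrite -(inj_eq val_inj) /= => /negbTE ->; rewrite mul0rn.
Qed.

(** With [c] the coefficient of degree k + 1, the difference polynomial [Q] has coefficient (k + 1)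
    c in degree k, so (k + 1)! c is an integer by induction. Subtracting c times a falling factorial
    lowers the degree and keeps the values at natural numbers integral. *)
Lemma int_valued_coef (k : nat) (P : {poly rat}) : (size P <= k.+1)%N ->
  (forall n : nat, P.[n%:R] \is a Num.int) -> exists Z : {poly int}, (k`!)%:R *: P = map_poly intr Z.
Proof.
elim: k P => [|k IH] P sP intP.
  have := intP 0%N; rewrite {1}(size1_polyC sP) hornerC => /intrP[m hm]; exists m%:P.
  by rewrite fact0 scale1r (size1_polyC sP) hm map_polyC.
pose Q := P \Po ('X + 1%:P) - P.
have QE n : Q`_n = \sum_(i < size P) P`_i * ('C(i, n))%:R - P`_n.
  by rewrite coefB coef_comp_poly; congr (_ - _); apply: eq_bigr => i _; rewrite coef_Xadd1_exp.
have cP n : \sum_(i < size P) P`_i * ('C(i, n))%:R = \sum_(i < k.+2) P`_i * ('C(i, n))%:R.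
  rewrite (big_ord_widen _ (fun i => P`_i * ('C(i, n))%:R) sP) [LHS]big_mkcond /=.
  by apply: eq_bigr => i _; case: ltnP => // h; rewrite nth_default ?mul0r.
have sQ : (size Q <= k.+1)%N.
  apply/leq_sizeP => n kn; rewrite QE cP; apply/eqP; rewrite subr_eq0; apply/eqP.
  move: kn; rewrite leq_eqVlt => /orP[/eqP <-|kn].
    rewrite big_ord_recr /= binn mulr1 big1 ?add0r // => i _.
    by rewrite bin_small ?mulr0.
  rewrite nth_default ?(leq_trans sP) // big1 // => i _.
  by rewrite bin_small ?mulr0 //; apply: leq_trans (ltn_ord i) kn.
have intQ n : Q.[n%:R] \is a Num.int.
  rewrite /Q hornerD hornerN horner_comp hornerD hornerX hornerC natr1.
  by rewrite rpredB.
have Qk : Q`_k = k.+1%:R * P`_k.+1.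
  rewrite QE cP !big_ord_recr /= binn big1 ?add0r; last first.
    by move=> i _; rewrite bin_small ?mulr0.
  by rewrite binSn mulr1; ring.
pose c := P`_k.+1.
have [Z1 hZ1] := IH Q sQ intQ.
have cint : (k.+1)`!%:R * c = (Z1`_k)%:~R.
  by have := congr1 (fun p : {poly rat} => p`_k) hZ1; rewrite coefZ Qk coef_map mulrA -natrM mulnC -factS.
pose P2 := P - c *: fallp rat k.+1.
have sP2 : (size P2 <= k.+1)%N.
  apply/leq_sizeP => n kn; rewrite coefB coefZ; move: kn; rewrite leq_eqVlt => /orP[/eqP <-|kn].
    have /monicP := monic_fallp rat k.+1; rewrite lead_coefE size_fallp /= => ->.
    by rewrite mulr1 subrr.
  by rewrite !nth_default ?size_fallp ?mulr0 ?subrr // (leq_trans sP).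
have intP2 n : P2.[n%:R] \is a Num.int.
  rewrite hornerD hornerN hornerZ fallp_eval rpredB // -bin_ffact natrM mulrCA [c * _]mulrC cint rpredM ?rpred_nat //.
  by apply/intrP; exists Z1`_k.
have [Z2 hZ2] := IH P2 sP2 intP2.
exists (k.+1%:R *: Z2 + Z1`_k *: fallp int k.+1).
have -> : P = P2 + c *: fallp rat k.+1 by rewrite subrK.
rewrite scalerDr scalerA cint factS natrM -scalerA hZ2 fallp_int; apply/polyP => i.
by rewrite coef_map !coefD !coefZ !coef_map /= intrD !intrM natz.
Qed.

(* The derivative of the integer valued polynomial [n |-> x (q(r+pn) - q(r))] at
   [n = -r/p] is [x p q'(0)], and its denominator divides [k! p^k]. *)
Lemma linear_coef_bound (q : {poly int}) (k p r : nat) (x : rat) : (size q <= k.+2)%N -> (0 < p)%N ->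
  q`_1 = 1 -> (forall n : nat, x * (q.[(r + p * n)%N%:R] - q.[r%:R])%:~R \is a Num.int) ->
  ((k.+1)`! * p ^ k.+1)%N%:R * x \is a Num.int.
Proof.
move=> sq p0 q1 hx; have pR : p%:R != 0 :> rat by rewrite pnatr_eq0 -lt0n.
pose L : {poly rat} := p%:R *: 'X + (r%:R)%:P.
have LE y : L.[y] = p%:R * y + r%:R by rewrite /L hornerD hornerZ hornerX hornerC.
have qE (n : nat) : (map_poly intr q).[n%:R] = (q.[n%:R])%:~R :> rat by rewrite -(horner_map intr) /= rmorph_nat.
pose P := x *: (map_poly intr q \Po L - ((q.[r%:R])%:~R)%:P).
have sL : (size L <= 2)%N.
  by rewrite /L (leq_trans (size_polyD _ _)) // geq_max (leq_trans (size_scale_leq _ _)) ?size_polyX // size_polyC; case: eqP.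
have sP : (size P <= k.+2)%N.
  apply: leq_trans (size_scale_leq _ _) _; apply: leq_trans (size_polyD _ _) _; rewrite geq_max size_polyN.
  apply/andP; split; last by rewrite (leq_trans (size_polyC_leq1 _)).
  apply: leq_trans (size_comp_poly_leq _ _) _; rewrite ltnS.
  apply: leq_trans (_ : k.+1 * 1 <= _)%N; last by rewrite muln1.
  apply: leq_mul; last by move: sL; case: (size L) => [|[|[]]].
  have : (size (map_poly (intr : int -> rat) q) <= k.+2)%N by apply: leq_trans sq; apply: size_poly.
  by case: (size _).
have [n|Z hZ] := int_valued_coef sP.
  rewrite /P hornerZ hornerD hornerN hornerC horner_comp LE -natrM -natrD addnC qE -intrB.
  exact: hx.
have : ((k.+1)`!%:R *: P)^`().[- r%:R / p%:R] = (map_poly intr Z)^`().[- r%:R / p%:R] by rewrite hZ.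
rewrite /P !derivZ derivB derivC subr0 deriv_comp !hornerZ hornerM horner_comp LE.
have -> : p%:R * (- r%:R / p%:R) + r%:R = 0 :> rat by rewrite mulrC divfK // addNr.
rewrite /L derivD derivZ derivX derivC addr0 hornerZ hornerC mulr1 horner_coef0 coef_deriv mulr1n coef_map /= q1 mul1r deriv_map.
have sZ : (size (map_poly (intr : int -> rat) Z^`()) <= k.+1)%N.
  have sZ2 : (size (map_poly (intr : int -> rat) Z) <= k.+2)%N.
    by rewrite -hZ; apply: leq_trans (size_scale_leq _ _) sP.
  rewrite -deriv_map; have [->|nz] := eqVneq (map_poly (intr : int -> rat) Z) 0; first by rewrite deriv0 size_poly0.
  by rewrite -ltnS; apply: leq_trans sZ2; apply: lt_size_deriv.
move=> E; have -> : ((k.+1)`! * p ^ k.+1)%N%:R * x = p%:R ^+ k * ((k.+1)`!%:R * (x * p%:R)).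
  by rewrite natrM natrX exprS; ring.
rewrite E (horner_coef_wide _ sZ) mulr_sumr; apply: rpred_sum => i _.
rewrite coef_map /= mulrCA rpredM //; first by apply/intrP; eexists.
have -> : p%:R ^+ k = p%:R ^+ (k - i) * p%:R ^+ i :> rat by rewrite -exprD subnK // -ltnS.
by rewrite -mulrA -exprMn [p%:R * _]mulrC divfK // rpredM // ?rpredX ?rpredN ?rpred_nat.
Qed.

(** * The polynomial case *)

(** Indexed like [ders], so that an integer polynomial also gives a [tame] family. *)
Definition polyders (R : realType) (q : {poly int}) (i : nat) (x : R) : R := ((map_poly intr q)^`(i)).[x].

Lemma polyders_nat (R : realType) (q : {poly int}) (n : nat) : polyders q 0 (n%:R : R) = (q.[n%:R])%:~R.
Proof. by rewrite /polyders derivn0 -(horner_map intr) /= rmorph_nat. Qed.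

Lemma polyders_derive (R : realType) (q : {poly int}) (i : nat) (x : R) :
  is_derive x 1 (@polyders R q i) (polyders q i.+1 x).
Proof. by rewrite /polyders derivnS; apply: is_derive_poly. Qed.

Lemma polyders_top (R : realType) (q : {poly int}) (k : nat) (x : R) : size q = k.+1 ->
  polyders q k x = ((k`!)%:R * lead_coef q)%:~R.
Proof.
move=> sq; rewrite /polyders derivn_map.
have -> : q^`(k) = ((k`!)%:R * lead_coef q)%:P.
  apply/polyP => i; rewrite coef_derivn coefC lead_coefE sq; case: i => [|i] /=.
    by rewrite addn0 ffactnn mulr_natl.
  by rewrite nth_default ?mul0rn // sq addnS ltnS leq_addr.
by rewrite map_polyC hornerC.
Qed.

Lemma polyders_gt (R : realType) (q : {poly int}) (k j : nat) (x : R) : size q = k.+1 -> (k < j)%N ->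
  polyders q j x = 0.
Proof.
move=> sq kj; rewrite /polyders derivn_map derivn_poly0 ?sq //.
by rewrite raddf0 horner0.
Qed.

Lemma poly_tame (R : realType) (q : {poly int}) (k : nat) : size q = k.+1 -> 0 < lead_coef q ->
  exists X C, tame k (@polyders R q) X C.
Proof.
move=> sq lq.
have v1 : 1 <= ((k`!)%:R * lead_coef q)%:~R :> R.
  by rewrite ler1z -gtz0_ge1 mulr_gt0 // ltr0n fact_gt0.
have der i : evt (fun x : R => is_derive x 1 (polyders q i) (polyders q i.+1 x)).
  by exists 0 => x _; apply: polyders_derive.
have top c : c <= 1 -> evt (fun x : R => c <= polyders q k x).
  by move=> c1; exists 0 => x _; rewrite (polyders_top _ sq) (le_trans c1).
have z j : (k < j)%N -> forall x : R, polyders q j x = 0.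
  by move=> kj x; apply: polyders_gt sq kj.
apply: (@tame_intro R k (polyders q) 1) => //.
- move=> i ik; have [||c' c'0 [Y hY]] := @growth_iter R (k - i) (fun l => polyders q (i + l)%N) 1 ltr01.
  + by move=> l _; rewrite addnS.
  + by rewrite subnKC //; apply: top.
  exists (Num.max Y 1) => x; rewrite ge_max => /andP[Yx x1]; have := hY x Yx; rewrite addn0.
  by apply: lt_le_trans; rewrite mulr_gt0 // exprn_gt0 //; apply: lt_le_trans x1.
- exact: top.
- by move=> e e0; exists 0 => x _; rewrite z // normr0 ltW.
- by left; exists 0 => x _; rewrite z.
- by left; exists 0 => x _; rewrite z.
Qed.

Lemma poly_to_infty (R : realType) (q : {poly int}) (k : nat) : size q = k.+2 -> 0 < lead_coef q ->
  forall c : R, evt (fun x : R => c <= polyders q 0 x).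
Proof.
move=> sq lq c; have v1 : 1 <= ((k.+1`!)%:R * lead_coef q)%:~R :> R.
  by rewrite ler1z -gtz0_ge1 mulr_gt0 // ltr0n fact_gt0.
have [||c' c'0 [Y hY]] := @growth_iter R k.+1 (polyders q) 1 ltr01.
- by move=> i _; exists 0 => x _; apply: polyders_derive.
- by exists 0 => x _; rewrite (polyders_top _ sq).
exists (Num.max Y (Num.max 1 (c / c'))) => x; rewrite !ge_max => /and3P[Yx x1 cx].
apply: le_trans (hY x Yx); apply: le_trans (_ : c' * x <= _).
  by rewrite mulrC -ler_pdivrMr.
by rewrite ler_pM2l // -{1}[x]expr1 ler_weXn2l.
Qed.

Lemma poly_bound (R : realType) (P : {poly R}) (k : nat) : (size P <= k.+1)%N ->
  exists2 A : R, 0 < A & forall x, 1 <= x -> `|P.[x]| <= A * x ^+ k.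
Proof.
move=> sP; pose S := \sum_(i < k.+1) `|P`_i|.
have S0 : 0 <= S by apply: sumr_ge0.
exists (S + 1); first lraw S0.
move=> x x1; have x0 : 0 <= x by lraw x1.
apply: le_trans (_ : S * x ^+ k <= _); last by rewrite ler_wpM2r ?exprn_ge0 // lerDl.
rewrite (horner_coef_wide _ sP) /S mulr_suml; apply: le_trans (ler_norm_sum _ _ _) _.
apply: ler_sum => i _; rewrite normrM ler_wpM2l // ger0_norm ?exprn_ge0 //.
by apply: ler_weXn2l => //; rewrite -ltnS.
Qed.

Lemma dlk_zero (V : zmodType) (k : nat) (Z : nat -> V) (l : nat) : (k <= l)%N ->
  (forall n, dlk k.+1 Z n = 0) -> (forall m, (m < l)%N -> dl Z m = 0) -> forall n, Z n = Z 0%N.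
Proof.
elim: k => [|k IH] kl hZ h0; first exact: dl0_const.
apply: IH => //; first exact: ltnW.
move=> n; rewrite (dl0_const (g := dlk k.+1 Z)) //.
have gen i m : (m + i < l)%N -> dlk i.+1 Z m = 0.
  elim: i m => [|i IHi] m mi; first by apply: h0; rewrite -(addn0 m).
  by rewrite dlkS {1}/dl !IHi ?subrr ?addSn -?addnS //; apply: leq_trans mi; rewrite addnS.
exact: gen.
Qed.

(** At integer values the frequencies j/T and (T - j)/T give conjugate sums, so j/T <= 1/2 may be
    assumed. *)
Lemma expsum_fold (R : realType) (T K j : nat) (U : nat -> int) : (0 < T)%N -> (j <= T)%N ->
  nc (expsum (fun m => (T - j)%:R * ((U m)%:~R / T%:R) : R) K) = nc (expsum (fun m => j%:R * ((U m)%:~R / T%:R) : R) K).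
Proof.
move=> T0 jT; rewrite -[RHS]nc_conj -expsumN; congr nc; rewrite /expsum; apply: eq_bigr => m _.
rewrite natrB // -[RHS](eeDint _ (U m)); congr ee; field.
by rewrite pnatr_eq0 -lt0n.
Qed.

(* If the sum is large at [j/T], the inverse theorem gives a fraction [th'] with
   [M th' q] integer valued, up to a constant, on a progression; then [Q0 th']
   is an integer, so that [th' q(t)] is linear in [t] modulo 1. *)
Lemma poly_sum_small (R : realType) (k : nat) (eps : R) : 0 < eps -> exists2 Q0 : nat, (0 < Q0)%N &
  forall q s : {poly int}, q = 'X + Q0%:R *: s -> q`_1 = 1 -> size q = k.+2 -> 0 < lead_coef q ->
  forall eta1 : R, 0 < eta1 <= 1 -> exists (eta : R) (N0 : nat), 0 < eta <= eta1 /\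
  forall N, (N0 <= N)%N ->
  let K := Num.truncn (eta * N%:R) in
  let U (m : nat) : int := q.[(N + m)%N%:R] - q.[N%:R] in
  let T := (absz (U K)).+1 in
  forall j, (0 < j < T)%N -> nc (expsum (fun m => j%:R * ((U m)%:~R / T%:R) : R) K) <= eps * K%:R.
Proof.
move=> eps0; have [p [M [L0 [C1 [c0 [d inv]]]]]] := @inverse_thm R k.+1 eps eps0.
have [[p0 M0 _ _ _] _] := inv.
(* By [linear_coef_bound] the factor (k + 1)! p^(k + 1) clears the denominator of c/v; the factor M
   is the one in th' = c/(M v). *)
exists ((k.+1)`! * p ^ k.+1 * M)%N; first by rewrite !muln_gt0 fact_gt0 expn_gt0 p0.
set Q0 := (_ * M)%N => q s qE q1 sq lq eta1 heta1.
have Q0p : (0 < Q0)%N by rewrite !muln_gt0 fact_gt0 expn_gt0 p0.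
have [X [C ta]] := @poly_tame R q k.+1 sq lq.
have ainf := @poly_to_infty R q k sq lq.
have [eta [D [c1 [N0 [[/andP[eta0 etale] D0 c10] win]]]]] := window_inverse inv ta (ltn0Sn k) ainf (ltn0Sn 0) eps0 heta1.
have eta1' : eta <= 1 by apply: le_trans etale _; case/andP: heta1.
have sq1 : (size ((map_poly (intr : int -> R) q)^`(1)) <= k.+1)%N.
  rewrite derivn1; have sm : (size (map_poly (intr : int -> R) q) <= k.+2)%N by rewrite -sq; apply: size_poly.
  have [->|nz] := eqVneq (map_poly (intr : int -> R) q) 0; first by rewrite deriv0 size_poly0.
  by rewrite -ltnS; apply: leq_trans sm; apply: lt_size_deriv.
have [A A0 hA] := poly_bound sq1.
have step (n i : nat) : (0 < n)%N -> `|(q.[(n + i)%N%:R] - q.[n%:R])%:~R : R| <= i%:R * (A * (n + i)%N%:R ^+ k).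
  move=> n0; have [xi /andP[x1 x2] ->] : exists2 xi : R, n%:R <= xi <= (n + i)%N%:R &
      (q.[(n + i)%N%:R] - q.[n%:R])%:~R = polyders q 1 xi * ((n + i)%N%:R - n%:R).
    rewrite intrB -!polyders_nat; apply: mvt_closed => [|x _]; first by rewrite ler_nat leq_addr.
    exact: polyders_derive.
  rewrite natrD addrAC subrr add0r normrM (ger0_norm (ler0n _ _)) mulrC ler_wpM2l //.
  have n1 : 1 <= n%:R :> R by rewrite ler1n.
  apply: le_trans (hA xi (le_trans n1 x1)) _; rewrite ler_pM2l // -natrD lerXn2r ?nnegrE //.
  by apply: le_trans x1; rewrite ler0n.
pose v : int := (p ^ k.+1)%N%:R * ((k.+1`!)%:R * lead_coef q).
have v0 : 0 < v by rewrite /v !mulr_gt0 // ltr0n ?expn_gt0 ?p0 ?fact_gt0.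
have v1 : 1 <= v%:~R :> R by rewrite ler1z -gtz0_ge1.
have [E E0 small] := @poly_small R k.+1.
have [c1i c1k] : 0 < c1^-1 /\ 0 < c1 ^+ k by rewrite invr_gt0 exprn_gt0.
pose F := E * D / c1 ^+ k.
have F0 : 0 < F by rewrite /F divr_gt0 ?mulr_gt0.
pose B0 := F * (p%:R * (A * 2 ^+ k)) + v%:~R * D.
have B00 : 0 <= B0.
  rewrite /B0; apply: addr_ge0; last by apply: mulr_ge0; [apply: le_trans v1|exact: ltW].
  by rewrite mulr_ge0 ?(ltW F0) // mulr_ge0 ?ler0n // mulr_ge0 ?(ltW A0) ?exprn_ge0.
pose B1 := F * (A * 2 ^+ k).
have B10 : 0 <= B1 by rewrite /B1 mulr_ge0 ?(ltW F0) // mulr_ge0 ?(ltW A0) ?exprn_ge0.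
pose B2 := (2 + 8 * B1) * (8 * Q0%:R) / eps.
have B20 : 0 <= B2 by rewrite /B2 divr_ge0 ?mulr_ge0 ?(ltW eps0) ?ler0n //; lraw B10.
have [Nb _ hNb] := natr_above (`|X| + B0 + 8 * F + k.+2%:R / c1 + (B2 + 1) / eta + 2).
exists eta, (maxn N0 Nb); split; first by rewrite eta0.
move=> N; rewrite geq_max => /andP[hN0 hN]; lazy zeta.
pose K := Num.truncn (eta * N%:R); rewrite -/K.
pose U (m : nat) : int := q.[(N + m)%N%:R] - q.[N%:R].
pose T := (absz (U K)).+1.
(* The reduction to j/T <= 1/2 places the limiting slope [th'] in the range of [ee_sub1_ge]. *)
suff main j : (0 < j)%N -> (2 * j <= T)%N -> nc (expsum (fun m => j%:R * ((U m)%:~R / T%:R) : R) K) <= eps * K%:R.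
  move=> j /andP[j0 jT]; rewrite -/T; have [h|h] := leqP (2 * j) T; first exact: main.
  rewrite -(@expsum_fold R T K j U) //; last exact: ltnW.
  by move: jT h; rewrite -/(U K) -/T; move: main; clearbody T => main jT h; apply: main; clear -jT h j0; lia.
move=> j0 jT; rewrite leNgt; apply/negP => big.
have {hNb hN} : `|X| + B0 + 8 * F + k.+2%:R / c1 + (B2 + 1) / eta + 2 <= N%:R by apply: le_trans hNb _; rewrite ler_nat.
have p1 : 0 <= k.+2%:R / c1 :> R by rewrite divr_ge0 // ltW.
have p2 : 0 <= (B2 + 1) / eta :> R by rewrite divr_ge0 ?(ltW eta0) //; lraw B20.
have p3 := ler_norm X; have p4 := normr_ge0 X.
move=> hN; have [n1 n2 n3 [n4 n5 n6]] : [/\ X <= N%:R, B0 < N%:R, 8 * F <= N%:R &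
    [/\ k.+2%:R / c1 <= N%:R, (B2 + 1) / eta < N%:R & 1 <= N%:R :> R]].
  by clear -hN B00 F0 p1 p2 p3 p4; split; last split; lra.
have NR : 0 < N%:R :> R by lraw n6.
have N0' : (0 < N)%N by rewrite -(ltr_nat R).
have KN : K%:R <= eta * N%:R by rewrite truncn_le mulr_ge0 // ltW.
have KN1 : K%:R <= N%:R :> R by apply: le_trans KN _; rewrite -[leRHS]mul1r ler_pM2r.
have KN2 : (K <= N)%N by rewrite -(ler_nat R).
have incE m : incr (polyders q 0) N m = (U m)%:~R :> R.
  by rewrite /incr -natrD !polyders_nat -intrB.
have TE : (Num.truncn (incr (@polyders R q 0) N K)).+1 = T.
  rewrite incE /T; congr S; have UK : 0 <= U K.
    rewrite -(ler_int R) -incE /incr subr_ge0; apply: (tame_mono ta (ltn0Sn k)) => //.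
    by rewrite lerDl ler0n.
  by rewrite -{1}(gez0_abs UK) -pmulrn natrK.
have T0 : (0 < T)%N by [].
have [||r [l [P [c [[/andP[th0 _] hl hr hP c_neq0] [hclose _]]]]]] := win N hN0 j.
- by rewrite TE mul1n j0 /=; apply: leq_trans jT; clear -j0; lia.
- rewrite -/K TE; suff -> : expsum (fun m => j%:R * (incr (@polyders R q 0) N m / T%:R)) K
     = expsum (fun m => j%:R * ((U m)%:~R / T%:R) : R) K by [].
  by apply: eq_expsum => m _; rewrite incE.
move: th0; rewrite TE in hclose *; set th : R := j%:R / T%:R in hclose *; move=> th0.
have th12 : th <= 1 / 2.
  by rewrite /th ler_pdivrMr ?ltr0n // mulrC mul1r ler_pdivlMr // mulrC -natrM ler_nat.
pose W m : int := q.[(N + r + p * m)%N%:R].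
have hW m : dlk k.+1 W m = v.
  apply/eqP; rewrite -(eqr_int R) -(@dlk_intr R); apply/eqP.
  have [|i x _ _||xi _ hxi] := @mvt_iter R k.+1 (@polyders R q) 0 p%:R _ _ (N + r)%N%:R m; rewrite ?ler0n //.
    exact: polyders_derive.
  rewrite (polyders_top _ sq) in hxi.
  rewrite /v intrM [((p ^ _)%:R)%:~R](_ : _ = p%:R ^+ k.+1); last by rewrite rmorph_nat natrX.
  by rewrite -hxi; apply: eq_dlk => x; rewrite /W -natrM -natrD polyders_nat.
pose Qf m : R := M%:R * th * (W m)%:~R - (P m)%:~R.
have QfE i m : dlk i Qf m = M%:R * th * (dlk i W m)%:~R - (dlk i P m)%:~R.
  by rewrite (dlk_sub _ (fun m => M%:R * th * (W m)%:~R)) dlkM !(@dlk_intr R i).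
have hQf n : dlk k.+2 Qf n = 0.
  by rewrite QfE (dlkS k.+1 W) (dlkS k.+1 P) /dl !hW !hP !subrr mulr0 subr0.
have lk : (k.+1 < l)%N.
  rewrite -(ltr_nat R); apply: lt_le_trans hl; rewrite ler_pdivrMr // mulrC in n4.
  by apply: lt_le_trans n4; rewrite ltr_nat.
have dQf m : (m < l)%N -> `|dl Qf m| <= D / N%:R.
  move=> ml; have := hclose m ml; rewrite !polyders_nat -/(W _) -/(W _) -intrB.
  by rewrite -[dl Qf m]/(dlk 1 Qf m) QfE.
have NK0 : 0 < N%:R ^+ k.+1 :> R by rewrite exprn_gt0.
have topQ : `|M%:R * th * v%:~R - c%:~R| <= F / N%:R ^+ k.+1.
  have := small Qf (D / N%:R) l lk hQf dQf k (ltnSn k); rewrite QfE hW hP => h.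
  rewrite ler_pdivlMr // /F ler_pdivlMr //; set V := `|_| in h *.
  have hck : (c1 * N%:R) ^+ k <= l%:R ^+ k by rewrite lerXn2r ?nnegrE ?mulr_ge0 ?ler0n // ltW.
  have := le_trans (ler_wpM2l (normr_ge0 _ : 0 <= V) hck) h; rewrite mulrA ler_pdivlMr //; apply: le_trans.
  by rewrite le_eqVlt; apply/orP; left; apply/eqP; rewrite exprMn exprS; ring.
(* Increments of [Z] are integers of absolute value below 1, first on the window and then everywhere
   by degree. Hence [c * W / v] equals the integer valued [P] up to a constant. *)
pose Z m := c * W m - v * P m.
have dZ m : (m < l)%N -> dl Z m = 0.
  move=> ml; have dZE : (dl Z m)%:~R = v%:~R * dl Qf m - (M%:R * th * v%:~R - c%:~R) * (dl W m)%:~R :> R.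
    rewrite -[dl Qf m]/(dlk 1 Qf m) QfE /= /Z /dl !intrB !intrM; ring.
  have dW : `|(dl W m)%:~R : R| <= p%:R * (A * 2 ^+ k) * N%:R ^+ k.
    have := step (N + r + p * m)%N p; rewrite /dl /W mulnS addnA [(N + r + p + p * m)%N]addnAC => h.
    apply: le_trans (h _) _; first by rewrite -addnA addn_gt0 N0'.
    rewrite -!mulrA ler_wpM2l // ler_pM2l // -exprMn lerXn2r ?nnegrE ?mulr_ge0 ?ler0n //.
    rewrite -natrM ler_nat mul2n -addnn -!addnA leq_add2l; apply: leq_trans hr; rewrite leq_add2l.
    by rewrite -mulnSr leq_mul2l ml orbT.
  apply/eqP; rewrite -absz_eq0 -leqn0 -ltnS -(ltr_nat R) natr_absz intr_norm dZE.
  apply: le_lt_trans (ler_normB _ _) _; rewrite !normrM (ger0_norm (le_trans ler01 v1)).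
  apply: le_lt_trans (_ : v%:~R * (D / N%:R) + F / N%:R ^+ k.+1 * (p%:R * (A * 2 ^+ k) * N%:R ^+ k) < _).
    apply: lerD; first by rewrite ler_wpM2l ?dQf // (le_trans ler01).
    by apply: ler_pM.
  rewrite [X in X < _](_ : _ = B0 / N%:R); last by rewrite /B0 exprS; field; rewrite gt_eqF // gt_eqF // exprn_gt0.
  by rewrite ltr_pdivrMr // mul1r.
have cZ n : Z n = Z 0%N.
  apply: (@dlk_zero _ k.+1 Z l) => //; first exact: ltnW.
  move=> n'; have := dlk_sub k.+2 (fun m => c * W m) (fun m => v * P m) n'.
  by rewrite !dlkM (dlkS k.+1 W) (dlkS k.+1 P) /dl !hW !hP !subrr !mulr0 subrr.
pose x : rat := c%:~R / v%:~R.
have vr : v%:~R != 0 :> rat by rewrite intr_eq0 gt_eqF.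
have xint : ((k.+1)`! * p ^ k.+1)%N%:R * x \is a Num.int.
  apply: (@linear_coef_bound q k p (N + r) x) => //; first by rewrite sq.
  move=> n; apply/intrP; exists (P n - P 0%N).
  have := cZ n; rewrite /Z /W muln0 addn0 => h.
  apply: (mulfI vr); rewrite /x mulrA mulrCA divff // mulr1 -!intrM; congr (_%:~R).
  by rewrite !mulrBr; move: h; clear; move=> h; 
  rewrite [LHS](_ : _ = c * q.[(N + r + p * n)%:R] - v * P n + v * P n - c * q.[(N + r)%:R]); [rewrite h|]; ring.
have /intrP[z hz] := xint.
pose th' : R := c%:~R / (M%:R * v%:~R).
have MR : 1 <= M%:R :> R by rewrite ler1n.
have Mv : 1 <= M%:R * v%:~R :> R by rewrite -[leLHS]mulr1 ler_pM.
have thz : Q0%:R * th' = z%:~R.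
  have := congr1 (fun y : rat => ratr y : R) hz; rewrite ratr_int => <-.
  rewrite /x (rmorphM (@ratr R)) (rmorph_nat (@ratr R)) (fmorph_div (@ratr R)) /= !ratr_int /th' /Q0 natrM.
  by field; rewrite intr_eq0 !gt_eqF // ltr0n.
have z0 : z != 0.
  apply/eqP => z0; move: thz; rewrite z0 => /eqP; rewrite mulf_eq0 pnatr_eq0 -leqn0 leqNgt Q0p /= /th' mulf_eq0 intr_eq0 (negbTE c_neq0) /= invr_eq0.
  by rewrite gt_eqF //; lraw Mv.
have thth : `|th - th'| <= F / N%:R ^+ k.+1.
  have Mv0 : 0 < M%:R * v%:~R :> R by lraw Mv.
  have e : M%:R * th * v%:~R - c%:~R = (th - th') * (M%:R * v%:~R).
    by rewrite /th' mulrBl divfK ?gt_eqF //; ring.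
  by apply: le_trans topQ; rewrite e normrM (gtr0_norm Mv0) -{1}[`|_|]mulr1 ler_wpM2l.
(* The subtracted term is an integer, and it removes [th' * Q0 * s], leaving a phase of slope close
   to [th']. *)
pose g m : R := j%:R * ((U m)%:~R / T%:R) - (z * s.[(N + m)%N%:R])%:~R.
have sumg : expsum g K = expsum (fun m => j%:R * ((U m)%:~R / T%:R) : R) K.
  by rewrite /expsum; apply: eq_bigr => m _; rewrite /g -mulrNz eeDint.
have dg m : (m < K)%N -> `|dl g m - th'| <= B1 / N%:R.
  move=> mK.
  pose dq : R := (q.[(N + m + 1)%N%:R] - q.[(N + m)%N%:R])%:~R.
  have dqE : dq = 1 + Q0%:R * (s.[(N + m + 1)%N%:R] - s.[(N + m)%N%:R])%:~R.
    rewrite /dq qE !(hornerD, hornerZ, hornerX) !intrB !intrD !intrM !rmorph_nat natrD; ring.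
  have -> : dl g m - th' = (th - th') * dq.
    rewrite mulrBl {2}dqE mulrDr mulr1 mulrA [th' * Q0%:R]mulrC thz.
    have alg (t t' y u w e s1 s2 : R) : t * (u - e) - y * s1 - (t * (w - e) - y * s2) - t' = t * (u - w) - (t' + y * (s1 - s2)).
      by ring.
    have fE i : j%:R * ((U i)%:~R / T%:R) = th * (U i)%:~R :> R by rewrite mulrA mulrAC.
    by rewrite /dl /g !fE /U -[m.+1]addn1 addnA /dq !intrB !intrM; exact: alg.
  rewrite normrM; have := step (N + m)%N 1%N; rewrite -/dq mul1r => h.
  apply: le_trans (ler_pM _ _ thth (h _)) _ => //; first by rewrite addn_gt0 N0'.
  have NN : (N + m + 1)%N%:R <= 2 * N%:R :> R.
    by rewrite -natrM ler_nat mul2n -addnn -addnA leq_add2l addn1; apply: leq_trans KN2.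
  apply: le_trans (_ : F / N%:R ^+ k.+1 * (A * (2 * N%:R) ^+ k) <= _).
    apply: ler_wpM2l; first by rewrite divr_ge0 ?(ltW F0) ?(ltW NK0).
    by rewrite ler_pM2l // lerXn2r ?nnegrE ?mulr_ge0 ?ler0n.
  by rewrite le_eqVlt; apply/orP; left; apply/eqP; rewrite /B1 exprMn exprS; field; rewrite gt_eqF // gt_eqF // exprn_gt0.
have := expsum_linear dg; rewrite sumg => hlin.
have NN1 : F / N%:R ^+ k.+1 <= 1 / 8.
  rewrite ler_pdivrMr // mulrC mul1r ler_pdivlMr // mulrC; apply: le_trans n3 _.
  by rewrite -{1}[N%:R]expr1 ler_weXn2l.
have thb : `|th'| <= 7 / 8.
  have := ler_normB th (th - th'); rewrite opprB addrC subrK (gtr0_norm th0) => h.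
  by clear -h thth NN1 th12; lra.
have th'lo : 1 <= Q0%:R * `|th'|.
  by rewrite -(ger0_norm (ler0n R Q0)) -normrM thz -intr_norm ler1z -gtz0_ge1 normr_gt0.
have eelo := ee_sub1_ge thb.
(* As [z] is nonzero, [th'] is at least 1/Q0 in absolute value, so a sum of almost constant slope
   [th'] is bounded, and with it [K]. *)
have KB : K%:R <= B2.
  rewrite /B2 ler_pdivlMr // mulrC; set S := nc (expsum _ K) in big hlin.
  have S0 : 0 <= eps * K%:R by rewrite mulr_ge0 ?ler0n // ltW.
  have h1 : 8 * (B1 / N%:R) * K%:R <= 8 * B1.
    by rewrite -mulrA ler_pM2l // mulrAC ler_pdivrMr // ler_wpM2l.
  have h2 : `|th'| / 8 * (eps * K%:R) <= 2 + 8 * B1.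
    apply: le_trans (_ : nc (ee th' - 1) * S <= _); last by clear -h1 hlin; lra.
    by apply: ler_pM => //; first [by rewrite divr_ge0|exact: ltW].
  apply: le_trans (_ : Q0%:R * `|th'| * (eps * K%:R) <= _); first by rewrite -{1}[eps * _]mul1r ler_wpM2r.
  have -> : Q0%:R * `|th'| * (eps * K%:R) = `|th'| / 8 * (eps * K%:R) * (8 * Q0%:R) by field.
  by rewrite ler_wpM2r // mulr_ge0.
have /andP[_] := truncn_itv (mulr_ge0 (ltW eta0) (ltW NR)); rewrite -/K -natr1 => h.
rewrite ltr_pdivrMr // mulrC in n5.
by clear -h KB n5; lra.
Qed.

(** * Fractional parts in the first half of the unit interval *)

Lemma Re_Im_le (R : rcfType) (z : R[i]) : `|complex.Re z| <= nc z /\ `|complex.Im z| <= nc z.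
Proof.
have := nc_sqr z; have := nc_ge0 z; set n := nc z; case: z @n => x y n n0 /= e.
have hx := sqr_ge0 x; have hy := sqr_ge0 y.
by split; rewrite -(ler_pXn2r (_ : (0 < 2)%N)) ?nnegrE // real_normK ?num_real // e; [rewrite lerDl|rewrite lerDr].
Qed.

(** Two fractional parts in [1/16, 7/16] add up to a number in [1/8, 7/8]: no carry, and a margin of
    1/8 on both sides. *)
Definition good (R : realType) (y : R) : bool := `[< exists z : int, z%:~R + 1 / 16 <= y <= z%:~R + 7 / 16 >].

Lemma sin_good (R : realType) (y : R) : 1 / 2 <= complex.Im (ee y) -> good y.
Proof.
move=> hy; apply/asboolP; exists (Num.floor y); set z := Num.floor y.
have /andP[z1 z2] := floor_itv y; rewrite -/z in z1 z2; rewrite intrD1 in z2.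
pose f := y - z%:~R; have f0 : 0 <= f by rewrite /f; lraw z1.
have f1 : f < 1 by rewrite /f; lraw z2.
have yE : y = f + z%:~R by rewrite /f subrK.
have : 1 / 2 <= sin (2 * pi * f) by rewrite -Im_ee -(eeDint f z) -yE.
have [_ pi4] := pi_bounds R; have pi0 : 0 < pi :> R := pi_gt0 R.
move=> hs.
(* The margins 1/16 result from sin t <= t and pi <= 4. *)
suff : 1 / 16 <= f <= 7 / 16 by rewrite yE => /andP[h1 h2]; apply/andP; split; [lraw h1|lraw h2].
apply/andP; split; rewrite leNgt; apply/negP => hf.
  have : sin (2 * pi * f) <= 2 * pi * f by apply: sin_le_id; rewrite !mulr_ge0 // ltW.
  have : 2 * pi * f <= 2 * 4 * f by rewrite ler_wpM2r // ler_pM2l.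
  by move=> h1 h2; have h3 := le_trans hs (le_trans h2 h1); lraw hf h3.
have [h|h] := leP f (1 / 2).
  have e : sin (2 * pi * f) = sin (2 * pi * (1 / 2 - f)).
    rewrite [2 * pi * (1 / 2 - f)](_ : _ = - (2 * pi * f) + pi); last by field.
    by rewrite sinDpi sinN opprK.
  have g0 : 0 <= 1 / 2 - f by lraw h.
  have : sin (2 * pi * (1 / 2 - f)) <= 2 * pi * (1 / 2 - f) by apply: sin_le_id; rewrite !mulr_ge0 // ltW.
  have : 2 * pi * (1 / 2 - f) <= 2 * 4 * (1 / 2 - f) by rewrite ler_wpM2r // ler_pM2l.
  by rewrite e in hs => h1 h2; have h3 := le_trans hs (le_trans h2 h1); lraw hf h3.
have : 0 <= sin (2 * pi * (f - 1 / 2)).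
  apply: sin_ge0_pi; apply/andP; split.
    by rewrite !mulr_ge0 // ?ltW // subr_gt0.
  rewrite [leLHS](_ : _ = pi * (2 * f - 1)); last by field.
  by rewrite -[leRHS]mulr1 ler_pM2l //; lraw f1.
have e : sin (2 * pi * f) = - sin (2 * pi * (f - 1 / 2)).
  rewrite [2 * pi * f](_ : _ = 2 * pi * (f - 1 / 2) + pi); last by field.
  by rewrite sinDpi.
by rewrite e in hs => h1; lraw hs h1.
Qed.

(* With [s = sin (2 pi f)] the left-hand side is [(s + 1)^2 (s - 1/2)]. *)
Lemma trig_minorant (R : realType) (f : R) :
  1 / 4 + 3 / 4 * complex.Im (ee f) - 1 / 4 * complex.Im (ee (3 * f)) - 3 / 4 * complex.Re (ee (2 * f))
  <= 2 * (good f)%:R.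
Proof.
rewrite -!eeX; case E: (ee f) => [c s]; rewrite !exprS expr0 /=.
have sc : c ^+ 2 + s ^+ 2 = 1.
  by have := nc_sqr (ee f); rewrite nc_ee expr1n E.
have s1 : s <= 1 by have := sqr_ge0 c; have := sqr_ge0 (s - 1); nra.
have s2 : -1 <= s by have := sqr_ge0 c; have := sqr_ge0 (s + 1); nra.
rewrite [leLHS](_ : _ = (s + 1) ^+ 2 * (s - 1 / 2) - 3 / 4 * (s + 1) * (c ^+ 2 + s ^+ 2 - 1)); last by field.
rewrite sc subrr mulr0 subr0; have [h|h] := leP (1 / 2) s.
  by rewrite (@sin_good _ f) ?E // mulr1; nra.
apply: le_trans (_ : 0 <= _); last by rewrite mulr_ge0 ?ler0n.
by rewrite nmulr_lle0 ?sqr_ge0 //; lraw h.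
Qed.

(** Summing the minorant, its constant term gives L/4, while the three frequencies contribute
    bounded geometric sums. So about L/8 points are good, and eventually L/16. *)
Lemma good_density (R : realType) (phi : R) : (forall h : nat, (0 < h <= 3)%N -> ee (h%:R * phi) != 1) ->
  exists L0 : nat, forall (L : nat) (psi : R), (L0 <= L)%N ->
    (L <= 16 * #|[pred x : 'I_L | good (phi * (x : nat).+1%:R + psi)]|)%N.
Proof.
move=> hphi.
have bnd h : (0 < h <= 3)%N -> exists2 C : R, 0 < C & forall (L : nat) (psi : R),
    nc (\sum_(x < L) ee (h%:R * (phi * (x : nat).+1%:R + psi))) <= C.
  move=> hh; have := hphi h hh; set s := h%:R * phi => hs.
  have d0 : 0 < nc (ee s - 1).
    by rewrite lt_neqAle nc_ge0 andbT eq_sym; apply: contra hs => /eqP/nc_eq0/eqP; rewrite subr_eq0.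
  exists (2 / nc (ee s - 1)); first by rewrite divr_gt0.
  move=> L psi; rewrite ler_pdivlMr //.
  have -> : \sum_(x < L) ee (h%:R * (phi * (x : nat).+1%:R + psi)) = ee (s + h%:R * psi) * \sum_(x < L) ee ((x : nat)%:R * s).
    rewrite mulr_sumr; apply: eq_bigr => x _; rewrite -eeD; congr ee; rewrite /s -[x.+1%:R]natr1; ring.
  rewrite ncM nc_ee mul1r mulrC -ncM geom_sum; apply: le_trans (ncD _ _) _.
  by rewrite ncN nc_ee nc1.
have [C1 C10 h1] := bnd 1%N isT; have [C2 C20 h2] := bnd 2%N isT; have [C3 C30 h3] := bnd 3%N isT.
have [L0 _ hL0] := natr_above (16 * (C1 + C2 + C3)); exists L0 => L psi LL.
have hL : 16 * (C1 + C2 + C3) <= L%:R by apply: le_trans hL0 _; rewrite ler_nat.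
rewrite -(ler_nat R) natrM; pose f (x : 'I_L) := phi * (x : nat).+1%:R + psi.
have GE : #|[pred x : 'I_L | good (f x)]|%:R = \sum_(x < L) (good (f x))%:R :> R.
  by rewrite -sum1_card big_mkcond natr_sum; apply: eq_bigr => x _; rewrite inE; case: (good _).
rewrite GE; have ImS (F : 'I_L -> R[i]) : \sum_(x < L) complex.Im (F x) = complex.Im (\sum_(x < L) F x).
  by rewrite (big_morph (@complex.Im R) (id1 := 0) (op1 := +%R)) // => - [? ?] [? ?].
have ReS (F : 'I_L -> R[i]) : \sum_(x < L) complex.Re (F x) = complex.Re (\sum_(x < L) F x).
  by rewrite (big_morph (@complex.Re R) (id1 := 0) (op1 := +%R)) // => - [? ?] [? ?].
have : \sum_(x < L) (1 / 4 + 3 / 4 * complex.Im (ee (f x)) - 1 / 4 * complex.Im (ee (3 * f x)) - 3 / 4 * complex.Re (ee (2 * f x)))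
   <= \sum_(x < L) 2 * (good (f x))%:R by apply: ler_sum => x _; apply: trig_minorant.
rewrite !sumrB !big_split /= -!mulr_sumr !ImS ReS sumr_const card_ord -[_ *+ L]mulr_natr.
have {}h1 : `|complex.Im (\sum_(x < L) ee (f x))| <= C1.
  apply: le_trans (proj2 (Re_Im_le _)) _; apply: le_trans (h1 L psi); rewrite le_eqVlt; apply/orP; left; apply/eqP.
  by congr nc; apply: eq_bigr => x _; rewrite mul1r.
have {}h2 : `|complex.Re (\sum_(x < L) ee (2 * f x))| <= C2 by apply: le_trans (proj1 (Re_Im_le _)) (h2 L psi).
have {}h3 : `|complex.Im (\sum_(x < L) ee (3 * f x))| <= C3 by apply: le_trans (proj2 (Re_Im_le _)) (h3 L psi).
move: h1 h2 h3; rewrite !ler_norml; set u1 := complex.Im (\sum_(x < L) ee (f x)).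
set u2 := complex.Re _; set u3 := complex.Im _; set g := \sum_(x < L) _.
move=> /andP[a1 a2] /andP[b1 b2] /andP[c1 c2] hg.
by clear -a1 a2 b1 b2 c1 c2 hg hL C10 C20 C30; clearbody u1 u2 u3 g; lra.
Qed.

(** The targets have length 1/4, so steps of at most 1/4 cannot jump over them, and an unbounded
    sequence must cross one on its way up or down. *)
Lemma step_target (R : realType) (w : nat -> R) (m0 : nat) :
  (forall m, (m0 <= m)%N -> `|w m.+1 - w m| <= 1 / 4) ->
  (forall B : R, exists m1 : nat, forall m, (m1 <= m)%N -> B <= `|w m|) ->
  forall N0 : nat, exists2 N, (N0 <= N)%N & exists z : int, z%:~R + 1 / 8 <= w N <= z%:~R + 3 / 8.
Proof.
move=> hs hinf N0; pose n0 := maxn N0 m0; pose z0 := Num.floor (w n0).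
have /andP[z1 z2] := floor_itv (w n0); rewrite -/z0 in z1 z2; rewrite intrD1 in z2.
have [m1 hm1] := hinf (`|w n0| + 3).
have := hm1 _ (leq_maxl m1 n0); set n1 := maxn m1 n0 => h1.
have n01 : (n0 <= n1)%N := leq_maxr _ _.
have st n : `|w (n0 + n).+1 - w (n0 + n)%N| <= 1 / 4.
  by apply: hs; apply: leq_trans (leq_maxr N0 m0) _; rewrite leq_addr.
have N0n n : (N0 <= n0 + n)%N by apply: leq_trans (leq_maxl N0 m0) _; rewrite leq_addr.
have [up|dn] : w n0 + 3 <= w n1 \/ w n1 <= w n0 - 3.
  have := ler_norm (w n0); have := ler_norm (- w n0); rewrite normrN => a1 a2.
  have [s|s] := ger0P (w n1); [left|right]; rewrite ?(ger0_norm s) ?(ltr0_norm s) in h1; lraw h1 a1 a2.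
  have [|[|n] hn least] := @least_nat (fun n => z0%:~R + 9 / 8 <= w (n0 + n)%N).
  - by exists (n1 - n0)%N; rewrite subnKC //; lraw up z1.
  - by exfalso; rewrite addn0 in hn; lraw hn z2.
  exists (n0 + n.+1)%N => //; exists (z0 + 1); rewrite intrD1.
  have := least n (ltnSn n) => /negP; rewrite -ltNge => h2; have := st n; rewrite -addnS ler_norml => /andP[_ h3].
  by apply/andP; split; [lraw hn|lraw h2 h3].
have [|[|n] hn least] := @least_nat (fun n => w (n0 + n)%N <= z0%:~R - 5 / 8).
- by exists (n1 - n0)%N; rewrite subnKC //; lraw dn z2.
- by exfalso; rewrite addn0 in hn; lraw hn z1.
exists (n0 + n.+1)%N => //; exists (z0 - 1); rewrite intrB.
have := least n (ltnSn n) => /negP; rewrite -ltNge => h2; have := st n; rewrite -addnS ler_norml => /andP[h3 _].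
by apply/andP; split; [lraw h2 h3|lraw hn].
Qed.

(** The graph argument for the integers [U m], with vertices restricted to a set [G] of density at
    least 1/16; [b] takes care of the parity of [q.[N]]. *)
Lemma poly_pairs (R : realType) (k r : nat) : (0 < r)%N -> exists2 Q0 : nat, (0 < Q0)%N &
  forall q s : {poly int}, q = 'X + Q0%:R *: s -> q`_1 = 1 -> size q = k.+2 -> 0 < lead_coef q ->
  forall eta1 : R, 0 < eta1 <= 1 -> exists (eta : R) (N0 : nat), 0 < eta <= eta1 /\
  forall N, (N0 <= N)%N ->
  let K := Num.truncn (eta * N%:R) in
  let U (m : nat) : int := q.[(N + m)%N%:R] - q.[N%:R] in
  exists L : nat, (N%:R * eta <= 4 * L%:R) /\
  forall (b : nat) (G : pred nat) (col : nat -> 'I_r), (b <= 1)%N ->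
    (L <= 16 * #|[pred x : 'I_L | G (x : nat).+1]|)%N ->
  exists m x y : nat, [/\ (m < K)%N, x != y, (0 < x)%N, (0 < y)%N & U m + b%:Z = (x + y)%N%:Z] /\
    [/\ G x, G y & col x = col y].
Proof.
(* Half of the lower bound 1/(256 r) for n/T below. *)
move=> r0; pose eps : R := 1 / (512 * r)%N%:R.
have rR : 0 < (512 * r)%N%:R :> R by rewrite ltr0n muln_gt0.
have eps0 : 0 < eps by rewrite divr_gt0.
have [Q0 Q00 small] := @poly_sum_small R k eps eps0; exists Q0 => // q s qE q1 sq lq eta1 heta1.
have [eta [N0 [/andP[eta0 etale] hsum]]] := small q s qE q1 sq lq eta1 heta1.
have [X [C [[X1 _ _ pos0] _]]] := @poly_tame R q k.+1 sq lq.
have [Nb _ hNb] := natr_above (X + (256 * r + 9)%N%:R / eta).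
exists eta, (maxn N0 Nb); split; first by rewrite eta0.
move=> N; rewrite geq_max => /andP[hN0 hN]; lazy zeta.
pose K := Num.truncn (eta * N%:R); rewrite -/K.
pose U (m : nat) : int := q.[(N + m)%N%:R] - q.[N%:R].
pose T := (absz (U K)).+1; have T0 : (0 < T)%N by [].
have hNR : X + (256 * r + 9)%N%:R / eta <= N%:R by apply: le_trans hNb _; rewrite ler_nat.
have q0 : 0 <= (256 * r + 9)%N%:R / eta by rewrite divr_ge0 // ltW.
have XN : X <= N%:R by lraw hNR q0.
have etaN : (256 * r + 9)%N%:R <= eta * N%:R.
  by rewrite mulrC -ler_pdivrMr //; lraw hNR X1.
have /andP[KE KE1] := truncn_itv (le_trans (ler0n _ _) etaN); rewrite -/K in KE KE1.
have KT : (256 * r + 9 <= K)%N by rewrite -ltnS -(ltr_nat R); apply: le_lt_trans etaN KE1.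
have Ustep i : U i < U i.+1.
  rewrite -subr_gt0 -(ltr_int R).
  have [|xi /andP[x1 x2]] := @mvt_closed R (polyders q 0) (polyders q 1) (N + i)%N%:R (N + i.+1)%N%:R
    _ (fun x _ => polyders_derive q 0 x); first by rewrite ler_nat leq_add2l.
  have -> : (N + i.+1)%N%:R - (N + i)%N%:R = 1 :> R by rewrite addnS -natr1 addrAC subrr add0r.
  rewrite !polyders_nat /U mulr1 => e.
  rewrite opprB addrA subrK intrB e; apply: pos0 => //; apply: le_trans XN (le_trans _ x1).
  by rewrite ler_nat leq_addr.
have Umono i j : (i <= j)%N -> U i + (j - i)%N%:Z <= U j.
  move=> ij; rewrite -{2}(subnKC ij); elim: (j - i)%N => [|n IH]; first by rewrite addr0 addn0.
  by have := Ustep (i + n)%N; rewrite addnS; clear -IH; lia.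
have U0 : U 0%N = 0 by rewrite /U addn0 subrr.
have UK : (T = absz (U K) + 1)%N /\ (absz (U K))%:Z = U K /\ K%:Z <= U K.
  have := Umono 0%N K (leq0n _); rewrite U0 subn0 add0r /T => h.
  by rewrite addn1 gez0_abs //; apply: le_trans h.
have TK : (K < T)%N by case: UK => [-> [h1 h2]]; clear -h1 h2; lia.
have TU : U K = T.-1%:Z by case: UK => [e [h1 _]]; rewrite -h1 e addn1.
(* Sums of two vertices up to [L] are at most [T.-1], the last value of [U], so [U m + b - x - y]
   stays strictly between -T and T. *)
pose L := (T.-1)./2; exists L.
have L2 : (2 * L <= T.-1)%N by rewrite /L mul2n -[leqRHS]odd_double_half leq_addl.
have L3 : (T <= 2 * L + 2)%N.
  have := odd_double_half T.-1; rewrite -/L -mul2n; have := leq_b1 (odd T.-1); have := prednK T0.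
  by move: (nat_of_bool _) => o; clearbody L; move: (T.-1) => w; clear; clearbody T; lia.
split.
  rewrite mulrC; apply: le_trans (ltW KE1) _; rewrite -natrM ler_nat.
  by move: L3 TK KT; clear; clearbody T L K; lia.
move=> b G col b1 hG.
have xT (x : 'I_L) : (x.+1 < T)%N.
  by have := ltn_ord x; move: (x : nat) => x'; clear -L2 T0; clearbody L T; lia.
pose V := [set x : 'I_T | [&& (0 < x)%N, (x <= L)%N & G x]]%SET.
have cV : (L <= 16 * #|V|)%N.
  apply: leq_trans hG _; rewrite leq_mul2l /=.
  have inj : injective (fun x : 'I_L => Ordinal (xT x)) by move=> x y /(congr1 val) /= [] /val_inj.
  rewrite -(fintype.card_image inj); apply: fintype.subset_leq_card; apply/fintype.subsetP => y /fintype.imageP[x]; rewrite !inE => Gx ->.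
  by rewrite /= Gx ltn_ord.
pose n := (#|V| %/ (2 * r))%N.
have r20 : (0 < 2 * r)%N by rewrite muln_gt0.
have nE := ltn_ceil #|V| r20; rewrite -/n in nE.
have nT : (T <= 256 * r * n)%N.
  have h1 : (#|V| < 2 * r * n.+1)%N by rewrite mulnC.
  by move: h1 cV L3 TK KT; move: #|V| => cv; clear -r0; clearbody n L T K; nia.
have n0 : (0 < n)%N by case: n nT {nE} => //; rewrite muln0 leqn0 => /eqP e; rewrite e in T0.
have nV : (2 * n * r <= #|V|)%N by apply: leq_trans (leq_trunc_div #|V| (2 * r)); rewrite -/n [leqRHS]mulnCA mulnA.
have [A [B [An Bn AV BV AB]]] := color_pair (fun x : 'I_T => col x) nV r0 n0.
have [||||m [x [y [mK xA yB E]]]] := @dense_hit_int R T K n (fun m => U m + b%:Z) eps A B T0 _ n0 (ltW eps0) An Bn.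
- by apply: leq_trans KT; rewrite addnS.
- rewrite /eps ltr_pdivrMr // mulrAC ltr_pdivlMr ?ltr0n // mul1r -natrM ltr_nat.
  by apply: leq_ltn_trans nT _; clear -n0 r0; nia.
- move=> j hj; apply: le_trans (hsum N hN0 j hj).
  rewrite le_eqVlt; apply/orP; left; apply/eqP; rewrite -[RHS](@expsum_cst R _ (j%:R * (b%:R / T%:R))); congr nc.
  by apply: eq_expsum => m _; rewrite -/(U m) -mulrDr -mulrDl intrD.
- move=> m x y mK /AV xV /BV yV; move: xV yV; rewrite !inE => /and3P[x0 xL _] /and3P[y0 yL _].
  have h1 := Umono 0%N m (leq0n _); rewrite U0 in h1; have h2 := Umono m K (ltnW mK); rewrite TU in h2.
  by move: h1 h2 x0 xL y0 yL b1 mK L2 T0; move: (U m) (x : nat) (y : nat) => u x' y'; clear; clearbody T L K; lia.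
have [xy cxy] := AB x y xA yB; have := AV x xA; have := BV y yB; rewrite !inE => /and3P[y0 _ Gy] /and3P[x0 _ Gx].
by exists m, x, y; split.
Qed.

(** * Local normal form of an integer valued polynomial *)

Lemma newton_poly (k : nat) (h : nat -> int) : 0 < h k ->
  exists P : {poly rat}, [/\ size P = k.+2, 0 < lead_coef P & forall n : nat, P.[n%:R] = (newton k.+1 h n)%:~R].
Proof.
move=> hk; pose c i : rat := (h i)%:~R / (i.+1)`!%:R.
have fR i : ((i)`!)%:R != 0 :> rat by rewrite pnatr_eq0 -lt0n fact_gt0.
have ck : 0 < c k by rewrite /c divr_gt0 ?ltr0z // ltr0n fact_gt0.
pose P := \sum_(i < k.+1) c i *: fallp rat i.+1.
have sk : size (c k *: fallp rat k.+1) = k.+2 by rewrite size_scale ?size_fallp // gt_eqF.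
have sl : (size (\sum_(i < k) c i *: fallp rat i.+1)%R < k.+2)%N.
  rewrite ltnS; apply: leq_trans (size_sum _ _ _) _; apply/bigmax_leqP => i _.
  by apply: leq_trans (size_scale_leq _ _) _; rewrite size_fallp ltnS.
exists P; rewrite /P; split.
- by rewrite big_ord_recr /= addrC size_polyDl sk.
- rewrite big_ord_recr /= lead_coefDr ?sk // lead_coefZ.
  by have /monicP -> := monic_fallp rat k.+1; rewrite mulr1.
- move=> n; rewrite horner_sum /newton rmorph_sum /=; apply: eq_bigr => i _.
  rewrite hornerZ fallp_eval -bin_ffact natrM /c [in RHS]intrM natz; field.
  exact: fR.
Qed.

(** Since (k + 1)! P has integer coefficients, dilation by (k + 1)! makes every coefficient of
    positive degree integral, and the constant one is P(0). *)
Lemma integral_dilation (k : nat) (P : {poly rat}) : size P = k.+2 -> 0 < lead_coef P ->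
  (forall n : nat, exists z : int, P.[n%:R] = z%:~R) ->
  exists Pi : {poly int}, [/\ size Pi = k.+2, 0 < lead_coef Pi &
    forall y : nat, (Pi.[y%:R])%:~R = P.[((k.+1)`! * y)%N%:R]].
Proof.
move=> sP lP intP; have [||Z hZ] := @int_valued_coef k.+1 P; first by rewrite sP.
  by move=> n; apply/intrP; apply: intP.
have [z0 hz0] := intP 0%N; rewrite -[0%:R]/(0 : rat) horner_coef0 in hz0.
set f := ((k.+1)`!)%N in hZ *; have f0 : (0 < f)%N by rewrite fact_gt0.
have hZi i : (Z`_i)%:~R = f%:R * P`_i.
  by have := congr1 (fun p : {poly rat} => p`_i) hZ; rewrite coefZ coef_map.
pose cf i : int := if i is j.+1 then f%:R ^+ j * Z`_i else z0.
have cfE i : (cf i)%:~R = P`_i * f%:R ^+ i :> rat.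
  case: i => [|i] /=; first by rewrite mulr1 hz0.
  by rewrite intrM hZi rmorphXn /= rmorph_nat exprSr; ring.
have cfk : 0 < cf k.+1.
  by rewrite -(ltr_int rat) cfE mulr_gt0 ?exprn_gt0 ?ltr0n //; move: lP; rewrite lead_coefE sP.
exists (\poly_(i < k.+2) cf i); split.
- by rewrite size_poly_eq // gt_eqF.
- by rewrite lead_coef_poly // gt_eqF.
- move=> y; rewrite horner_poly rmorph_sum /= horner_coef sP; apply: eq_bigr => i _.
  by rewrite intrM cfE rmorphXn /= rmorph_nat natrM exprMn mulrA.
Qed.

(** Taylor expansion at a point where the derivative is [d > 0]. With step d Q, Q = Q0 w, the linear
    term is d^2 Q t and all higher terms are divisible by d^2 Q^2, so division by d^2 Q leaves t
    plus a multiple of Q t^2. *)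
Lemma local_poly (R : realType) (k : nat) (Pi : {poly int}) : size Pi = k.+2 -> 0 < lead_coef Pi ->
  exists y0 d : nat, (0 < d)%N /\ forall Q0 w : nat, (0 < Q0)%N -> (0 < w)%N ->
  exists q s : {poly int}, [/\ q = 'X + Q0%:R *: s, q`_1 = 1, size q = k.+2, 0 < lead_coef q &
    forall t : nat, Pi.[(y0 + d * (Q0 * w) * t)%N%:R] = Pi.[y0%:R] + (d * d * (Q0 * w))%N%:R * q.[t%:R]].
Proof.
move=> sP lP; have [X [C [[X1 _ _ pos0] _]]] := @poly_tame R Pi k.+1 sP lP.
have [y0 _ hy0] := natr_above X.
have dpos : 0 < Pi^`().[y0%:R].
  have := pos0 1%N y0%:R isT hy0; rewrite /polyders derivn_map derivn1.
  by rewrite -(rmorph_nat (intr : {rmorphism int -> R})) horner_map /= ltr0z.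
pose d := absz Pi^`().[y0%:R]; have dE : d%:R = Pi^`().[y0%:R] by rewrite natz gez0_abs // ltW.
have d0 : (0 < d)%N by rewrite absz_gt0 gt_eqF.
exists y0, d; split=> // Q0 w Q00 w0; set Q := (Q0 * w)%N.
have Q0' : (0 < Q)%N by rewrite muln_gt0 Q00.
pose P1 := Pi \Po ('X + (y0%:R)%:P); pose tau := drop_poly 2 P1.
pose L : {poly int} := (d * Q)%N%:R *: 'X.
have dQ0 : (d * Q)%N%:R != 0 :> int by rewrite pnatr_eq0 -lt0n muln_gt0 d0.
have sX : size ('X + (y0%:R)%:P : {poly int}) = 2 by rewrite size_XaddC.
have sL : size L = 2 by rewrite size_scale // size_polyX.
have P10 : P1`_0 = Pi.[y0%:R] by rewrite -horner_coef0 horner_comp !hornerE.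
have P11 : P1`_1 = d%:R.
  have := coef_deriv P1 0; rewrite mulr1n => <-.
  by rewrite -horner_coef0 deriv_comp hornerM horner_comp derivD derivX derivC addr0 !hornerE dE.
have P1E : P1 = (Pi.[y0%:R])%:P + d%:R *: 'X + tau * 'X^2.
  rewrite -{1}(poly_take_drop 2 P1); congr (_ + _); apply/polyP => i.
  by rewrite coef_take_poly coefD coefC coefZ coefX; case: i => [|[|i]] /=; rewrite ?P10 ?P11 ?mulr0 ?mulr1 ?addr0 ?add0r.
pose q := 'X + Q%:R *: ('X^2 * (tau \Po L)).
have qP : (d * d * Q)%N%:R *: q = P1 \Po L - (Pi.[y0%:R])%:P.
  rewrite P1E !comp_polyD comp_polyC comp_polyZ comp_polyX comp_polyM comp_Xn_poly.
  have -> (u v x : {poly int}) : u + v + x - u = v + x by ring.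
  rewrite /q /L scalerDr exprZn !scalerA -scalerAr ['X^2 * _]mulrC; congr (_ *: _ + _ *: _).
    by rewrite -natrM mulnA.
  by rewrite -!natrM -natrX; congr (_%:R); ring.
have D0 : (d * d * Q)%N%:R != 0 :> int by rewrite pnatr_eq0 -lt0n !muln_gt0 d0 Q00 w0.
have sP1L : size (P1 \Po L) = k.+2 by rewrite !size_comp_poly2.
have sc : (size (- (Pi.[y0%:R])%:P : {poly int}) < size (P1 \Po L))%N.
  by rewrite sP1L size_polyN (leq_ltn_trans (size_polyC_leq1 _)).
exists q, (w%:R *: ('X^2 * (tau \Po L))); split.
- by rewrite /q scalerA -natrM.
- by rewrite coefD coefX coefZ coefXnM mulr0 addr0.
- by rewrite -(size_scale q D0) qP size_polyDl.
- have := congr1 (fun p : {poly int} => lead_coef p) qP; rewrite lead_coefZ (lead_coefDl sc).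
  rewrite lead_coef_comp ?sL // lead_coef_comp ?sX // lead_coefXaddC expr1n mulr1 => e.
  rewrite -(pmulr_rgt0 _ (_ : 0 < (d * d * Q)%N%:R)); last by rewrite ltr0n !muln_gt0 d0 Q00 w0.
  rewrite e mulr_gt0 // exprn_gt0 // lead_coefZ lead_coefX mulr1 ltr0n muln_gt0 d0 //.
- move=> t; have := congr1 (fun p : {poly int} => p.[t%:R]) qP; rewrite hornerZ => ->.
  rewrite hornerD hornerN hornerC addrC subrK !horner_comp !hornerE; congr (Pi.[_]).
  by rewrite -natrM -natrD addnC.
Qed.

Lemma decay_var (R : realType) (be : nat -> R) (D : R) : 0 <= D ->
  (forall m, `|dl be m| <= D / m.+1%:R) -> forall m j, `|be (m + j)%N - be m| <= j%:R * (D / m.+1%:R).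
Proof.
move=> D0 hbe m j; rewrite telescope_dl; apply: le_trans (ler_norm_sum _ _ _) _.
rewrite mulrC mulr_natr -[X in _ *+ X]card_ord -sumr_const; apply: ler_sum => i _.
apply: le_trans (hbe _) _; rewrite ler_wpM2l // lef_pV2 ?posrE ?ltr0n // ler_nat ltnS leq_addr //.
Qed.

Lemma ee_eq1 (R : realType) (s : R) : ee s = 1 -> exists z : int, s = z%:~R.
Proof.
move=> hs; have [A _ hA] := nearest_int s; exists A; apply/eqP; rewrite -subr_eq0 -normr_le0.
by apply: le_trans hA _; rewrite hs subrr nc0 mulr0.
Qed.

(** For rational [lam] the factor [w] contains its denominator; for irrational [lam] no multiple of
    the slope is an integer. A slope of at least 1 later separates the integer parts. *)
Lemma scale_choice (R : realType) (lam : R) (c : nat) : 0 < lam -> (0 < c)%N ->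
  exists2 w : nat, (0 < w)%N & 1 <= lam * (c * w)%N%:R /\
  ((forall h : nat, (0 < h <= 3)%N -> ee (h%:R * (lam * (c * w)%N%:R)) != 1) \/
   (exists z : int, lam * (c * w)%N%:R = z%:~R) /\ exists v : rat, lam = ratr v).
Proof.
move=> lam0 c0; have [w1 w10 hw1] := natr_above lam^-1.
have big w : (w1 <= w)%N -> 1 <= lam * (c * w)%N%:R.
  move=> ww; rewrite mulrC -ler_pdivrMr // mul1r; apply: le_trans hw1 _; rewrite ler_nat.
  by apply: leq_trans ww _; rewrite leq_pmull.
have [[v vE]|nv] := pselect (exists v : rat, lam = ratr v).
  have dn : (0 < absz (denq v))%N by rewrite absz_gt0 denq_neq0.
  exists (w1 * absz (denq v))%N; first by rewrite muln_gt0 w10.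
  split; first by apply: big; rewrite leq_pmulr.
  right; split; last by exists v.
  exists ((c * w1)%N%:Z * numq v); rewrite vE -(ratr_nat R) -(ratr_int R) -(rmorphM (@ratr R)); congr ratr.
  rewrite -{1}[v]divq_num_den mulnA natrM.
  have -> : (absz (denq v))%:R = (denq v)%:~R :> rat by rewrite -{2}(gez0_abs (denq_ge0 v)).
  by rewrite intrM; field; rewrite intr_eq0 denq_neq0.
exists w1 => //; split; first exact: big.
left=> h /andP[h0 _]; apply/eqP => /ee_eq1[z hz]; apply: nv.
exists (z%:~R / (h * (c * w1))%N%:R); rewrite fmorph_div /= ratr_int ratr_nat -hz.
rewrite [in RHS]natrM; field; rewrite !pnatr_eq0 -!lt0n ?muln_gt0 h0 c0 w10 //.
Qed.

Lemma floor_good (R : realType) (v : R) : good v ->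
  exists2 e : R, 1 / 16 <= e <= 7 / 16 & v = (Num.floor v)%:~R + e.
Proof.
move=> /asboolP[z /andP[z1 z2]]; exists (v - (Num.floor v)%:~R); last by rewrite addrC subrK.
rewrite (@floor_intro _ v z); last by apply/andP; split; [lraw z1|lraw z2].
by apply/andP; split; [lraw z1|lraw z2].
Qed.

Lemma good_int (R : realType) (v : R) (z : int) : z%:~R + 1 / 8 <= v <= z%:~R + 3 / 8 -> good v.
Proof. by move=> /andP[h1 h2]; apply/asboolP; exists z; apply/andP; split; [lraw h1|lraw h2]. Qed.

Lemma poly_case (R : realType) (a : R -> R) (k p n0 : nat) (lam D : R) (h : nat -> int)
  (r : nat) (color : nat -> 'I_r) :
  (0 < p)%N -> (0 < n0)%N -> 0 < lam -> 0 <= D -> 0 < h k ->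
  (forall m, `|dl (fun m => a (n0 + p * m)%N%:R - lam * (newton k.+1 h m)%:~R) m| <= D / m.+1%:R) ->
  (forall c, evt (fun x => c <= a x)) ->
  (forall (P : {poly rat}) (c : R), evt (fun x => c <= `|a x - (map_poly ratr P).[x]|)) ->
  exists x y n : nat, [/\ (0 < x)%N, (0 < y)%N & (0 < n)%N] /\
     [/\ x <> y, color x = color y & (x + y)%:Z = Num.floor (a n%:R)].
Proof.
move=> p0 n00 lam0 D0 hk hbe ainf far.
have r0 : (0 < r)%N by case: r color => // color; case: (color 0%N).
have [P [sP lP hP]] := newton_poly hk.
have [|Pi [sPi lPi hPi]] := integral_dilation sP lP.
  by move=> n; exists (newton k.+1 h n).
set f := ((k.+1)`!)%N in hPi; have f0 : (0 < f)%N by rewrite fact_gt0.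
have PiE y : newton k.+1 h (f * y) = Pi.[y%:R].
  by apply/eqP; rewrite -(eqr_int rat) hPi hP.
have [y0 [d [d0 loc]]] := local_poly R sPi lPi.
have [Q0 Q00 pairs] := @poly_pairs R k r r0.
have [|w w0 [phi1 hcase]] := @scale_choice R lam (d * d * Q0) lam0; first by rewrite !muln_gt0 d0.
have [q [s [qE q1 sq lq ev]]] := loc Q0 w Q00 w0.
rewrite -[(d * d * Q0 * w)%N]mulnA in phi1 hcase.
set phi := lam * _ in phi1 hcase.
pose be m := a (n0 + p * m)%N%:R - lam * (newton k.+1 h m)%:~R.
pose e := (d * (Q0 * w))%N; have e0 : (0 < e)%N by rewrite !muln_gt0 d0 Q00.
pose mm t := (f * (y0 + e * t))%N; pose nn t := (n0 + p * mm t)%N.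
pose Pi0 : R := lam * (Pi.[y0%:R])%:~R.
have aE t : a (nn t)%:R = Pi0 + phi * (q.[t%:R])%:~R + be (mm t).
  rewrite /be -/(nn t) /mm PiE ev intrD intrM rmorph_nat /Pi0 /phi; ring.
have mmD t m : mm (t + m)%N = (mm t + f * e * m)%N by rewrite /mm; ring.
have mm_ge t : (f * e * t <= mm t)%N by rewrite /mm mulnDr -mulnA leq_addl.
have fe0 : (0 < f * e)%N by rewrite muln_gt0 f0.
have tmm t : (t <= mm t)%N by apply: leq_trans (mm_ge t); rewrite leq_pmull.
have tnn t : (t <= nn t)%N.
  by apply: leq_trans (tmm t) _; apply: leq_trans (leq_addl _ _); rewrite leq_pmull.
have var := decay_var D0 hbe.
(* Keeps the variation of [be] over the window below 1/16. *)
pose eta1 : R := 1 / (16 * (D + 1)).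
have heta1 : 0 < eta1 <= 1.
  by rewrite /eta1 divr_gt0 ?mulr_gt0 ?ltr_wpDl // ler_pdivrMr ?mulr_gt0 ?ltr_wpDl //; lraw D0.
have [eta [N1 [/andP[eta0 etale] hpair]]] := pairs q s qE q1 sq lq eta1 heta1.
(* Half of the constant part: if the two indices add up to q(t), then [v N x + v N y] is
   [phi * q(t) + Pi0 + be (mm N)]. *)
pose rho N : R := (Pi0 + be (mm N)) / 2.
pose i0 N := (absz q.[N%:R] %/ 2)%N.
pose v N x := phi * (i0 N + x)%N%:R + rho N.
have find Nmin : exists2 N, (Nmin <= N)%N & forall L : nat, N%:R * eta <= 4 * L%:R ->
    (L <= 16 * #|[pred x : 'I_L | good (v N (x : nat).+1)]|)%N.
  case: hcase => [irr|[[z hz] [v0 v0E]]].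
    have [L0 hL0] := good_density irr; have [N2 _ hN2] := natr_above (4 * L0%:R / eta).
    exists (maxn Nmin N2) => [|L hL]; first exact: leq_maxl.
    set N := maxn _ _ in hL *.
    have LL : (L0 <= L)%N.
      rewrite -(ler_nat R) -(ler_pM2l (_ : 0 < 4)) //; apply: le_trans hL; rewrite -ler_pdivrMr //.
      by apply: le_trans hN2 _; rewrite ler_nat leq_maxr.
    apply: leq_trans (hL0 L (phi * (i0 N)%:R + rho N) LL) _.
    rewrite leq_mul2l /=; apply: fintype.subset_leq_card; apply/fintype.subsetP => x; rewrite !inE /v natrD mulrDr.
    by rewrite addrA [phi * (i0 N)%:R + _]addrC.
  (* The rational polynomial that takes the value [lam * newton] at [nn t]; by [far], [be] is
     unbounded. As [phi] is an integer, all [v N x] agree with [rho N] modulo 1, so it suffices to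
     steer [rho]. *)
  pose Pq : {poly rat} := v0 *: (P \Po ((p%:R)^-1 *: ('X - (n0%:R)%:P))).
  have PqE t : (map_poly ratr Pq).[(nn t)%:R] = lam * (newton k.+1 h (mm t))%:~R :> R.
    rewrite -(ratr_nat R) horner_map /= /Pq hornerZ horner_comp !hornerE natrD addrAC subrr add0r natrM mulKf; last first.
      by rewrite pnatr_eq0 -lt0n.
    by rewrite hP (rmorphM (@ratr R)) /= ratr_int -v0E.
  have [N2 _ hN2] := natr_above ((f * e)%N%:R * D * 2).
  have [||N NN [z' hz']] := @step_target R rho N2 _ _ Nmin.
  - move=> m N2m; rewrite /rho -mulrBl opprD addrACA subrr add0r normrM [`|2^-1|]ger0_norm // -addn1 mmD muln1.
    have h1 : `|be (mm m + f * e)%N - be (mm m)| <= _ := var (mm m) (f * e)%N.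
    have h2 : (f * e)%N%:R * (D / (mm m).+1%:R) * 2 <= 1.
      rewrite mulrA mulrAC ler_pdivrMr ?ltr0n // mul1r; apply: le_trans hN2 _; rewrite ler_nat.
      by apply: leq_trans N2m _; apply: leq_trans (tmm m) _.
    by move: h1 h2; move: ((f * e)%N%:R * (D / (mm m).+1%:R)) `|_| => u u' h1 h2; lraw h1 h2.
  - move=> B; have [X hX] := far Pq (2 * B + `|Pi0|); have [m1 _ hm1] := natr_above X.
    exists m1 => m mm1; have : X <= (nn m)%:R.
      by apply: le_trans hm1 _; rewrite ler_nat; apply: leq_trans (tnn m).
    move=> /hX; rewrite PqE -/(be _) => h1.
    rewrite /rho normrM [`|2^-1|]ger0_norm // ler_pdivlMr // mulrC.
    have := ler_normB (Pi0 + be (mm m)) Pi0; rewrite [Pi0 + _]addrC addrK => h2.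
    by lraw h1 h2.
  exists N => // L _; rewrite [#|_|](_ : _ = L) ?leq_pmull // -[RHS]card_ord; apply: eq_card => x.
  rewrite !inE; apply: (@good_int _ _ (z * (i0 N + x.+1)%N%:Z + z')).
  by rewrite /v hz intrD intrM -!addrA !lerD2l.
(* The margin [phi + 4] gives [v N u >= 2], hence positive integer parts. *)
have [X hX] := ainf (phi + 4); have [N2 _ hN2] := natr_above X.
have [X3 [C3 ta]] := @poly_tame R q k.+1 sq lq.
have [[X31 _ _ pos3] _] := ta; have [N3 _ hN3] := natr_above X3.
have [N] := find (maxn N1 (maxn N2 (maxn N3 1))); rewrite !geq_max => /and4P[NN1 NN2 NN3 NN4] hgood.
have [L [hL hcol]] := hpair N NN1.
have qN : 0 < q.[N%:R].
  rewrite -(ltr_int R) -polyders_nat; apply: pos3 => //.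
  by apply: le_trans hN3 _; rewrite ler_nat.
pose b := odd (absz q.[N%:R]).
have qNE : q.[N%:R] = (2 * i0 N + b)%N%:Z.
  by rewrite -{1}(gez0_abs (ltW qN)) /i0 /b divn2 mul2n addnC odd_double_half.
have [m [x [y [[mK xy x0 y0' E] [Gx Gy Cxy]]]]] :=
  hcol b (fun x => good (v N x)) (fun x => color (absz (Num.floor (v N x)))) (leq_b1 _) (hgood L hL).
pose t := (N + m)%N.
have qt : q.[t%:R] = (i0 N + x)%N%:Z + (i0 N + y)%N%:Z.
  by move: E; rewrite qNE -/t => E; clear -E; lia.
have [ex /andP[ex1 ex2] vx] := floor_good Gx; have [ey /andP[ey1 ey2] vy] := floor_good Gy.
set zx := Num.floor (v N x) in vx Cxy; set zy := Num.floor (v N y) in vy Cxy.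
have dif : `|be (mm t) - be (mm N)| <= 1 / 16.
  rewrite /t mmD; apply: le_trans (var _ _) _.
  have NR : 0 < N%:R :> R by rewrite ltr0n.
  have mN : m%:R <= eta * N%:R.
    apply: le_trans (_ : (Num.truncn (eta * N%:R))%:R <= _); first by rewrite ler_nat ltnW.
    by rewrite truncn_le mulr_ge0 // ltW.
  have m1 : (f * e)%N%:R * N%:R <= (mm N).+1%:R :> R.
    by rewrite -natrM ler_nat; apply: leq_trans (mm_ge N) _.
  rewrite mulrA ler_pdivrMr ?ltr0n //; apply: le_trans (_ : 1 / 16 * ((f * e)%N%:R * N%:R) <= _); last first.
    by rewrite ler_pM2l //; lra.
  rewrite natrM -mulrA [leRHS]mulrCA ler_pM2l ?ltr0n //.
  have h1 : eta * (16 * (D + 1)) <= 1.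
    by move: etale; rewrite /eta1 ler_pdivlMr // mulr_gt0 // ltr_wpDl.
  have h2 : D * m%:R <= D * (eta * N%:R) by rewrite ler_wpM2l.
  have h3 : D * (eta * N%:R) <= (D + 1) * (eta * N%:R) by rewrite ler_wpM2r ?lerDl // mulr_ge0 // ltW.
  have h4 : (eta * (16 * (D + 1))) * N%:R <= 1 * N%:R by rewrite ler_pM2r.
  have h5 : (eta * (16 * (D + 1))) * N%:R = 16 * ((D + 1) * (eta * N%:R)) by ring.
  by rewrite h5 in h4; lraw h2 h3 h4.
(* The error is ex + ey, in [1/8, 7/8], plus at most 1/16 from [be], so it stays inside (0, 1). *)
have tot : a (nn t)%:R = (zx + zy)%:~R + (ex + ey + (be (mm t) - be (mm N))).
  rewrite aE qt; have -> : phi * ((i0 N + x)%N%:Z + (i0 N + y)%N%:Z)%:~R = v N x + v N y - 2 * rho N.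
    by rewrite /v intrD; ring.
  by rewrite vx vy /rho intrD; field.
have low u : 2 <= v N u.
  have XN : X <= (nn N)%:R by apply: le_trans hN2 _; rewrite ler_nat; apply: leq_trans (tnn N).
  have := hX _ XN; rewrite aE qNE => h1.
  have h2 : 2 * v N u = phi * (2 * i0 N + b)%N%:Z%:~R + Pi0 + be (mm N) - phi * b%:R + 2 * phi * u%:R.
    have -> : (2 * i0 N + b)%N%:Z%:~R = 2 * (i0 N)%:R + b%:R :> R by rewrite -pmulrn natrD natrM.
    by rewrite /v /rho natrD; field.
  have h3 : phi * b%:R <= phi * 1 by rewrite ler_wpM2l ?lern1 ?leq_b1 //; lraw phi1.
  have h4 : 0 <= 2 * phi * u%:R by rewrite mulr_ge0 ?ler0n //; lraw phi1.
  by lraw h1 h2 h3 h4.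
have zpos u : 0 < Num.floor (v N u).
  have /andP[_] := floor_itv (v N u); rewrite intrD1 -(ltr_int R) => h1.
  by have h2 := low u; lraw h1 h2.
have zx0 : 0 < zx := zpos x; have zy0 : 0 < zy := zpos y.
exists (absz zx), (absz zy), (nn t); split.
  by rewrite !absz_gt0 !gt_eqF // addn_gt0 n00.
split=> //.
  (* Equal integer parts would put [v N x] and [v N y] within 6/16, yet they differ by at least
     [phi >= 1]. *)
  move=> zz; have {}zz : zx = zy by rewrite -(gez0_abs (ltW zx0)) -(gez0_abs (ltW zy0)) zz.
  have vxy : v N x - v N y = ex - ey by rewrite vx vy zz; ring.
  have : phi * (x%:R - y%:R) = ex - ey by rewrite -vxy /v !natrD; ring.
  move=> h1; have h2 : 1 <= `|x%:R - y%:R| :> R.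
    have -> : x%:R - y%:R = (x%:Z - y%:Z)%:~R :> R by rewrite intrB.
    rewrite -intr_norm ler1z -gtz0_ge1 normr_gt0 subr_eq0.
    by apply: contra xy => /eqP[->].
  have : phi * `|x%:R - y%:R| = `|ex - ey|.
    by rewrite -h1 normrM gtr0_norm //; lraw phi1.
  have h3 : `|ex - ey| <= 6 / 16 by rewrite ler_norml; apply/andP; split; [lraw ex1 ey2|lraw ex2 ey1].
  have h4 : 1 <= phi * `|x%:R - y%:R| by rewrite -[leLHS]mulr1; apply: ler_pM.
  by move=> h5; rewrite h5 in h4; lraw h3 h4.
rewrite tot PoszD !gez0_abs ?ltW //; apply/esym; apply: floor_intro.
move: dif; rewrite ler_norml => /andP[g1 g2].
by apply/andP; split; [lraw ex1 ey1 g1|lraw ex2 ey2 g2].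
Qed.

(** Two of the r + 1 numbers from m0 to m0 + r share a colour; at the first index where [a 0]
    reaches their sum, it exceeds the sum by less than 1/2. *)
Lemma slow_case (R : realType) (a : nat -> R -> R) (X C : R) (r : nat) (color : nat -> 'I_r) :
  tame 0 a X C -> (forall c, evt (fun x => c <= a 0%N x)) ->
  exists x y n : nat, [/\ (0 < x)%N, (0 < y)%N & (0 < n)%N] /\
     [/\ x <> y, color x = color y & (x + y)%:Z = Num.floor (a 0%N n%:R)].
Proof.
move=> [[_ _ der _] [_ [small _ _]]] ainf.
have [|Y hY] := small (1 / 2); first by rewrite divr_gt0.
have [N0 N00 hN0] := natr_above (`|X| + `|Y|).
have XN : X <= N0%:R by have := ler_norm X; have := normr_ge0 Y; move=> *; lra.
have YN : Y <= N0%:R by have := ler_norm Y; have := normr_ge0 X; move=> *; lra.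
have st n : a 0%N (N0 + n.+1)%N%:R - a 0%N (N0 + n)%N%:R <= 1 / 2.
  have N0n : N0%:R <= (N0 + n)%N%:R :> R by rewrite ler_nat leq_addr.
  have [||xi /andP[x1 x2] ->] := @mvt_closed R (a 0%N) (a 1%N) (N0 + n)%N%:R (N0 + n.+1)%N%:R.
  - by rewrite ler_nat leq_add2l.
  - by move=> x /andP[x1 _]; apply: der => //; lra.
  rewrite addnS -natr1 addrAC subrr add0r mulr1; apply: le_trans (ler_norm _) _.
  by apply: hY; lra.
have [m0 m00 hm0] := natr_above (a 0%N N0%:R + 1).
have [i [j [ij cij]]] : exists i j : 'I_r.+1, i != j /\ color (m0 + i)%N = color (m0 + j)%N.
  apply: contrapT => no; have inj : injective (fun i : 'I_r.+1 => color (m0 + i)%N).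
    move=> i j cij; apply/eqP; rewrite -[_ == _]negbK; apply/negP => ij.
    by apply: no; exists i, j.
  by have := leq_card _ inj; rewrite !card_ord ltnn.
pose z := (m0 + i + (m0 + j))%N.
have zm : m0%:R <= z%:R :> R by rewrite ler_nat /z -addnA leq_addr.
have [|[|n] hn least] := @least_nat (fun n => z%:R <= a 0%N (N0 + n)%N%:R).
- have [W hW] := ainf z%:R; have [w _ hw] := natr_above W; exists w; apply: hW.
  by apply: le_trans hw _; rewrite ler_nat leq_addl.
- by exfalso; rewrite addn0 in hn; lra.
exists (m0 + i)%N, (m0 + j)%N, (N0 + n.+1)%N; split; first by rewrite !addn_gt0 m00 N00.
split=> //; first by move/addnI/val_inj => e; rewrite e eqxx in ij.
have h1 := st n; have /negP := least n (ltnSn n); rewrite -ltNge => h2.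
apply/esym/floor_intro; rewrite -/z -pmulrn hn /=; lra.
Qed.
Unset Implicit Arguments.

Theorem theorem1p2 (R : realType) (alpha : R -> R)
  (alpha_subpoly : sub_polynomial alpha)
  (alpha_pinfty : alpha x @[x --> +oo] --> +oo)
  (alpha_far : forall p : {poly rat},
     `|alpha x - (map_poly ratr p).[x]| @[x --> +oo] --> +oo)
  (r : nat) (color : nat -> 'I_r) :
  exists x y n : nat,
    [/\ (0 < x)%N, (0 < y)%N & (0 < n)%N] /\
    [/\ x <> y, color x = color y & (x + y)%:Z = Num.floor (alpha n%:R)].
Proof.
have ainf c : evt (fun x => c <= ders alpha 0 x).
  by apply: evt_near; move/cvgryPge: alpha_pinfty => /(_ c).
have far (P : {poly rat}) c : evt (fun x => c <= `|alpha x - (map_poly ratr P).[x]|).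
  by apply: evt_near; move/cvgryPge: (alpha_far P) => /(_ c).
have [k [X [C ta]]] := hardy_tame alpha_subpoly alpha_pinfty.
case: k ta => [|k] ta; first exact: slow_case ta ainf.
apply: contrapT => nos.
have [p [n0 [lam [D [h [[p0 n00 lam0 D0 hk] hbe]]]]]] := near_polynomial ta ainf nos.
exact: nos (poly_case color p0 n00 lam0 D0 hk hbe ainf far).
Qed.
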